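(* Let $p$ be a prime, $G=\mathrm{U}(1,1)(\mathbb{Q}_{p^2}/\mathbb{Q}_p)$ with diagonal torus $T$ and upper-triangular Borel subgroup $B$. Let $E/\mathbb{Q}_p$ be a finite extension with ring of integers $\mathcal{O}$ and residue field $k$, and let $\overline\chi:G\to k^\times$ be a smooth character. Then the natural transformation $$\mathrm{St}_B^G:\mathrm{Def}_{\overline\chi}\to\mathrm{Def}_{\mathrm{St}_G\otimes\overline\chi}$$ of functors on $\mathrm{Art}(\mathcal{O})$, sending (the class of) a lift $\sigma:G\to A^\times$ of $\overline\chi$ to (the class of) $\mathrm{St}_B^G(\sigma)=\mathrm{Ind}_B^G(\sigma|_T)/\sigma$, is an isomorphism of functors.
   Context: $G=\{g\in\mathrm{GL}_2(\mathbb{Q}_{p^2}) : c(g)^tJg=J\}$ where $c$ is the nontrivial automorphism of the unramified quadratic extension $\mathbb{Q}_{p^2}/\mathbb{Q}_p$ and $J=\begin{pmatrix}0&1\\1&0\end{pmatrix}$; $T$ is the diagonal subgroup and $B=TU$ the upper-triangular subgroup of $G$, $U$ its unipotent radical. For a smooth character $\sigma|_T$ of $T$ with values in $A^\times$ (inflated to $B$ trivially on $U$), $\mathrm{Ind}_B^G(\sigma|_T)$ is the smooth induction (locally constant-on-the-right functions $f:G\to A$ with $f(bg)=\sigma(b)f(g)$, $G$ acting by right translation); when $\sigma|_T$ extends to the character $\sigma$ of $G$, the line of functions $g\mapsto a\sigma(g)$ is a subrepresentation isomorphic to $\sigma$, and $\mathrm{St}_B^G(\sigma)$ is the quotient. Over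 $k$, $\mathrm{St}_G=\mathrm{Ind}_B^G(\mathbf{1})/\mathbf{1}$ is the Steinberg representation and $\mathrm{St}_B^G(\overline\chi)\cong\mathrm{St}_G\otimes\overline\chi$. $\mathrm{Art}(\mathcal{O})$ is the category of local Artinian $\mathcal{O}$-algebras with residue field identified with $k$ via the structure map, with local $\mathcal{O}$-algebra morphisms. For a smooth representation $\overline\pi$ of $G$ over $k$, a lift to $A\in\mathrm{Art}(\mathcal{O})$ is a pair $(\pi,\phi)$ with $\pi$ a smooth $A[G]$-module free over $A$ and $\phi:\pi\to\overline\pi$ an $A[G]$-linear surjection inducing $\pi\otimes_Ak\cong\overline\pi$; $\mathrm{Def}_{\overline\pi}(A)$ is the set of isomorphism classes of lifts (isomorphisms compatible with the $\phi$'s). *)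

(* Defs.v *)
From HB Require Import structures.
From mathcomp Require Import all_boot all_order all_algebra all_field.
From mathcomp Require Import all_classical topology_structure.

Set Implicit Arguments.
Unset Strict Implicit.
Unset Printing Implicit Defensive.

Import Order.TTheory GRing.Theory Num.Theory.

Local Open Scope classical_set_scope.
Local Open Scope ring_scope.
Local Open Scope quotient_scope.

Definition padic_val (p : nat) (q : rat) : int :=
  (logn p `|numq q|%N)%:Z - (logn p `|denq q|%N)%:Z.

Definition padic_abs (p : nat) (q : rat) : rat :=
  if q == 0 then 0 else p%:R ^ (- padic_val p q).

(* A completion of Q for the p-adic absolute value, unique up to a unique
   isomorphism.  The absolute value of Q_p takes its values in p^Z and 0, hence
   the codomain rat. *)
Record padicField (p : nat) := PadicField {
  padic_sort :> fieldType;
  padic_norm : padic_sort -> rat;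
  padic_norm_eq0 : forall x, (padic_norm x == 0) = (x == 0);
  padic_normM : forall x y, padic_norm (x * y) = padic_norm x * padic_norm y;
  padic_normD : forall x y,
    padic_norm (x + y) <= Num.max (padic_norm x) (padic_norm y);
  padic_norm_ratr : forall q : rat, padic_norm (ratr q) = padic_abs p q;
  padic_dense : forall (x : padic_sort) (e : rat), 0 < e ->
    exists q : rat, padic_norm (x - ratr q) < e;
  padic_complete : forall u : nat -> padic_sort,
    (forall e : rat, 0 < e -> exists N, forall m n, (N <= m)%N -> (N <= n)%N ->
       padic_norm (u m - u n) < e) ->
    exists l, forall e : rat, 0 < e -> exists N, forall n, (N <= n)%N ->
       padic_norm (u n - l) < e
}.

Section PadicIntegers.
Variables (p : nat) (Qp : padicField p).

Definition padic_int : {pred Qp} := [pred x | padic_norm x <= 1].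

Lemma padic_norm1 : padic_norm (1 : Qp) = 1.
Proof.
have n1 : padic_norm (1 : Qp) != 0 by rewrite padic_norm_eq0 oner_eq0.
by apply: (mulfI n1); rewrite -padic_normM !mulr1.
Qed.

Lemma padic_normN1 : padic_norm (-1 : Qp) = 1.
Proof.
have := padic_norm_ratr Qp (-1)%:~R; rewrite ratr_int mulrN1z => ->.
by rewrite /padic_abs /padic_val /= !logn1 subrr oppr0 expr0z.
Qed.

Lemma padic_norm_ge0 (x : Qp) : 0 <= padic_norm x.
Proof.
have /eqP n0 : padic_norm (0 : Qp) == 0 by rewrite padic_norm_eq0.
have := padic_normD x (- x).
by rewrite subrr n0 -mulN1r padic_normM padic_normN1 mul1r maxxx.
Qed.

Fact padic_int_subring : subring_closed padic_int.
Proof.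
split; rewrite ?inE ?padic_norm1 // => x y; rewrite !inE => hx hy.
  apply: le_trans (padic_normD _ _) _.
  by rewrite ge_max hx -mulN1r padic_normM padic_normN1 mul1r.
by rewrite padic_normM mulr_ile1 ?padic_norm_ge0.
Qed.
HB.instance Definition _ :=
  GRing.isSubringClosed.Build Qp padic_int padic_int_subring.

Record Zp := ZpElt { Zp_val :> Qp; _ : Zp_val \in padic_int }.
HB.instance Definition _ := [isSub for Zp_val].
HB.instance Definition _ := [Choice of Zp by <:].
HB.instance Definition _ := [SubChoice_isSubComNzRing of Zp by <:].

End PadicIntegers.

Arguments padic_int {p} Qp.

Section RingOfIntegers.
Variables (p : nat) (Qp : padicField p) (L : fieldExtType Qp).

Definition Zp_emb : Zp Qp -> L := in_alg L \o val.
HB.instance Definition _ := GRing.RMorphism.on Zp_emb.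

Definition integers : {pred L} := [pred x | `[< integralOver Zp_emb x >]].

Lemma integersP x : reflect (integralOver Zp_emb x) (x \in integers).
Proof. exact: asboolP. Qed.

Fact integers_subring : subring_closed integers.
Proof.
split=> [|x y /integersP hx /integersP hy|x y /integersP hx /integersP hy].
- by apply/integersP; exact: integral1.
- by apply/integersP; exact: integral_sub.
- by apply/integersP; exact: integral_mul.
Qed.
HB.instance Definition _ :=
  GRing.isSubringClosed.Build L integers integers_subring.

Record intRing := IntRing { intRing_val :> L; _ : intRing_val \in integers }.
HB.instance Definition _ := [isSub for intRing_val].
HB.instance Definition _ := [Choice of intRing by <:].
HB.instance Definition _ := [SubChoice_isSubComNzRing of intRing by <:].

(* p generates the maximal ideal of the ring of integers (ramification index 1) *)
Definition unramified : Prop :=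
  forall x : L, x \in integers -> x^-1 \notin integers ->
    exists2 y, y \in integers & x = p%:R * y.

Definition padic_close (n : nat) (x y : L) : Prop :=
  exists2 z, z \in integers & x - y = p%:R ^+ n * z.

Lemma padic_close_le n m x y : (m <= n)%N -> padic_close n x y ->
  padic_close m x y.
Proof.
move=> /subnKC <- [z hz e]; exists (p%:R ^+ (n - m) * z).
  by rewrite rpredM // rpredX // rpred_nat.
by rewrite e exprD mulrA.
Qed.

End RingOfIntegers.

Arguments integers {p Qp} L.

(* a group with a topology; no definition below uses their compatibility *)
#[short(type="groupTopType")]
HB.structure Definition GroupTop := {G of Group G & Topological G}.

Section Unitary.
Variables (p : nat) (Qp : padicField p) (L : fieldExtType Qp).
Variable c : {lrmorphism L -> L}.

Definition antidiag : 'M[L]_2 := \matrix_(i, j) (i != j)%:R.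

Definition unitary : {pred 'M[L]_2} :=
  [pred g | (g \in unitmx) && ((map_mx c g)^T *m antidiag *m g == antidiag)].

Record U11 := U11Elt { U11_val :> 'M[L]_2; U11P : U11_val \in unitary }.
HB.instance Definition _ := [isSub for U11_val].
HB.instance Definition _ := [Choice of U11 by <:].

Fact unitary1 : 1%:M \in unitary.
Proof. by rewrite inE unitmx1 map_mx1 trmx1 mul1mx mulmx1 eqxx. Qed.

Fact unitaryM (g h : U11) : val g *m val h \in unitary.
Proof.
case: g h => [g /= /andP[ug /eqP hg]] [h /= /andP[uh /eqP hh]].
rewrite inE unitmx_mul ug uh /= map_mxM trmx_mul.
by rewrite -[X in _ == X]hh -[X in _ == _ *m X *m _]hg !mulmxA.
Qed.

Fact unitaryV (g : U11) : invmx (val g) \in unitary.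
Proof.
case: g => [g /= /andP[ug /eqP hg]].
rewrite inE unitmx_inv ug /= -[X in _ *m X *m _]hg !mulmxA -trmx_mul -map_mxM.
by rewrite mulmxV // map_mx1 trmx1 mul1mx -mulmxA mulmxV // mulmx1.
Qed.

Definition U11_one : U11 := U11Elt unitary1.
Definition U11_mul (g h : U11) : U11 := U11Elt (unitaryM g h).
Definition U11_inv (g : U11) : U11 := U11Elt (unitaryV g).

Fact U11_mulA : associative U11_mul.
Proof. by move=> g h k; apply: val_inj; rewrite /= mulmxA. Qed.
Fact U11_mul1g : left_id U11_one U11_mul.
Proof. by move=> g; apply: val_inj; rewrite /= mul1mx. Qed.
Fact U11_mulg1 : right_id U11_one U11_mul.
Proof. by move=> g; apply: val_inj; rewrite /= mulmx1. Qed.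
Fact U11_mulVg : left_inverse U11_one U11_inv U11_mul.
Proof.
by move=> g; apply: val_inj; rewrite /= mulVmx //; case: g => g /= /andP[].
Qed.
Fact U11_mulgV : right_inverse U11_one U11_inv U11_mul.
Proof.
by move=> g; apply: val_inj; rewrite /= mulmxV //; case: g => g /= /andP[].
Qed.
HB.instance Definition _ := isGroup.Build U11
  U11_mulA U11_mul1g U11_mulg1 U11_mulVg U11_mulgV.

(* the topology induced by the p-adic topology of 'M[L]_2 *)
Definition U11_open : set_system U11 := [set X : set U11 |
  forall g : U11, X g -> exists n, forall h : U11,
    (forall i j, padic_close n (val h i j) (val g i j)) -> X h].

Fact U11_openT : U11_open setT.
Proof. by move=> g _; exists 0%N. Qed.

Fact U11_openI : setI_closed U11_open.
Proof.
move=> X Y oX oY g [/oX[n hn] /oY[m hm]]; exists (maxn n m) => h hh.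
by split; [apply: hn|apply: hm] => i j; apply: padic_close_le (hh i j);
  rewrite ?leq_maxl ?leq_maxr.
Qed.

Fact U11_open_bigU (I : Type) (f : I -> set U11) :
  (forall i, U11_open (f i)) -> U11_open (\bigcup_i f i).
Proof.
by move=> o g [i _ /(o i)[n hn]]; exists n => h /hn fh; exists i.
Qed.
HB.instance Definition _ := isOpenTopological.Build U11
  U11_openT U11_openI U11_open_bigU.

Definition torus : set U11 :=
  [set g : U11 | val g ord_max ord0 = 0 /\ val g ord0 ord_max = 0].
Definition unipotent : set U11 :=
  [set g : U11 | val g ord_max ord0 = 0 /\
           val g ord0 ord0 = 1 /\ val g ord_max ord_max = 1].

End Unitary.

(* An A-module up to the equivalence pm_eq; moduleQuot is its quotient. *)
Record premodule (A : comNzRingType) := Premodule {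
  pm_sort : choiceType;
  pm_eq : pm_sort -> pm_sort -> Prop;
  pm_zero : pm_sort;
  pm_opp : pm_sort -> pm_sort;
  pm_add : pm_sort -> pm_sort -> pm_sort;
  pm_scale : A -> pm_sort -> pm_sort;
  pm_refl : forall x, pm_eq x x;
  pm_sym : forall x y, pm_eq x y -> pm_eq y x;
  pm_trans : forall x y z, pm_eq x y -> pm_eq y z -> pm_eq x z;
  pm_oppE : forall x x', pm_eq x x' -> pm_eq (pm_opp x) (pm_opp x');
  pm_addE : forall x x' y y', pm_eq x x' -> pm_eq y y' ->
    pm_eq (pm_add x y) (pm_add x' y');
  pm_scaleE : forall a x x', pm_eq x x' -> pm_eq (pm_scale a x) (pm_scale a x');
  pm_addA : forall x y z, pm_eq (pm_add x (pm_add y z)) (pm_add (pm_add x y) z);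
  pm_addC : forall x y, pm_eq (pm_add x y) (pm_add y x);
  pm_add0 : forall x, pm_eq (pm_add pm_zero x) x;
  pm_addN : forall x, pm_eq (pm_add (pm_opp x) x) pm_zero;
  pm_scaleA : forall a b x,
    pm_eq (pm_scale a (pm_scale b x)) (pm_scale (a * b) x);
  pm_scale1 : forall x, pm_eq (pm_scale 1 x) x;
  pm_scaleDr : forall a x y,
    pm_eq (pm_scale a (pm_add x y)) (pm_add (pm_scale a x) (pm_scale a y));
  pm_scaleDl : forall x a b,
    pm_eq (pm_scale (a + b) x) (pm_add (pm_scale a x) (pm_scale b x))
}.

Section ModuleQuot.
Variables (A : comNzRingType) (M : premodule A).
Local Notation X := (pm_sort M).

Definition pm_rel : rel X := fun x y => `[< pm_eq x y >].
Fact pm_rel_refl : reflexive pm_rel.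
Proof. by move=> x; apply/asboolP; exact: pm_refl. Qed.
Fact pm_rel_sym : symmetric pm_rel.
Proof. by move=> x y; apply: asbool_equiv_eq; split; exact: pm_sym. Qed.
Fact pm_rel_trans : transitive pm_rel.
Proof. by move=> y x z /asboolP h /asboolP h'; apply/asboolP; apply: pm_trans h h'. Qed.
Definition pm_equiv : equiv_rel X := EquivRel pm_rel pm_rel_refl pm_rel_sym pm_rel_trans.

Definition moduleQuot := {eq_quot pm_equiv}.
HB.instance Definition _ := Choice.on moduleQuot.
HB.instance Definition _ := EqQuotient.on moduleQuot.
Local Notation Q := moduleQuot.

Definition mq (x : X) : Q := \pi_Q x.
Definition mrepr (x : Q) : X := repr x.

Lemma mqP x y : mq x = mq y <-> pm_eq x y.
Proof. by split=> [/eqmodP /asboolP|h] //; apply/eqmodP/asboolP. Qed.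
Lemma mreprK x : mq (mrepr x) = x. Proof. exact: reprK. Qed.
Lemma mreprP x : pm_eq (mrepr (mq x)) x.
Proof. by apply/mqP; rewrite mreprK. Qed.

Definition mq_zero : Q := mq (pm_zero M).
Definition mq_opp (x : Q) : Q := mq (pm_opp (mrepr x)).
Definition mq_add (x y : Q) : Q := mq (pm_add (mrepr x) (mrepr y)).
Definition mq_scale a (x : Q) : Q := mq (pm_scale a (mrepr x)).

Lemma mq_addE x y : mq_add (mq x) (mq y) = mq (pm_add x y).
Proof. by apply/mqP/pm_addE; exact: mreprP. Qed.
Lemma mq_oppE x : mq_opp (mq x) = mq (pm_opp x).
Proof. by apply/mqP/pm_oppE; exact: mreprP. Qed.
Lemma mq_scaleE a x : mq_scale a (mq x) = mq (pm_scale a x).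
Proof. by apply/mqP/pm_scaleE; exact: mreprP. Qed.
Lemma mqW (P : Q -> Prop) : (forall x, P (mq x)) -> forall x, P x.
Proof. by move=> h x; rewrite -[x]mreprK. Qed.

Fact mq_addA : associative mq_add.
Proof.
elim/mqW=> x; elim/mqW=> y; elim/mqW=> z.
by rewrite !mq_addE; apply/mqP/pm_addA.
Qed.
Fact mq_addC : commutative mq_add.
Proof.
elim/mqW=> x; elim/mqW=> y.
by rewrite !mq_addE; apply/mqP/pm_addC.
Qed.
Fact mq_add0 : left_id mq_zero mq_add.
Proof. by elim/mqW=> x; rewrite !mq_addE; apply/mqP/pm_add0. Qed.
Fact mq_addN : left_inverse mq_zero mq_opp mq_add.
Proof. by elim/mqW=> x; rewrite mq_oppE !mq_addE; apply/mqP/pm_addN. Qed.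
HB.instance Definition _ :=
  GRing.isZmodule.Build Q mq_addA mq_addC mq_add0 mq_addN.

Fact mq_scaleA a b x : mq_scale a (mq_scale b x) = mq_scale (a * b) x.
Proof. by elim/mqW: x => x; rewrite !mq_scaleE; apply/mqP/pm_scaleA. Qed.
Fact mq_scale1 : left_id 1 mq_scale.
Proof. by elim/mqW=> x; rewrite mq_scaleE; apply/mqP/pm_scale1. Qed.
Fact mq_scaleDr : right_distributive mq_scale +%R.
Proof.
move=> a; elim/mqW=> x; elim/mqW=> y; rewrite [X in mq_scale a X]mq_addE.
rewrite !mq_scaleE [RHS]mq_addE.
exact/mqP/pm_scaleDr.
Qed.
Fact mq_scaleDl x : {morph mq_scale^~ x : a b / a + b}.
Proof.
move=> a b; elim/mqW: x => x; rewrite !mq_scaleE [RHS]mq_addE.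
exact/mqP/pm_scaleDl.
Qed.
HB.instance Definition _ := GRing.Zmodule_isLmodule.Build A Q
  mq_scaleA mq_scale1 mq_scaleDr mq_scaleDl.

Lemma mqD x y : mq (pm_add x y) = mq x + mq y.
Proof. by rewrite [RHS]mq_addE. Qed.
Lemma mqN x : mq (pm_opp x) = - mq x.
Proof. by rewrite [RHS]mq_oppE. Qed.
Lemma mqZ a x : mq (pm_scale a x) = a *: mq x.
Proof. by rewrite [RHS]mq_scaleE. Qed.

End ModuleQuot.

Definition submodule (A : comNzRingType) (V : lmodType A) (N : set V) : Prop :=
  [/\ N 0, forall u v, N u -> N v -> N (u + v) & forall a v, N v -> N (a *: v)].

Section QuotientModule.
Variables (A : comNzRingType) (V : lmodType A) (N : set V) (sN : submodule N).

Let sN0 : N 0. Proof. by case: sN. Qed.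
Let sND u v : N u -> N v -> N (u + v). Proof. by case: sN => _ + _; apply. Qed.
Let sNZ a v : N v -> N (a *: v). Proof. by case: sN => _ _; apply. Qed.
Let sNN v : N v -> N (- v). Proof. by move=> ?; rewrite -scaleN1r; apply: sNZ. Qed.
Let eqN (x y : V) := N (x - y).
Let eqNxx x y : x = y -> eqN x y. Proof. by move->; rewrite /eqN subrr. Qed.

Definition quotient_pre : premodule A.
Proof.
exists V eqN 0 -%R +%R *:%R.
- by move=> x; exact: eqNxx.
- by move=> x y /sNN; rewrite /eqN opprB.
- by move=> x y z h /(sND h); rewrite /eqN addrA subrK.
- by move=> x y /sNN; rewrite /eqN opprD.
- by move=> x x' y y' h /(sND h); rewrite /eqN opprD addrACA.
- by move=> a x y /(sNZ a); rewrite /eqN scalerBr.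
- by move=> x y z; apply: eqNxx; rewrite addrA.
- by move=> x y; apply: eqNxx; rewrite addrC.
- by move=> x; apply: eqNxx; rewrite add0r.
- by move=> x; apply: eqNxx; rewrite addNr.
- by move=> a b x; apply: eqNxx; rewrite scalerA.
- by move=> x; apply: eqNxx; rewrite scale1r.
- by move=> a x y; apply: eqNxx; rewrite scalerDr.
- by move=> x a b; apply: eqNxx; rewrite scalerDl.
Defined.

End QuotientModule.

(* For f : A -> A', tensor f V is the A'-module A' (x)_A V: finite sums of
   symbols (a', v), two of them being identified when every balanced biadditive
   map to an abelian group takes the same value on both. *)
Section Tensor.
Variables (A A' : comNzRingType) (f : {rmorphism A -> A'}) (V : lmodType A).

Record balanced (W : zmodType) (b : A' -> V -> W) : Prop := Balanced {
  balancedDl : forall x y v, b (x + y) v = b x v + b y v;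
  balancedDr : forall x u v, b x (u + v) = b x u + b x v;
  balancedM : forall x a v, b (x * f a) v = b x (a *: v)
}.

Definition tens_sum (W : zmodType) (b : A' -> V -> W) (s : seq (A' * V)) : W :=
  \sum_(t <- s) b t.1 t.2.

Definition tens_eq (s s' : seq (A' * V)) : Prop :=
  forall (W : zmodType) (b : A' -> V -> W), balanced b ->
    tens_sum b s = tens_sum b s'.

Lemma balanced0l (W : zmodType) (b : A' -> V -> W) v : balanced b -> b 0 v = 0.
Proof.
by move=> bb; apply: (addrI (b 0 v)); rewrite -(balancedDl bb) !addr0.
Qed.
Lemma balanced0r (W : zmodType) (b : A' -> V -> W) x : balanced b -> b x 0 = 0.
Proof.
by move=> bb; apply: (addrI (b x 0)); rewrite -(balancedDr bb) !addr0.
Qed.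
Lemma balancedNl (W : zmodType) (b : A' -> V -> W) x v :
  balanced b -> b (- x) v = - b x v.
Proof.
move=> bb; apply: (addrI (b x v)).
by rewrite -(balancedDl bb) !subrr balanced0l.
Qed.
Lemma balanced_scale (W : zmodType) (b : A' -> V -> W) c :
  balanced b -> balanced (fun x => b (c * x)).
Proof.
move=> bb; split=> [x y v|x u v|x a v]; first by rewrite mulrDr (balancedDl bb).
  by rewrite (balancedDr bb).
by rewrite mulrA (balancedM bb).
Qed.

Definition tens_opp (s : seq (A' * V)) := [seq (- t.1, t.2) | t <- s].
Definition tens_scale a (s : seq (A' * V)) := [seq (a * t.1, t.2) | t <- s].

Lemma tens_sum_opp (W : zmodType) (b : A' -> V -> W) s : balanced b ->
  tens_sum b (tens_opp s) = - tens_sum b s.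
Proof.
move=> bb; rewrite /tens_sum big_map -sumrN; apply: eq_bigr => t _ /=.
exact: balancedNl.
Qed.
Lemma tens_sum_add (W : zmodType) (b : A' -> V -> W) s s' :
  tens_sum b (s ++ s') = tens_sum b s + tens_sum b s'.
Proof. exact: big_cat. Qed.
Lemma tens_sum_scale (W : zmodType) (b : A' -> V -> W) a s :
  tens_sum b (tens_scale a s) = tens_sum (fun x => b (a * x)) s.
Proof. by rewrite /tens_sum big_map. Qed.

Definition tensor_pre : premodule A'.
Proof.
exists (seq (A' * V)) tens_eq [::] tens_opp cat tens_scale.
- by move=> s W b.
- by move=> s s' e W b bb; rewrite e.
- by move=> s s' s'' e e' W b bb; rewrite e // e'.
- by move=> s s' e W b bb; rewrite !tens_sum_opp // e.
- by move=> s s' t t' e e' W b bb; rewrite !tens_sum_add e // e'.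
- by move=> a s s' e W b bb; rewrite !tens_sum_scale e //; exact: balanced_scale.
- by move=> s s' t W b bb; rewrite catA.
- by move=> s s' W b bb; rewrite !tens_sum_add addrC.
- by move=> s W b bb.
- move=> s W b bb; rewrite tens_sum_add tens_sum_opp // addNr.
  by rewrite /tens_sum big_nil.
- move=> a a' s W b bb; rewrite !tens_sum_scale.
  by apply: eq_bigr => t _; rewrite mulrA.
- by move=> s W b bb; rewrite tens_sum_scale; apply: eq_bigr => t _; rewrite mul1r.
- by move=> a s s' W b bb; rewrite /tens_scale map_cat.
- move=> s a a' W b bb; rewrite tens_sum_add !tens_sum_scale -big_split.
  by apply: eq_bigr => t _; rewrite mulrDl (balancedDl bb).
Defined.

Definition tensor : lmodType A' := moduleQuot tensor_pre.

Definition pure (x : A') (v : V) : tensor := mq (M := tensor_pre) [:: (x, v)].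

Definition tens_lift (W : zmodType) (b : A' -> V -> W) (x : tensor) : W :=
  tens_sum b (mrepr x).

Lemma tens_lift_mq (W : zmodType) (b : A' -> V -> W) s : balanced b ->
  tens_lift b (mq (M := tensor_pre) s) = tens_sum b s.
Proof.
move=> bb; have h : tens_eq (mrepr (mq (M := tensor_pre) s)) s.
  exact: (mreprP (M := tensor_pre) s).
exact: h.
Qed.

Lemma tens_lift_pure (W : zmodType) (b : A' -> V -> W) x v : balanced b ->
  tens_lift b (pure x v) = b x v.
Proof. by move=> bb; rewrite tens_lift_mq // /tens_sum big_seq1. Qed.

Lemma tens_liftD (W : zmodType) (b : A' -> V -> W) x y : balanced b ->
  tens_lift b (x + y) = tens_lift b x + tens_lift b y.
Proof.
move=> bb; elim/(mqW (M := tensor_pre)): x => x.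
elim/(mqW (M := tensor_pre)): y => y.
by rewrite -mqD !tens_lift_mq // tens_sum_add.
Qed.

Lemma pure_balanced : balanced pure.
Proof.
split=> [x y v|x u v|x a v]; rewrite /pure -?mqD; apply/mqP => W b bb;
  rewrite /= /tens_sum ?big_cons ?big_nil ?addr0 /=.
- exact: balancedDl.
- exact: balancedDr.
- exact: balancedM.
Qed.

Lemma scale_pure a x v : a *: pure x v = pure (a * x) v.
Proof. by rewrite /pure -mqZ. Qed.

Lemma tensorW (P : tensor -> Prop) : P 0 -> (forall x v, P (pure x v)) ->
  (forall y z, P y -> P z -> P (y + z)) -> forall y, P y.
Proof.
move=> P0 Pp PD; elim/(mqW (M := tensor_pre)); elim=> [|[x v] s IHs] //.
rewrite (_ : mq _ = pure x v + mq (M := tensor_pre) s); first exact: PD.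
by rewrite /pure -mqD.
Qed.

Lemma tensor_ext (W : zmodType) (h h' : tensor -> W) :
  {morph h : x y / x + y} -> {morph h' : x y / x + y} ->
  (forall x v, h (pure x v) = h' (pure x v)) -> h =1 h'.
Proof.
have z (k : tensor -> W) : {morph k : x y / x + y} -> k 0 = 0.
  by move=> kD; apply: (addrI (k 0)); rewrite -kD !addr0.
move=> hD h'D e; elim/tensorW => [|x v|y y' E E']; rewrite ?z //.
by rewrite hD h'D E E'.
Qed.

End Tensor.

Arguments pure {A A'} f {V}.
Arguments tens_lift {A A'} f {V W}.

Section TensorComp.
Variables (A A' A'' : comNzRingType).
Variables (f : {rmorphism A -> A'}) (g : {rmorphism A' -> A''}).
Variables (h : {rmorphism A -> A''}) (hE : h =1 g \o f) (V : lmodType A).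

Let b1 (x : A'') (y : A') (v : V) : tensor h V := pure h (x * g y) v.
Let b1P x : balanced f (b1 x).
Proof.
have pb := pure_balanced h V.
split=> [y z v|y u v|y a v]; rewrite /b1.
- by rewrite rmorphD mulrDr (balancedDl pb).
- by rewrite (balancedDr pb).
- by rewrite -(balancedM pb) rmorphM mulrA hE.
Qed.
Let b2 (x : A'') (t : tensor f V) : tensor h V := tens_lift f (b1 x) t.
Let b2P : balanced g b2.
Proof.
have pb := pure_balanced h V.
split=> [x y t|x t u|x a t]; rewrite /b2.
- move: t; apply: tensor_ext => [t t'|t t'|z v]; rewrite ?tens_liftD //.
    by rewrite addrACA.
  by rewrite !tens_lift_pure // /b1 mulrDl (balancedDl pb).
- by rewrite tens_liftD.
- move: t; apply: tensor_ext => [t t'|t t'|z v]; rewrite ?scalerDr ?tens_liftD //.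
  by rewrite scale_pure !tens_lift_pure // /b1 rmorphM mulrA.
Qed.
Definition tensor_comp : tensor g (tensor f V) -> tensor h V := tens_lift g b2.

Let b3 (x : A'') (v : V) : tensor g (tensor f V) := pure g x (pure f 1 v).
Let b3P : balanced h b3.
Proof.
have pf := pure_balanced f V; have pg := pure_balanced g (tensor f V).
split=> [x y v|x u v|x a v]; rewrite /b3.
- by rewrite (balancedDl pg).
- by rewrite (balancedDr pf) (balancedDr pg).
- by rewrite hE (balancedM pg) scale_pure -(balancedM pf) mulrC.
Qed.
Let tensor_uncomp : tensor h V -> tensor g (tensor f V) := tens_lift h b3.

Lemma tensor_compD : {morph tensor_comp : x y / x + y}.
Proof. by move=> x y; exact: tens_liftD. Qed.

Lemma tensor_comp_pure x y v :
  tensor_comp (pure g x (pure f y v)) = pure h (x * g y) v.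
Proof. by rewrite /tensor_comp tens_lift_pure // /b2 tens_lift_pure. Qed.

Lemma tensor_comp_ext (W : zmodType) (k k' : tensor g (tensor f V) -> W) :
  {morph k : x y / x + y} -> {morph k' : x y / x + y} ->
  (forall x y v, k (pure g x (pure f y v)) = k' (pure g x (pure f y v))) ->
  k =1 k'.
Proof.
have pg := pure_balanced g (tensor f V).
move=> kD k'D e; apply: tensor_ext => // x t; move: t.
apply: (@tensor_ext _ _ _ _ _ (fun t => k (pure g x t)) (fun t => k' (pure g x t))).
- by move=> t t'; rewrite (balancedDr pg) kD.
- by move=> t t'; rewrite (balancedDr pg) k'D.
- by move=> y v; exact: e.
Qed.

Lemma tensor_comp_linear : linear tensor_comp.
Proof.
have pg := pure_balanced g (tensor f V).
move=> a x y; rewrite tensor_compD; congr (_ + _); move: x.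
apply: (tensor_comp_ext (k := fun x => tensor_comp (a *: x))
  (k' := fun x => a *: tensor_comp x)) => [x z|x z|x z v].
- by rewrite scalerDr tensor_compD.
- by rewrite tensor_compD scalerDr.
- by rewrite scale_pure !tensor_comp_pure scale_pure mulrA.
Qed.

Lemma tensor_comp_bij : bijective tensor_comp.
Proof.
have pf := pure_balanced f V; have pg := pure_balanced g (tensor f V).
exists tensor_uncomp.
- apply: tensor_comp_ext => [x y|x y //|x y v].
    by rewrite tensor_compD /tensor_uncomp tens_liftD.
  rewrite tensor_comp_pure /tensor_uncomp tens_lift_pure // /b3 (balancedM pg).
  by rewrite scale_pure mulr1.
- apply: tensor_ext => [x y|x y //|x v].
    by rewrite /tensor_uncomp tens_liftD // tensor_compD.
  rewrite /tensor_uncomp tens_lift_pure // /b3 tensor_comp_pure.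
  by rewrite rmorph1 mulr1.
Qed.

End TensorComp.

Section TensorId.
Variables (A : comNzRingType) (f : {rmorphism A -> A}) (fE : f =1 id).
Variable V : lmodType A.

Let b (x : A) (v : V) : V := x *: v.
Let bP : balanced f b.
Proof.
split=> [x y v|x u v|x a v]; rewrite /b ?scalerDl ?scalerDr //.
by rewrite fE scalerA.
Qed.
Definition tensor_id : tensor f V -> V := tens_lift f b.

Lemma tensor_id_pure x v : tensor_id (pure f x v) = x *: v.
Proof. exact: tens_lift_pure. Qed.
Lemma tensor_idD : {morph tensor_id : x y / x + y}.
Proof. by move=> x y; exact: tens_liftD. Qed.
Lemma tensor_id_linear : linear tensor_id.
Proof.
move=> a x y; rewrite tensor_idD; congr (_ + _); move: x.
apply: (tensor_ext (h := fun x => tensor_id (a *: x))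
   (h' := fun x => a *: tensor_id x)) => [x z|x z|x v].
- by rewrite scalerDr tensor_idD.
- by rewrite tensor_idD scalerDr.
- by rewrite scale_pure !tensor_id_pure scalerA.
Qed.
Lemma tensor_id_bij : bijective tensor_id.
Proof.
have pf := pure_balanced f V.
exists (pure f 1) => [|v]; last by rewrite tensor_id_pure scale1r.
apply: (tensor_ext (h := fun x => pure f 1 (tensor_id x))
   (h' := id)) => [x y|x y //|x v].
  by rewrite tensor_idD (balancedDr pf).
by rewrite tensor_id_pure -(balancedM pf) mul1r fE.
Qed.
End TensorId.

Definition free_module (A : comNzRingType) (V : lmodType A) : Prop :=
  exists (I : choiceType) (e : I -> V),
    (forall v, exists s : seq (A * I), v = \sum_(t <- s) t.1 *: e t.2) /\
    (forall (s : seq I) (a : I -> A), uniq s -> \sum_(i <- s) a i *: e i = 0 ->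
       forall i, i \in s -> a i = 0).

Section FreeBaseChange.
Variables (A A' : comNzRingType) (f : {rmorphism A -> A'}) (V : lmodType A).
Variables (I : choiceType) (e : I -> V).
Hypothesis span : forall v, exists s : seq (A * I), v = \sum_(t <- s) t.1 *: e t.2.
Hypothesis indep : forall (s : seq I) (a : I -> A),
  uniq s -> \sum_(i <- s) a i *: e i = 0 -> forall i, i \in s -> a i = 0.

Let co (i : I) (s : seq (A * I)) : A := \sum_(t <- s | t.2 == i) t.1.

Let co0 s : \sum_(t <- s) t.1 *: e t.2 = 0 -> forall i, co i s = 0.
Proof.
move=> s0 i; set r := undup (map snd s).
have [ir|ir] := boolP (i \in r); last first.
  apply: big1_seq => t /andP[/eqP ti ts]; case/negP: ir.
  by rewrite mem_undup -ti map_f.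
apply: (@indep r (fun i => co i s)) ir; first exact: undup_uniq.
rewrite -[RHS]s0.
under eq_bigr do rewrite scaler_suml.
rewrite (exchange_big_dep xpredT) //= big_seq [RHS]big_seq; apply: eq_bigr => t ts.
rewrite (eq_bigl (fun j => j == t.2)); last by move=> j; rewrite eq_sym.
rewrite -big_filter (_ : [seq j <- r | j == t.2] = [:: t.2]) ?big_seq1 //.
have := filter_pred1_uniq (undup_uniq (map snd s)); apply.
by rewrite mem_undup map_f.
Qed.

Let co_eq s s' : \sum_(t <- s) t.1 *: e t.2 = \sum_(t <- s') t.1 *: e t.2 ->
  forall i, co i s = co i s'.
Proof.
move=> ss' i; apply/eqP; rewrite -subr_eq0; apply/eqP.
rewrite -(@co0 (s ++ [seq (- t.1, t.2) | t <- s']) _ i).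
  by rewrite /co big_cat big_map /= sumrN.
rewrite big_cat big_map /= ss'; under [X in _ + X]eq_bigr do rewrite scaleNr.
by rewrite sumrN subrr.
Qed.

Let rp v : seq (A * I) := projT1 (cid (span v)).
Let rpE v : v = \sum_(t <- rp v) t.1 *: e t.2.
Proof. exact: (projT2 (cid (span v))). Qed.

Let coord i v := co i (rp v).
Let coordD i u v : coord i (u + v) = coord i u + coord i v.
Proof.
rewrite /coord (@co_eq _ (rp u ++ rp v)) ?/co ?big_cat //=.
by rewrite -!rpE.
Qed.
Let coordZ i a v : coord i (a *: v) = a * coord i v.
Proof.
rewrite /coord (@co_eq _ [seq (a * t.1, t.2) | t <- rp v]).
  by rewrite /co big_map /= mulr_sumr.
rewrite -rpE big_map [in LHS](rpE v) scaler_sumr.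
by apply: eq_bigr => t _; rewrite scalerA.
Qed.
Let coord_e i j : coord i (e j) = (j == i)%:R.
Proof.
rewrite /coord (@co_eq _ [:: (1, j)]); last by rewrite -rpE big_seq1 scale1r.
by rewrite /co big_cons big_nil /=; case: eqP; rewrite ?addr0.
Qed.

Lemma tensor_free_basis : free_module (tensor f V).
Proof.
have pb := pure_balanced f V.
exists I, (fun i => pure f 1 (e i)); split.
  elim/tensorW => [|x v|y z [s ->] [s' ->]].
  - by exists [::]; rewrite big_nil.
  - exists [seq (x * f t.1, t.2) | t <- rp v]; rewrite big_map [in LHS](rpE v).
    rewrite (big_morph (pure f x) (balancedDr pb x) (balanced0r x pb)).
    by apply: eq_bigr => t _; rewrite scale_pure mulr1 (balancedM pb).
  - by exists (s ++ s'); rewrite big_cat.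
move=> s a us s0 i si.
pose b (x : A') (v : V) : A' := x * f (coord i v).
have bP : balanced f b.
  split=> [x y v|x u v|x c v]; rewrite /b ?mulrDl //.
    by rewrite coordD rmorphD mulrDr.
  by rewrite coordZ rmorphM mulrA.
have l0 : tens_lift f b 0 = 0.
  by apply: (addrI (tens_lift f b 0)); rewrite -tens_liftD // !addr0.
have := congr1 (tens_lift f b) s0.
rewrite (big_morph _ (fun x y => tens_liftD x y bP) l0) l0.
rewrite (bigD1_seq i) //= big1 => [|j ji].
  rewrite addr0 scale_pure tens_lift_pure // /b coord_e eqxx rmorph1 !mulr1.
  by [].
by rewrite scale_pure tens_lift_pure // /b coord_e (negbTE ji) rmorph0 mulr0.
Qed.

End FreeBaseChange.

Lemma tensor_free (A A' : comNzRingType) (f : {rmorphism A -> A'})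
  (V : lmodType A) : free_module V -> free_module (tensor f V).
Proof. by case=> I [e [sp ind]]; exact: tensor_free_basis sp ind. Qed.

Definition open_subgroup (G : groupTopType) (K : set G) : Prop :=
  [/\ open K, K 1%g, forall g h, K g -> K h -> K (g * h)%g &
      forall g, K g -> K (g^-1)%g].

Lemma open_subgroupT (G : groupTopType) : open_subgroup [set: G].
Proof. by split=> //; exact: openT. Qed.

Lemma open_subgroupI (G : groupTopType) (K K' : set G) :
  open_subgroup K -> open_subgroup K' -> open_subgroup (K `&` K').
Proof.
move=> [o K1 KM KV] [o' K1' KM' KV']; split=> //; first exact: openI.
  by move=> g h [? ?] [? ?]; split; [apply: KM|apply: KM'].
by move=> g [? ?]; split; [apply: KV|apply: KV'].
Qed.

Record srep (G : groupTopType) (A : comNzRingType) := SRep {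
  srep_mod :> lmodType A;
  srep_act : G -> srep_mod -> srep_mod;
  srep_linear : forall g, linear (srep_act g);
  srep_act1 : forall v, srep_act 1%g v = v;
  srep_actM : forall g h v, srep_act (g * h)%g v = srep_act g (srep_act h v);
  srep_smooth : forall v, exists2 K : set G, open_subgroup K &
    forall g, K g -> srep_act g v = v
}.

Section SRepTheory.
Variables (G : groupTopType) (A : comNzRingType) (V : srep G A).
Lemma srep_actD g (u v : V) : srep_act g (u + v) = srep_act g u + srep_act g v.
Proof. by have := srep_linear g 1 u v; rewrite !scale1r. Qed.
Lemma srep_act0 g : srep_act g (0 : V) = 0.
Proof. by apply: (addrI (srep_act g (0 : V))); rewrite -srep_actD !addr0. Qed.
Lemma srep_actZ g a (v : V) : srep_act g (a *: v) = a *: srep_act g v.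
Proof. by have := srep_linear g a v 0; rewrite srep_act0 !addr0. Qed.
End SRepTheory.

Section BaseChangeRep.
Variables (G : groupTopType) (A A' : comNzRingType) (f : {rmorphism A -> A'}).
Variable V : srep G A.

Let b (g : G) (x : A') (v : V) : tensor f V := pure f x (srep_act g v).
Let bP g : balanced f (b g).
Proof.
have pb := pure_balanced f V.
split=> [x y v|x u v|x a v]; rewrite /b.
- by rewrite (balancedDl pb).
- by rewrite srep_actD (balancedDr pb).
- by rewrite srep_actZ (balancedM pb).
Qed.
Definition bc_act (g : G) : tensor f V -> tensor f V := tens_lift f (b g).

Lemma bc_act_pure g x v : bc_act g (pure f x v) = pure f x (srep_act g v).
Proof. exact: tens_lift_pure. Qed.
Lemma bc_actD g x y : bc_act g (x + y) = bc_act g x + bc_act g y.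
Proof. exact: tens_liftD. Qed.

Fact bc_act_linear g : linear (bc_act g).
Proof.
move=> a x y; rewrite bc_actD; congr (_ + _); move: x.
apply: (tensor_ext (h := fun x => bc_act g (a *: x))
  (h' := fun x => a *: bc_act g x)) => [x z|x z|x v].
- by rewrite scalerDr bc_actD.
- by rewrite bc_actD scalerDr.
- by rewrite scale_pure !bc_act_pure scale_pure.
Qed.
Fact bc_act1 x : bc_act 1%g x = x.
Proof.
move: x; apply: (tensor_ext (h := bc_act 1%g) (h' := id)) => [x y|//|x v].
  exact: bc_actD.
by rewrite bc_act_pure srep_act1.
Qed.
Fact bc_actM g h x : bc_act (g * h)%g x = bc_act g (bc_act h x).
Proof.
move: x; apply: (tensor_ext (h := bc_act (g * h)%g)
  (h' := fun x => bc_act g (bc_act h x))) => [x y|x y|x v].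
- exact: bc_actD.
- by rewrite !bc_actD.
- by rewrite !bc_act_pure srep_actM.
Qed.
Fact bc_smooth x : exists2 K : set G, open_subgroup K &
  forall g, K g -> bc_act g x = x.
Proof.
elim/tensorW: x => [|x v|x y [K oK Kx] [K' oK' Ky]].
- exists setT; first exact: open_subgroupT.
  by move=> g _; apply: (addrI (bc_act g 0)); rewrite -bc_actD !addr0.
- have [K oK Kv] := srep_smooth v; exists K => // g /Kv e.
  by rewrite bc_act_pure e.
- exists (K `&` K'); first exact: open_subgroupI.
  by move=> g [/Kx ex /Ky ey]; rewrite bc_actD ex ey.
Qed.
Definition bc_rep : srep G A' :=
  SRep bc_act_linear bc_act1 bc_actM bc_smooth.

End BaseChangeRep.

Definition ideal (A : comNzRingType) (I : set A) : Prop :=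
  [/\ I 0, forall x y, I x -> I y -> I (x + y) & forall a x, I x -> I (a * x)].

Definition maximal_ideal (A : comNzRingType) (I : set A) : Prop :=
  [/\ ideal I, ~ I 1 &
      forall J : set A, ideal J -> ~ J 1 -> I `<=` J -> J = I].

Definition local_ring (A : comNzRingType) : Prop :=
  exists! I : set A, maximal_ideal I.

Definition artinian_ring (A : comNzRingType) : Prop :=
  forall I : nat -> set A, (forall n, ideal (I n)) ->
    (forall n, I n.+1 `<=` I n) -> exists N, forall n, (N <= n)%N -> I n = I N.

Section Art.
Variables (O : comNzRingType) (k : fieldType) (res : {rmorphism O -> k}).

(* Since art_res is onto the field k (it extends res, which is onto whenever k
   is the residue field of O), its kernel is the maximal ideal of A and it
   identifies the residue field of A with k. *)
Record artAlg := ArtAlg {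
  art_ring :> comNzRingType;
  art_str : {rmorphism O -> art_ring};
  art_res : {rmorphism art_ring -> k};
  art_local : local_ring art_ring;
  art_artinian : artinian_ring art_ring;
  art_resE : forall x, art_res (art_str x) = res x
}.

Record artHom (A A' : artAlg) := ArtHom {
  art_hom :> {rmorphism A -> A'};
  art_hom_str : forall x, art_hom (art_str A x) = art_str A' x;
  art_hom_local : forall a, art_res A a = 0 -> art_res A' (art_hom a) = 0
}.

Record artFunctor := ArtFunctor {
  af_obj :> artAlg -> Type;
  af_map : forall A A' : artAlg, artHom A A' -> af_obj A -> af_obj A';
  af_map_id : forall (A : artAlg) (h : artHom A A), h =1 id ->
    forall x, af_map h x = x;
  af_map_comp : forall (A A' A'' : artAlg) (h : artHom A A') (h' : artHom A' A'')
    (h'' : artHom A A''), h'' =1 h' \o h ->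
    forall x, af_map h'' x = af_map h' (af_map h x)
}.

Definition natural_iso (F F' : artFunctor) (eta : forall A, F A -> F' A) : Prop :=
  (forall (A A' : artAlg) (h : artHom A A') (x : F A),
     eta A' (af_map h x) = af_map h (eta A x)) /\
  (forall A, bijective (eta A)).

Hypothesis res_surj : forall y, exists x, res x = y.

Lemma art_hom_res (A A' : artAlg) (h : artHom A A') a :
  art_res A' (h a) = art_res A a.
Proof.
have [x xa] := res_surj (art_res A a).
have /art_hom_local : art_res A (a - art_str A x) = 0.
  by rewrite rmorphB art_resE xa subrr.
by move/(_ _ h); rewrite !rmorphB art_hom_str art_resE xa => /eqP; rewrite subr_eq0 => /eqP.
Qed.

Variables (G : groupTopType) (pi0 : srep G k).

(* lift_red: the induced map k (x)_A V -> pi0 is an isomorphism *)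
Record is_lift (A : artAlg) (V : srep G A) (phi : V -> pi0) : Prop := IsLift {
  lift_free : free_module V;
  lift_add : forall u v, phi (u + v) = phi u + phi v;
  lift_scale : forall a v, phi (a *: v) = art_res A a *: phi v;
  lift_equiv : forall g v, phi (srep_act g v) = srep_act g (phi v);
  lift_surj : forall w, exists v, phi v = w;
  lift_red : bijective (tens_lift (art_res A) (fun x v => x *: phi v))
}.

Record lift (A : artAlg) := Lift {
  lift_rep : srep G A;
  lift_map : lift_rep -> pi0;
  liftP : is_lift lift_map
}.

Definition lift_iso (A : artAlg) (l l' : lift A) : Prop :=
  exists psi : lift_rep l -> lift_rep l',
    [/\ linear psi, bijective psi,
        forall g v, psi (srep_act g v) = srep_act g (psi v) &
        forall v, lift_map (psi v) = lift_map v].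

Lemma lift_iso_refl A (l : lift A) : lift_iso l l.
Proof. by exists id; split=> //; exists id. Qed.

Lemma lift_iso_sym A (l l' : lift A) : lift_iso l l' -> lift_iso l' l.
Proof.
case=> psi [pl [psi' pK pK'] pg pm]; exists psi'; split.
- by move=> a x y; apply: (can_inj pK); rewrite pl !pK'.
- by exists psi.
- by move=> g v; apply: (can_inj pK); rewrite pg !pK'.
- by move=> v; rewrite -pm pK'.
Qed.

Lemma lift_iso_trans A (l l' l'' : lift A) :
  lift_iso l l' -> lift_iso l' l'' -> lift_iso l l''.
Proof.
case=> psi [pl pb pg pm] [psi' [pl' pb' pg' pm']]; exists (psi' \o psi); split.
- by move=> a x y; rewrite /= pl pl'.
- exact: bij_comp.
- by move=> g v; rewrite /= pg pg'.
- by move=> v; rewrite /= pm' pm.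
Qed.

Definition deformation (A : artAlg) : Type :=
  {X : lift A -> Prop | exists l, X = lift_iso l}.

Definition lift_class (A : artAlg) (l : lift A) : deformation A :=
  exist _ (lift_iso l) (ex_intro _ l erefl).

Lemma lift_classP A (l l' : lift A) :
  lift_class l = lift_class l' <-> lift_iso l l'.
Proof.
split=> [/(congr1 (@proj1_sig _ _)) /= e|ll'].
  by rewrite e; exact: lift_iso_refl.
apply: eq_exist; apply/funext => x; apply/propext; split=> h.
  exact: lift_iso_trans (lift_iso_sym ll') h.
exact: lift_iso_trans ll' h.
Qed.

Definition class_rep (A : artAlg) (X : deformation A) : lift A :=
  projT1 (cid (proj2_sig X)).

Lemma class_repK A (X : deformation A) : lift_class (class_rep X) = X.
Proof.
rewrite /class_rep; case: cid => l /=; case: X => X /= [l' e'] e.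
by apply: eq_exist; rewrite /= e.
Qed.

Section BaseChangeLift.
Variables (A A' : artAlg) (h : artHom A A') (l : lift A).

Let b (x : A') (v : lift_rep l) : pi0 := art_res A' x *: lift_map v.
Let bP : balanced h b.
Proof.
have L := liftP l; split=> [x y v|x u v|x a v]; rewrite /b.
- by rewrite rmorphD scalerDl.
- by rewrite (lift_add L) scalerDr.
- by rewrite (lift_scale L) rmorphM scalerA art_hom_res.
Qed.
Definition bc_map : bc_rep h (lift_rep l) -> pi0 := tens_lift h b.

Lemma bc_map_pure x v : bc_map (pure h x v) = art_res A' x *: lift_map v.
Proof. exact: tens_lift_pure. Qed.
Lemma bc_mapD x y : bc_map (x + y) = bc_map x + bc_map y.
Proof. exact: tens_liftD. Qed.
Lemma bc_mapZ a x : bc_map (a *: x) = art_res A' a *: bc_map x.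
Proof.
move: x; apply: (tensor_ext (h := fun x => bc_map (a *: x))
  (h' := fun x => art_res A' a *: bc_map x)) => [x y|x y|x v].
- by rewrite scalerDr bc_mapD.
- by rewrite bc_mapD scalerDr.
- by rewrite scale_pure !bc_map_pure rmorphM scalerA.
Qed.

Fact bc_is_lift : is_lift bc_map.
Proof.
have L := liftP l; split.
- exact: tensor_free (lift_free L).
- exact: bc_mapD.
- exact: bc_mapZ.
- move=> g x; move: x.
  apply: (tensor_ext (h := fun x => bc_map (bc_act g x))
    (h' := fun x => srep_act g (bc_map x))) => [x y|x y|x v].
  + by rewrite bc_actD bc_mapD.
  + by rewrite bc_mapD srep_actD.
  + by rewrite bc_act_pure !bc_map_pure (lift_equiv L) srep_actZ.
- move=> w; have [v <-] := lift_surj L w; exists (pure h 1 v).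
  by rewrite bc_map_pure rmorph1 scale1r.
- have hE : art_res A =1 art_res A' \o h by move=> a; rewrite /= art_hom_res.
  have B1 : balanced (art_res A') (fun x v => x *: bc_map v).
    split=> [x y v|x u v|x a v]; first by rewrite scalerDl.
      by rewrite bc_mapD scalerDr.
    by rewrite bc_mapZ scalerA.
  have B2 : balanced (art_res A) (fun x (v : lift_rep l) => x *: lift_map v).
    split=> [x y v|x u v|x a v]; first by rewrite scalerDl.
      by rewrite (lift_add L) scalerDr.
    by rewrite (lift_scale L) scalerA.
  pose K1 : tensor (art_res A') (tensor h (lift_rep l)) -> pi0 :=
    tens_lift (art_res A') (fun x v => x *: bc_map v).
  pose K2 : tensor (art_res A) (lift_rep l) -> pi0 :=
    tens_lift (art_res A) (fun x (v : lift_rep l) => x *: lift_map v).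
  have K1D : {morph K1 : x y / x + y} by move=> x y; exact: tens_liftD.
  have K2D : {morph K2 : x y / x + y} by move=> x y; exact: tens_liftD.
  have K1p x v : K1 (pure _ x v) = x *: bc_map v by exact: tens_lift_pure.
  have K2p x v : K2 (pure _ x v) = x *: lift_map v by exact: tens_lift_pure.
  pose C := @tensor_comp _ _ _ h (art_res A') (art_res A) (lift_rep l).
  have cb : bijective C by exact: tensor_comp_bij.
  have CD : {morph C : x y / x + y} by exact: tensor_compD.
  have Cp x y v : C (pure _ x (pure _ y v)) = pure _ (x * art_res A' y) v.
    exact: tensor_comp_pure.
  have K2b : bijective K2 by exact: lift_red L.
  apply: (eq_bij (bij_comp K2b cb) (g := K1)).
  apply: (@tensor_comp_ext _ _ _ h (art_res A') (lift_rep l) pi0 (K2 \o C) K1).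
  + by move=> x y; exact: (etrans (congr1 K2 (CD x y)) (K2D _ _)).
  + exact: K1D.
  + move=> x y v; rewrite [LHS](congr1 K2 (Cp x y v)) K1p K2p.
    by rewrite bc_map_pure scalerA.
Qed.
Definition bc_lift : lift A' := Lift bc_is_lift.

End BaseChangeLift.

Lemma bc_lift_iso A A' (h : artHom A A') (l l' : lift A) :
  lift_iso l l' -> lift_iso (bc_lift h l) (bc_lift h l').
Proof.
case=> psi [pl [psi' pK pK'] pg pm].
have mor (V V' : srep G A) (q : V -> V') : linear q ->
    balanced h (fun x v => pure h x (q v)).
  have pb := pure_balanced h V'.
  move=> ql; have qD u v : q (u + v) = q u + q v.
    by have := ql 1 u v; rewrite !scale1r.
  have q0 : q 0 = 0 by apply: (addrI (q 0)); rewrite -qD !addr0.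
  split=> [x y v|x u v|x a v].
  - by rewrite (balancedDl pb).
  - by rewrite qD (balancedDr pb).
  - by rewrite (balancedM pb); have := ql a v 0; rewrite !addr0 q0 addr0 => ->.
have pl' : linear psi' by move=> a x y; apply: (can_inj pK); rewrite pl !pK'.
have B := mor _ _ _ pl; have B' := mor _ _ _ pl'.
pose F := tens_lift h (fun x v => pure h x (psi v)).
pose F' := tens_lift h (fun x v => pure h x (psi' v)).
have FD : {morph F : x y / x + y} by move=> x y; exact: tens_liftD.
have F'D : {morph F' : x y / x + y} by move=> x y; exact: tens_liftD.
have Fp x v : F (pure h x v) = pure h x (psi v) by exact: tens_lift_pure.
have F'p x v : F' (pure h x v) = pure h x (psi' v) by exact: tens_lift_pure.
exists F; split.
- move=> a x y; rewrite FD; congr (_ + _); move: x.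
  apply: (tensor_ext (h := fun x => F (a *: x)) (h' := fun x => a *: F x)).
  + by move=> x z; rewrite scalerDr FD.
  + by move=> x z; rewrite FD scalerDr.
  + by move=> x v; rewrite scale_pure !Fp scale_pure.
- exists F'.
  + apply: tensor_ext => [x z|//|x v]; first by rewrite FD F'D.
    by rewrite Fp F'p pK.
  + apply: tensor_ext => [x z|//|x v]; first by rewrite F'D FD.
    by rewrite F'p Fp pK'.
- move=> g x; move: x.
  apply: (tensor_ext (h := fun x => F (bc_act g x)) (h' := fun x => bc_act g (F x))).
  + by move=> x z; rewrite bc_actD FD.
  + by move=> x z; rewrite FD bc_actD.
  + by move=> x v; rewrite bc_act_pure !Fp bc_act_pure pg.
- apply: (tensor_ext (h := fun x => bc_map (F x)) (h' := @bc_map _ _ _ _)).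
  + by move=> x z; rewrite FD bc_mapD.
  + by move=> x z; rewrite bc_mapD.
  + by move=> x v; rewrite Fp !bc_map_pure pm.
Qed.

Definition def_map A A' (h : artHom A A') (X : deformation A) : deformation A' :=
  lift_class (bc_lift h (class_rep X)).

Lemma def_map_class A A' (h : artHom A A') (l : lift A) :
  def_map h (lift_class l) = lift_class (bc_lift h l).
Proof.
apply/lift_classP; apply: bc_lift_iso; apply/lift_classP; exact: class_repK.
Qed.

Fact def_map_id A (h : artHom A A) : h =1 id -> forall X, def_map h X = X.
Proof.
move=> hE X; rewrite -(class_repK X); move: (class_rep X) => l.
rewrite def_map_class; apply/lift_classP; have L := liftP l.
exists (@tensor_id _ h (lift_rep l)); split.
- exact: tensor_id_linear.
- exact: tensor_id_bij.
- move=> g x; move: x.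
  apply: (tensor_ext (h := fun x => tensor_id (bc_act g x))
     (h' := fun x => srep_act g (tensor_id x))).
  + by move=> x y; rewrite bc_actD tensor_idD.
  + by move=> x y; rewrite tensor_idD // srep_actD.
  + by move=> x v; rewrite bc_act_pure !tensor_id_pure // srep_actZ.
- apply: (tensor_ext (h := fun x => lift_map (tensor_id x)) (h' := @bc_map _ _ _ _)).
  + by move=> x y; rewrite tensor_idD // (lift_add L).
  + by move=> x y; rewrite bc_mapD.
  + by move=> x v; rewrite tensor_id_pure // bc_map_pure (lift_scale L).
Qed.

Fact def_map_comp A A' A'' (h : artHom A A') (h' : artHom A' A'')
  (h'' : artHom A A'') : h'' =1 h' \o h ->
  forall X, def_map h'' X = def_map h' (def_map h X).
Proof.
move=> hE X; rewrite -(class_repK X); move: (class_rep X) => l.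
rewrite !def_map_class; apply/lift_classP; apply: lift_iso_sym.
pose C := @tensor_comp _ _ _ h h' h'' (lift_rep l).
have CD : {morph C : x y / x + y} by exact: tensor_compD.
have Cp x y v : C (pure _ x (pure _ y v)) = pure _ (x * h' y) v.
  exact: tensor_comp_pure.
exists C; split.
- exact: tensor_comp_linear.
- exact: tensor_comp_bij.
- move=> g x; move: x.
  apply: (@tensor_comp_ext _ _ _ h h' (lift_rep l) (tensor h'' (lift_rep l))
    (fun x => C (@bc_act _ _ _ h' (bc_rep h (lift_rep l)) g x))
    (fun x => @bc_act _ _ _ h'' (lift_rep l) g (C x))).
  + by move=> x y; rewrite bc_actD CD.
  + by move=> x y; rewrite CD bc_actD.
  + move=> x y v; rewrite Cp [RHS]bc_act_pure bc_act_pure.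
    by rewrite -Cp; congr (C (pure _ x _)); exact: bc_act_pure.
- apply: (@tensor_comp_ext _ _ _ h h' (lift_rep l) pi0
    (fun x => @bc_map _ _ h'' l (C x)) (@bc_map _ _ h' (bc_lift h l))).
  + by move=> x y; rewrite CD bc_mapD.
  + by move=> x y; rewrite bc_mapD.
  + move=> x y v; rewrite Cp !bc_map_pure rmorphM -scalerA art_hom_res.
    by congr (_ *: _); apply/esym; exact: bc_map_pure.
Qed.

Definition Def : artFunctor := ArtFunctor def_map_id def_map_comp.

End Art.

Section PadicBounds.
Variables (p : nat) (hp : prime p) (Qp : padicField p) (L : fieldExtType Qp).

Lemma padic_natr_neq0 n : (0 < n)%N -> (n%:R : L) != 0.
Proof.
move=> n0; rewrite -(rmorph_nat (in_alg L)) fmorph_eq0 -padic_norm_eq0.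
have -> : (n%:R : Qp) = ratr n%:R by rewrite ratr_nat.
have nz : (n%:R : rat) != 0 by rewrite pnatr_eq0 -lt0n.
rewrite padic_norm_ratr /padic_abs (negbTE nz) expfz_neq0 //.
by rewrite pnatr_eq0 -lt0n prime_gt0.
Qed.

Lemma padic_normp : padic_norm (p%:R : Qp) = p%:R^-1.
Proof.
have -> : (p%:R : Qp) = ratr p%:R by rewrite ratr_nat.
have nz : (p%:R : rat) != 0 by rewrite pnatr_eq0 -lt0n prime_gt0.
rewrite padic_norm_ratr /padic_abs (negbTE nz) /padic_val.
rewrite -[(p%:R : rat)]/(p%:~R) numq_int denq_int /= logn_prime // eqxx logn1 subr0.
by [].
Qed.

Lemma padic_scale_int (x : Qp) : exists m, forall n, (m <= n)%N ->
  p%:R ^+ n * x \in padic_int Qp.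
Proof.
exists (Num.bound (padic_norm x)) => n mn.
have nX j : padic_norm ((p%:R : Qp) ^+ j) = p%:R^-1 ^+ j.
  by elim: j => [|j IHj]; rewrite ?expr0 ?padic_norm1 // !exprS padic_normM IHj padic_normp.
rewrite inE padic_normM nX exprVn mulrC ler_pdivrMr ?mul1r; last first.
  by rewrite exprn_gt0 // ltr0n prime_gt0.
apply/ltW/(lt_le_trans (archi_boundP (padic_norm_ge0 x))).
rewrite -natrX ler_nat (leq_trans mn) //; apply/ltnW/ltn_expl/prime_gt1/hp.
Qed.

Lemma padic_int_integral (x : Qp) : x \in padic_int Qp -> x%:A \in integers L.
Proof.
move=> hx; apply/integersP.
rewrite (_ : x%:A = Zp_emb L (ZpElt hx)) //; exact: integral_id.
Qed.

Lemma padic_bounded (x : L) : exists m, p%:R ^+ m * x \in integers L.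
Proof.
have /polyOver1P[P PE] : minPoly 1 x \is a polyOver 1%VS by exact: minPolyOver.
have Pm : map_poly (in_alg L) P \is monic by rewrite -PE monic_minPoly.
have Pr : root (map_poly (in_alg L) P) x by rewrite -PE root_minPoly.
have szP : size P = (size P).-1.+1.
  by move: Pm; rewrite map_monic => /monic_neq0; rewrite -size_poly_gt0; case: size.
set d := (size P).-1 in szP.
have [m hm] : exists m, forall i, (i < d)%N -> p%:R ^+ m * P`_i \in padic_int Qp.
  elim: d {szP} => [|e [m IHm]]; first by exists 0%N.
  have [m' hm'] := padic_scale_int P`_e.
  exists (m + m')%N => i; rewrite ltnS leq_eqVlt => /orP[/eqP->|/IHm h].
    by apply: hm'; exact: leq_addl.
  rewrite addnC exprD -mulrA rpredM // rpredX // rpred_nat.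
  by [].
exists m; apply/integersP.
pose c i : Qp := p%:R ^+ (m * (d - i)) * P`_i.
have ci i : (i <= d)%N -> c i \in padic_int Qp.
  rewrite leq_eqVlt => /orP[/eqP->|id].
    rewrite /c subnn muln0 mul1r; move: Pm; rewrite map_monic monicE lead_coefE.
    by move=> /eqP->; rewrite rpred1.
  rewrite /c -(subnSK id) mulnS addnC exprD -mulrA rpredM ?hm //.
  by rewrite rpredX // rpred_nat.
pose R : {poly L} := \poly_(i < d.+1) (c i)%:A.
have Rd : R`_d = 1.
  rewrite coef_poly ltnSn /c subnn muln0 mul1r.
  by move: Pm; rewrite map_monic monicE lead_coefE => /eqP->; rewrite scale1r.
apply: (@integral_root_monic _ _ (Zp_emb L) _ R).
- rewrite monicE lead_coefE.
  have -> : size R = d.+1 by rewrite size_poly_eq //= -/R; move: Rd; rewrite coef_poly ltnSn => ->; rewrite oner_neq0.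
  by rewrite Rd.
- apply/rootP; rewrite horner_poly.
  transitivity (p%:R ^+ (m * d) * (map_poly (in_alg L) P).[x]); last first.
    by rewrite (rootP Pr) mulr0.
  rewrite (@horner_coef_wide _ d.+1) ?size_map_poly ?szP // mulr_sumr.
  apply: eq_bigr => i _; have id : (i <= d)%N by rewrite -ltnS.
  rewrite coef_map /c /= -!/(in_alg L _) rmorphM rmorphXn rmorph_nat exprMn -exprM.
  have -> : (m * d = m * (d - i) + m * i)%N by rewrite -mulnDr subnK.
  by rewrite exprD -!mulrA; congr (_ * _); rewrite mulrCA.
- move=> y /(nthP 0)[i /leq_trans/(_ (size_poly _ _)) id <-].
  by rewrite coef_poly id; apply/integersP/padic_int_integral/ci.
Qed.

Lemma padic_bounded_mx n1 n2 (h : 'M[L]_(n1, n2)) :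
  exists m, forall i j, p%:R ^+ m * h i j \in integers L.
Proof.
pose M i j := projT1 (cid (padic_bounded (h i j))).
exists (\sum_i \sum_j M i j)%N => i j.
rewrite (bigD1 i) //= (bigD1 j) //= -addnA addnC exprD -mulrA rpredM //.
  by rewrite rpredX // rpred_nat.
exact: (projT2 (cid (padic_bounded (h i j)))).
Qed.
End PadicBounds.

Lemma open_subgroup_conj (p : nat) (hp : prime p) (Qp : padicField p)
  (L : fieldExtType Qp) (c : {lrmorphism L -> L}) (h : U11 c) (K : set (U11 c)) :
  open_subgroup K -> open_subgroup [set g | K (h^-1 * g * h)%g].
Proof.
case=> oK K1 KM KV; split=> /=.
- suff : U11_open [set g | K (h^-1 * g * h)%g] by [].
  have oK' : U11_open K by [].
  move=> g /= /oK'[n hn].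
  have [m1 hm1] := padic_bounded_mx hp (val (h^-1)%g).
  have [m2 hm2] := padic_bounded_mx hp (val h).
  exists (n + (m1 + m2))%N => g' gg'; apply: hn => i j.
  have gg i' j' := cid2 (gg' i' j').
  pose Z : 'M[L]_2 := \matrix_(i', j') s2val (gg i' j').
  have ZI i' j' : Z i' j' \in integers L.
    by rewrite mxE; exact: s2valP (gg i' j').
  have ZE : val g' - val g = p%:R ^+ (n + (m1 + m2)) *: Z.
    by apply/matrixP => i' j'; rewrite !mxE -(s2valP' (gg i' j')).
  pose H1 : 'M[L]_2 := p%:R ^+ m1 *: val (h^-1)%g.
  pose H2 : 'M[L]_2 := p%:R ^+ m2 *: val h.
  exists ((H1 *m Z *m H2) i j).
    rewrite mxE; apply: rpred_sum => k _; rewrite rpredM //; last by rewrite mxE.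
    by rewrite mxE; apply: rpred_sum => k' _; rewrite rpredM // mxE.
  have -> : forall A B : 'M[L]_2, A i j - B i j = (A - B) i j by move=> A B; rewrite !mxE.
  have -> : val (h^-1 * g' * h)%g - val (h^-1 * g * h)%g =
     val (h^-1)%g *m (val g' - val g) *m val h.
    by rewrite mulmxBr mulmxBl.
  rewrite ZE /H1 /H2 -!(scalemxAl, scalemxAr) !scalerA.
  by rewrite mxE [in RHS]mxE mulrA !exprD.
- by rewrite mulg1 mulVg.
- move=> g g' Kg Kg'; have := KM _ _ Kg Kg'.
  by rewrite !mulgA mulgK.
- by move=> g /KV; rewrite !invgM invgK mulgA.
Qed.

(* The values of a character are units, since G is a group. *)
Record schar (G : groupTopType) (A : comNzRingType) := SChar {
  schar_fun :> G -> A;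
  schar1 : schar_fun 1%g = 1;
  scharM : forall g h, schar_fun (g * h)%g = schar_fun g * schar_fun h;
  schar_smooth : exists2 K : set G, open_subgroup K &
    forall g, K g -> schar_fun g = 1
}.

Section Characters.
Variables (G : groupTopType) (A : comNzRingType).

Definition triv_char : schar G A.
Proof.
exists (fun _ => 1) => //; first by move=> g h; rewrite mulr1.
by exists setT => //; exact: open_subgroupT.
Defined.

Variable sigma : schar G A.

Lemma scharV g : sigma g * sigma (g^-1)%g = 1.
Proof. by rewrite -scharM mulgV schar1. Qed.

Definition char_rep : srep G A.
Proof.
exists A^o (fun g (v : A^o) => sigma g * v).
- by move=> g a u v; rewrite mulrDr; congr (_ + _); exact: mulrCA.
- by move=> v; rewrite schar1 mul1r.
- by move=> g h v; rewrite scharM mulrA.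
- move=> v; have [K oK K1] := schar_smooth sigma; exists K => // g /K1->.
  by rewrite mul1r.
Defined.

Definition twist_rep (V : srep G A) : srep G A.
Proof.
exists V (fun g (v : V) => sigma g *: srep_act g v).
- move=> g a u v; rewrite srep_actD srep_actZ scalerDr !scalerA.
  by rewrite (mulrC a).
- by move=> v; rewrite schar1 scale1r srep_act1.
- by move=> g h v; rewrite scharM srep_actM srep_actZ scalerA.
- move=> v; have [K oK K1] := schar_smooth sigma.
  have [K' oK' Kv] := srep_smooth v.
  exists (K `&` K'); first exact: open_subgroupI.
  by move=> g [/K1-> /Kv->]; rewrite scale1r.
Defined.
End Characters.

Section CharLift.
Variables (O : comNzRingType) (k : fieldType) (res : {rmorphism O -> k}).
Hypothesis res_surj : forall y, exists x, res x = y.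
Variables (G : groupTopType) (chi : schar G k).

Record char_lift (A : artAlg res) := CharLift {
  char_lift_char :> schar G A;
  char_lift_res : forall g, art_res A (char_lift_char g) = chi g
}.

Variables (A : artAlg res) (sigma : char_lift A).

Definition char_map : char_rep sigma -> char_rep chi := art_res A.

Fact char_is_lift : is_lift char_map.
Proof.
have D (u v : char_rep sigma) : char_map (u + v) = char_map u + char_map v.
  exact: rmorphD.
have Z a (v : char_rep sigma) : char_map (a *: v) = art_res A a *: char_map v.
  exact: rmorphM.
split=> //.
- exists unit, (fun _ => (1 : A^o)); split=> [v|s a].
    by exists [:: (v : A, tt)]; rewrite big_seq1 /= -[RHS]/(_ * _) mulr1.
  case: s => [|[] [|[] s]] //= _; rewrite big_seq1 => a0 [] _.
  by move: a0; rewrite -[LHS]/(_ * _) mulr1.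
- move=> g v; rewrite /char_map /= rmorphM char_lift_res.
  by [].
- move=> w; have [x xw] := res_surj w; exists (art_str A x : A^o).
  by rewrite -xw /char_map art_resE.
- have bP : balanced (art_res A) (fun x (v : char_rep sigma) => x *: char_map v).
    split=> [x y v|x u v|x a v]; first by rewrite scalerDl.
      by rewrite D scalerDr.
    by rewrite Z scalerA.
  have pb := pure_balanced (art_res A) (char_rep sigma).
  exists (fun x : k => pure (art_res A) x (1 : A^o)).
    apply: (tensor_ext (h := fun t => pure _ (tens_lift _ _ t) (1 : A^o)) (h' := id)) => //.
      by move=> x y; rewrite tens_liftD // (balancedDl pb).
    move=> x v; rewrite tens_lift_pure // -[x *: _]/(x * art_res A v).
    by rewrite (balancedM pb) -[v *: _]/(_ * _) mulr1.
  move=> x; rewrite tens_lift_pure // /char_map rmorph1.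
  by rewrite -[LHS]/(_ * _) mulr1.
Qed.
Definition lift_of_char : lift (char_rep chi) A := Lift char_is_lift.
End CharLift.

Section QuotientRep.
Variables (G : groupTopType) (A : comNzRingType) (V : srep G A) (N : set V).
Hypotheses (sN : submodule N) (aN : forall g v, N v -> N (srep_act g v)).

Local Notation Q := (moduleQuot (quotient_pre sN)).
Local Notation cl := (mq (M := quotient_pre sN)).

Lemma quotient_classP (u v : V) : cl u = cl v <-> N (u - v).
Proof. exact: mqP. Qed.
Lemma quotient_repr (v : V) : N (mrepr (cl v) - v).
Proof. by apply/quotient_classP; rewrite mreprK. Qed.

Definition quot_act (g : G) (x : Q) : Q := cl (srep_act g (mrepr x : V)).

Lemma quot_act_class g (v : V) : quot_act g (cl v) = cl (srep_act g v).
Proof.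
apply/quotient_classP; have := aN g (quotient_repr v).
by rewrite srep_actD -scaleN1r srep_actZ scaleN1r.
Qed.

Definition quotient_rep : srep G A.
Proof.
exists Q quot_act.
- move=> g a; elim/mqW=> u; elim/mqW=> v.
  by rewrite -mqZ -mqD !quot_act_class -mqZ -mqD /= srep_linear.
- by elim/mqW=> v; rewrite quot_act_class srep_act1.
- by move=> g h; elim/mqW=> v; rewrite !quot_act_class srep_actM.
- elim/mqW=> v; have [K oK Kv] := srep_smooth (v : V); exists K => // g /Kv e.
  by rewrite quot_act_class e.
Defined.

End QuotientRep.

Section Steinberg.
Variables (p : nat) (hp : prime p) (Qp : padicField p) (L : fieldExtType Qp).
Variable c : {lrmorphism L -> L}.
Local Notation G := (U11 c).

Section Unipotent.
Variables (A : comNzRingType) (sigma : schar G A).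

Let mx2 (x y z t : L) : 'M[L]_2 := \matrix_(i, j)
  (if i == ord0 then (if j == ord0 then x else y)
   else (if j == ord0 then z else t)).
Let mx2M x y z t x' y' z' t' : mx2 x y z t *m mx2 x' y' z' t' =
  mx2 (x * x' + y * z') (x * y' + y * t') (z * x' + t * z') (z * y' + t * t').
Proof.
apply/matrixP => i j; rewrite !mxE !big_ord_recl big_ord0 !mxE /= addr0.
by case: ifP => _; case: ifP.
Qed.
Let mx2T x y z t : (mx2 x y z t)^T = mx2 x z y t.
Proof. by apply/matrixP => i j; rewrite !mxE; do 2!case: ifP. Qed.
Let mx2c x y z t : map_mx c (mx2 x y z t) = mx2 (c x) (c y) (c z) (c t).
Proof. by apply/matrixP => i j; rewrite !mxE; do 2!case: ifP. Qed.
Let ord2P (i : 'I_2) : i = if i == ord0 then ord0 else ord_max.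
Proof. by case: i => [[|[|//]] hi]; apply: val_inj. Qed.
Let mx2E (M : 'M[L]_2) :
  M = mx2 (M ord0 ord0) (M ord0 ord_max) (M ord_max ord0) (M ord_max ord_max).
Proof.
apply/matrixP => i j; rewrite !mxE [in LHS](ord2P i) [in LHS](ord2P j).
by do 2!case: ifP.
Qed.
Let antidiagE : antidiag L = mx2 0 1 1 0.
Proof.
apply/matrixP => i j; rewrite !mxE [in LHS](ord2P i) [in LHS](ord2P j).
by do 2!case: ifP.
Qed.
Let unitaryE (M : 'M[L]_2) : (map_mx c M)^T *m antidiag L *m M = antidiag L ->
  M \in unitary c.
Proof.
move=> e; rewrite inE e eqxx andbT unitmxE unitfE; apply/eqP => d0.
have /eqP := congr1 determinant e; rewrite !det_mulmx d0 mulr0 eq_sym.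
have : antidiag L *m antidiag L = 1%:M.
  by rewrite antidiagE mx2M [RHS]mx2E !mxE /= !(mulr0, mul0r, mulr1, add0r, addr0).
move=> /(congr1 determinant); rewrite det_mulmx det1 => h /eqP d.
by move: h; rewrite d mulr0 => /esym/eqP; rewrite oner_eq0.
Qed.

Lemma schar_unipotent (u : G) : unipotent u -> sigma u = 1.
Proof.
case=> u10 [u00 u11].
set x : L := val u ord0 ord_max.
have uE : val u = mx2 1 x 0 1 by rewrite [LHS]mx2E u10 u00 u11.
have cx : c x + x = 0.
  have /andP[_ /eqP] := U11P u; rewrite -[U11_val u]/(val u) uE antidiagE mx2c mx2T !mx2M.
  move=> /matrixP/(_ ord_max ord_max); rewrite !mxE /=.
  by rewrite !(rmorph1, rmorph0, mulr0, mul0r, mulr1, mul1r, add0r, addr0) addrC.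
pose q : L := (p ^ 2 - 1)%:R.
have q0 : q != 0.
  by rewrite padic_natr_neq0 // subn_gt0 (ltn_trans (prime_gt1 hp)) // expnS ltn_Pmulr ?prime_gt1 ?prime_gt0.
have P0 : (p%:R : L) != 0 by rewrite padic_natr_neq0 ?prime_gt0.
have qE : p%:R * p%:R = q + 1 :> L.
  by rewrite /q natr1 subn1 prednK ?expn_gt0 ?prime_gt0 // -natrM mulnn.
pose y : L := x / q.
have cy : c y + y = 0.
  by rewrite /y fmorph_div rmorph_nat -mulrDl cx mul0r.
have vU : mx2 1 y 0 1 \in unitary c.
  apply: unitaryE; rewrite antidiagE mx2c mx2T !mx2M.
  rewrite !(rmorph1, rmorph0, mulr0, mul0r, mulr1, mul1r, add0r, addr0).
  by rewrite addrC cy.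
have tU : mx2 p%:R 0 0 p%:R^-1 \in unitary c.
  apply: unitaryE; rewrite antidiagE mx2c mx2T !mx2M fmorphV rmorph_nat.
  rewrite !(rmorph1, rmorph0, mulr0, mul0r, mulr1, mul1r, add0r, addr0).
  by rewrite mulfV // rmorph_nat mulVf.
pose v : G := U11Elt vU; pose t : G := U11Elt tU.
have E : (u * (v * t) = t * v)%g.
  apply: val_inj; rewrite [LHS]/= [RHS]/= -[U11_val u]/(val u) uE !mx2M.
  rewrite !(mulr0, mul0r, mulr1, mul1r, add0r, addr0); congr (mx2 _ _ _ _).
  apply: (mulfI P0); rewrite mulrA qE mulrDl mul1r addrC mulrDr !(mulrC p%:R).
  by rewrite -!mulrA mulVf // !mulr1 (mulrC q) divfK // addrC.
have w : sigma v * sigma t * (sigma (v^-1)%g * sigma (t^-1)%g) = 1.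
  by rewrite mulrACA !scharV mulr1.
have := congr1 sigma E; rewrite !scharM => e.
by rewrite -[LHS]mulr1 -[X in _ * X]w mulrA e (mulrC (sigma t)) w.
Qed.
End Unipotent.

Section Induction.
Variables (A : comNzRingType) (tau : schar G A).

(* As B = TU and the character tau|_T of T is inflated to B, the relation reads
   f(tug) = tau(t)f(g); only the restriction of tau to T matters here. *)
Definition ind_pred : {pred G -> A^o} := fun f => `[<
  (forall t u g : G, torus t -> unipotent u -> f (t * u * g)%g = tau t * f g) /\
  (exists2 K : set G, open_subgroup K & forall g h, K h -> f (g * h)%g = f g) >].

Lemma ind_predP f : reflect
  ((forall t u g : G, torus t -> unipotent u -> f (t * u * g)%g = tau t * f g) /\
   (exists2 K : set G, open_subgroup K & forall g h, K h -> f (g * h)%g = f g))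
  (f \in ind_pred).
Proof. exact: asboolP. Qed.

Fact ind_submod : submod_closed ind_pred.
Proof.
split=> [|a f f' /ind_predP[fB [K oK fK]] /ind_predP[fB' [K' oK' fK']]].
  apply/ind_predP; split=> [t u g _ _|]; first by rewrite /= mulr0.
  by exists setT => //; exact: open_subgroupT.
apply/ind_predP; split=> [t u g tt uu|].
  rewrite -[LHS]/(a * f _ + f' _) -[in RHS]/(a * f _ + f' _) fB // fB' //.
  by rewrite mulrDr mulrCA.
exists (K `&` K'); first exact: open_subgroupI.
move=> g h [Kh Kh']; rewrite -[LHS]/(a * f _ + f' _) -[RHS]/(a * f _ + f' _).
by rewrite fK // fK'.
Qed.
HB.instance Definition _ :=
  GRing.isSubmodClosed.Build A (G -> A^o) ind_pred ind_submod.

Record ind := Ind { ind_fun :> G -> A^o; indP : ind_fun \in ind_pred }.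
HB.instance Definition _ := [isSub for ind_fun].
HB.instance Definition _ := [Choice of ind by <:].
HB.instance Definition _ := [SubChoice_isSubLmodule of ind by <:].

Fact ind_trans (h : G) (f : ind) : (fun g => f (g * h)%g) \in ind_pred.
Proof.
case: f => f /= /ind_predP[fB [K oK fK]]; apply/ind_predP; split.
  by move=> t u g tt uu; rewrite -mulgA fB.
exists [set g | K (h^-1 * g * h)%g]; first exact: open_subgroup_conj.
by move=> g g' /(fK (g * h)%g); rewrite !mulgA mulgK.
Qed.
Definition ind_act (h : G) (f : ind) : ind := Ind (ind_trans h f).

Definition ind_rep : srep G A.
Proof.
exists ind ind_act.
- by move=> g a f f'; apply: val_inj; apply/funext.
- by move=> f; apply: val_inj; apply/funext => g; rewrite /= mulg1.
- by move=> h h' f; apply: val_inj; apply/funext => g; rewrite /= mulgA.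
- move=> f; have /ind_predP[_ [K oK fK]] := indP f; exists K => // h Kh.
  by apply: val_inj; apply/funext => g; rewrite /= fK.
Defined.

(* All the functions g |-> a tau(g) lie in ind (char_fun_ind). *)
Definition char_line : set ind_rep :=
  [set f : ind | exists a : A, forall g, f g = a * tau g].

Lemma char_fun_ind (a : A) : (fun g => a * tau g) \in ind_pred.
Proof.
apply/ind_predP; split=> [t u g _ uu|].
  by rewrite !scharM (schar_unipotent tau uu) mulr1 mulrCA.
have [K oK K1] := schar_smooth tau; exists K => // g h /K1 e.
by rewrite scharM e mulr1.
Qed.

Fact char_line_sub : submodule char_line.
Proof.
split=> [|f f' [a fa] [a' fa']|b f [a fa]].
- by exists 0 => g; rewrite mul0r.
- by exists (a + a') => g; rewrite mulrDl -fa -fa'.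
- by exists (b * a) => g; rewrite -mulrA -fa.
Qed.

Fact char_line_act g f : char_line f -> char_line (srep_act g f).
Proof.
by case=> a fa; exists (a * tau g) => h; rewrite /= fa scharM mulrAC mulrA.
Qed.

Definition St_rep : srep G A := quotient_rep char_line_sub char_line_act.
Definition St_class (f : ind) : St_rep := mq (M := quotient_pre char_line_sub) f.

End Induction.

Definition steinberg (A : comNzRingType) : srep G A := St_rep (triv_char G A).

(* The map from St(sigma) to St_G (x) chi induced by f |-> res o f, composed with
   the identification of St(chi) with St_G (x) chi given by f |-> chi^-1 f. *)
Section SteinbergMap.
Variables (O : comNzRingType) (k : fieldType) (res : {rmorphism O -> k}).
Variables (chi : schar G k) (A : artAlg res) (sigma : char_lift chi A).

Fact ind_red_subproof (f : ind sigma) :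
  (fun g => chi (g^-1)%g * art_res A (f g)) \in ind_pred (triv_char G k).
Proof.
case: f => f /= /ind_predP[fB [K oK fK]]; apply/ind_predP; split.
  move=> t u g tt uu.
  have chiu : chi (u^-1)%g = 1.
    by have := scharV chi u; rewrite (schar_unipotent chi uu) mul1r.
  rewrite [RHS]mul1r fB // rmorphM char_lift_res !invgM !scharM chiu mul1r mulrA.
  by congr (_ * _); rewrite -mulrA [chi (t^-1)%g * _]mulrC scharV mulr1.
have [K' oK' chi1] := schar_smooth chi.
exists (K `&` K'); first exact: open_subgroupI.
move=> g h [Kh Kh']; rewrite fK // invgM scharM chi1 ?mul1r //.
by case: oK' => _ _ _; apply.
Qed.
Definition ind_red (f : ind sigma) : ind (triv_char G k) :=
  Ind (ind_red_subproof f).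

Definition St_map (x : St_rep sigma) : twist_rep chi (steinberg k) :=
  St_class (ind_red (mrepr x)).

Lemma ind_redB (f f' : ind sigma) : ind_red f - ind_red f' = ind_red (f - f').
Proof.
apply: val_inj; apply/funext => g.
by rewrite -[LHS]/(chi _ * _ - chi _ * _) -mulrBr -rmorphB.
Qed.

Lemma St_map_class (f : ind sigma) : St_map (St_class f) = St_class (ind_red f).
Proof.
apply/quotient_classP; rewrite ind_redB.
have [a ha] := quotient_repr (char_line_sub sigma) f.
exists (art_res A a) => g; rewrite -[LHS]/(chi _ * art_res A _) ha.
by rewrite rmorphM char_lift_res mulrCA [chi _ * _]mulrC scharV.
Qed.

Lemma St_map_act h (x : St_rep sigma) :
  St_map (srep_act h x) = srep_act h (St_map x).
Proof.
elim/mqW: x => f; rewrite /= quot_act_class; last exact: char_line_act.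
rewrite -[mq f]/(St_class f) -[mq _]/(St_class (ind_act h f)) !St_map_class.
rewrite quot_act_class; last exact: char_line_act.
rewrite -[RHS]mqZ; congr St_class; apply: val_inj; apply/funext => g.
rewrite -[LHS]/(chi _ * art_res A (f (g * h)%g)).
rewrite -[RHS]/(chi h * (chi (g * h)^-1%g * art_res A (f (g * h)%g))).
by rewrite mulrA invgM scharM mulrA scharV mul1r.
Qed.

End SteinbergMap.

End Steinberg.

Arguments St_map {p} hp {Qp L c O k res chi A} sigma x.

(* Main.v *)
Require Import Defs.
From HB Require Import structures.
From mathcomp Require Import all_boot all_order all_algebra all_field.
From mathcomp Require Import all_classical topology_structure.
From mathcomp Require Import ring zify.

Import Order.TTheory GRing.Theory Num.Theory.

Local Open Scope classical_set_scope.
Local Open Scope ring_scope.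

(** Write q = p^2, t = diag(p, p^-1), let w be the antidiagonal element of G, and U_n
    the group of the unipotent matrices with upper right entry in q^n Z_p eps, where
    eps spans the trace zero line of Q_{p^2}.

    Bruhat decomposition identifies St(sigma) with the locally constant functions of
    compact support on Q_p, which have a basis independent of A; hence St(sigma) is a
    lift.

    Let V be a lift of St (x) chi. As smooth functions on Q_p have no U_0-cohomology,
    the class of the characteristic function of Z_p lifts to a U_0-fixed vector v, and
    by successive approximation along ideals of A it can be chosen to be an eigenvector
    of the operator sum_{i < q} u_i t, where u_i is unipotent with upper right entry
    i eps, with a unit as eigenvalue. Such an ordinary vector is unique up to a scalar,
    hence diag(y, 1/c(y)) acts on v by a scalar if y is a unit, and V is free on
    suitable translates of v by the Borel subgroup B. This determines a character tau
    of the torus. Let Gamma be the A[G]-module generated by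
    E = (1_tau, v) in Fun(G, A) x V, where 1_tau is the function supported on BwU_0 in
    the representation induced from tau. The relations between the ordinary vector and
    its translates give Gamma = A wE + A[B]E, so Gamma is the graph of a map from
    functions to V, whose kernel is a free A-module of rank one. So G acts on the
    kernel by a character s lifting chi, and Gamma induces an isomorphism from St(s)
    to V. Uniqueness of s follows from the uniqueness of ordinary vectors, as a
    character of G is determined by its restriction to the torus. *)

Set Implicit Arguments.
Unset Strict Implicit.
Unset Printing Implicit Defensive.

Lemma inj_surj_bij (T U : Type) (f : T -> U) :
  injective f -> (forall y, exists x, f x = y) -> bijective f.
Proof.
by move=> fi fs; have [g gP] := choice fs; exists g => [x|y //]; apply: fi.
Qed.

Section AdditiveFunctions.
Variables (U V : zmodType) (f : U -> V).
Hypothesis fD : {morph f : x y / x + y}.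

Lemma morphD0 : f 0 = 0.
Proof. by apply: (addrI (f 0)); rewrite -fD !addr0. Qed.

Lemma morphDN : {morph f : x / - x}.
Proof. by move=> x; apply: (addrI (f x)); rewrite -fD !subrr morphD0. Qed.

Lemma morphDB : {morph f : x y / x - y}.
Proof. by move=> x y; rewrite fD morphDN. Qed.

Lemma morphD_sum (I : Type) (r : seq I) (F : I -> U) :
  f (\sum_(i <- r) F i) = \sum_(i <- r) f (F i).
Proof. exact: (big_morph f fD morphD0). Qed.

Lemma morphD_inj : (forall x, f x = 0 -> x = 0) -> injective f.
Proof.
move=> f0 x y xy; apply/eqP; rewrite -subr_eq0; apply/eqP/f0.
by rewrite morphDB xy subrr.
Qed.

End AdditiveFunctions.

Lemma linearD_unbundled (A : nzRingType) (U V : lmodType A) (f : U -> V) :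
  linear f -> {morph f : x y / x + y}.
Proof. by move=> fl x y; have := fl 1 x y; rewrite !scale1r. Qed.

HB.instance Definition _ (G : groupTopType) (A : comNzRingType) (V : srep G A)
    (g : G) :=
  GRing.isLinear.Build A V V *:%R (@srep_act G A V g) (srep_linear g).

Lemma srep_actB (G : groupTopType) (A : comNzRingType) (V : srep G A) (g : G)
    (u v : V) :
  srep_act g (u - v) = srep_act g u - srep_act g v.
Proof. exact: linearB. Qed.

Lemma srep_act_sum (G : groupTopType) (A : comNzRingType) (V : srep G A) (g : G)
    (I : Type) (r : seq I) (F : I -> V) :
  srep_act g (\sum_(i <- r) F i) = \sum_(i <- r) srep_act g (F i).
Proof. exact: linear_sum. Qed.

(** * Spans and linear independence *)

Section LinearSpan.
Variables (A : comNzRingType) (V : lmodType A).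
Implicit Types (N X Y : set V) (u v : V).

Lemma submoduleN N v : submodule N -> N v -> N (- v).
Proof. by case=> _ _ NZ Nv; rewrite -scaleN1r; apply: NZ. Qed.

Lemma submoduleB N u v : submodule N -> N u -> N v -> N (u - v).
Proof. by move=> sN Nu /(submoduleN sN); case: sN => _ ND _; apply: ND. Qed.

Lemma submodule_sum N (I : eqType) (r : seq I) (P : pred I) (F : I -> V) :
  submodule N -> (forall i, i \in r -> P i -> N (F i)) ->
  N (\sum_(i <- r | P i) F i).
Proof.
case=> N0 ND _ NF; rewrite big_seq_cond.
by elim/big_rec: _ => // i x /andP[ir Pi]; apply/ND/NF.
Qed.

Lemma submodule_chain_bigcup (F : set (set V)) :
  F !=set0 -> F `<=` @submodule A V -> total_on F subset ->
  submodule (\bigcup_(N in F) N).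
Proof.
move=> [N FN] Fsub Ftot; split=> [|u v [M FM Mu] [M' FM' M'v]|a v [M FM Mv]].
- by exists N => //; case: (Fsub _ FN).
- have [MM'|M'M] := Ftot _ _ FM FM'.
    by exists M' => //; case: (Fsub _ FM') => _ MD _; apply: MD => //; exact: MM'.
  by exists M => //; case: (Fsub _ FM) => _ MD _; apply: MD => //; exact: M'M.
- by exists M => //; case: (Fsub _ FM) => _ _; apply.
Qed.

Lemma submodule_maximal_avoiding N v : submodule N -> ~ N v ->
  exists M, [/\ submodule M, N `<=` M, ~ M v &
    forall M', submodule M' -> M `<=` M' -> ~ M' v -> M' = M].
Proof.
move=> sN Nv; pose adm M := [/\ submodule M, N `<=` M & ~ M v].
have admN : adm N by split.
pose le (M M' : {M | adm M}) := `[< sval M `<=` sval M' >].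
have [|||[M [sM NM Mv]] Mmax] := @ZL_preorder _ (exist adm N admN) le.
- by move=> M; apply/asboolP.
- move=> M1 M2 M3 /asboolP M12 /asboolP M23; apply/asboolP.
  exact: subset_trans M23.
- move=> F Ftot; have [[M FM]|F0] := pselect (F !=set0); last first.
    by exists (exist adm N admN) => M FM; case: F0; exists M.
  suff cup : adm (\bigcup_(M in [set sval M | M in F]) M).
    exists (exist adm _ cup) => M' FM'; apply/asboolP => x M'x.
    by exists (sval M') => //; exists M'.
  split=> [|x Nx|[_ [[M' [_ _ M'v]] _ <-] /M'v]//]; last first.
    by exists (sval M); [exists M|case: (svalP M) => _ + _; apply].
  apply: submodule_chain_bigcup; first by exists (sval M), M.
    by move=> _ [[M' []] //= ? ? ? _ <-].
  move=> _ _ [M1 FM1 <-] [M2 FM2 <-].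
  by case: (Ftot _ _ FM1 FM2) => /asboolP ?; [left|right].
exists M; split=> // M' sM' MM' M'v; apply/seteqP; split=> //.
have admM' : adm M' by split=> //; exact: subset_trans MM'.
by have /asboolP := Mmax (exist adm M' admM') (asboolT MM').
Qed.

Definition lspan X : set V := smallest (@submodule A V) X.

Lemma lspan_submodule X : submodule (lspan X).
Proof.
split=> [N [[]]//|u v Xu Xv N [sN XN]|a v Xv N [sN XN]].
  by case: (sN) => _ ND _; apply: ND; [exact: Xu|exact: Xv].
by case: (sN) => _ _ NZ; apply: NZ; exact: Xv.
Qed.

Lemma lspan0 X : lspan X 0.
Proof. by case: (lspan_submodule X). Qed.

Lemma lspanD X u v : lspan X u -> lspan X v -> lspan X (u + v).
Proof. by case: (lspan_submodule X) => _ + _; apply. Qed.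

Lemma lspanZ X a v : lspan X v -> lspan X (a *: v).
Proof. by case: (lspan_submodule X) => _ _; apply. Qed.

Lemma lspanB X u v : lspan X u -> lspan X v -> lspan X (u - v).
Proof. exact: submoduleB (lspan_submodule X). Qed.

Lemma lspan_sum X (I : eqType) (r : seq I) (P : pred I) (F : I -> V) :
  (forall i, i \in r -> P i -> lspan X (F i)) -> lspan X (\sum_(i <- r | P i) F i).
Proof. exact: submodule_sum (lspan_submodule X). Qed.

Lemma mem_lspan X v : X v -> lspan X v.
Proof. exact: sub_gen_smallest. Qed.

Lemma lspan_min X N : submodule N -> X `<=` N -> lspan X `<=` N.
Proof. exact: smallest_sub. Qed.

Lemma lspan_rangeP (I : Type) (e : I -> V) v :
  lspan (range e) v <-> exists s : seq (A * I), v = \sum_(t <- s) t.1 *: e t.2.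
Proof.
split=> [|[s ->]]; last first.
  elim: s => [|t s IHs]; first by rewrite big_nil; exact: lspan0.
  by rewrite big_cons; apply: lspanD _ IHs; apply: lspanZ; apply: mem_lspan; exists t.2.
move: v; apply: lspan_min => /=; last first.
  by move=> _ [i _ <-]; exists [:: (1, i)]; rewrite big_seq1 scale1r.
split=> [|u v [s ->] [s' ->]|a v [s ->]].
- by exists [::]; rewrite big_nil.
- by exists (s ++ s'); rewrite big_cat.
- exists [seq (a * t.1, t.2) | t <- s]; rewrite big_map scaler_sumr.
  by apply: eq_bigr => t _; rewrite scalerA.
Qed.

Lemma lspan_finP (I : finType) (e : I -> V) v :
  lspan (range e) v <-> exists a : I -> A, v = \sum_i a i *: e i.
Proof.
split=> [|[a ->]]; last first.
  by apply: lspan_sum => i _ _; apply: lspanZ; apply: mem_lspan; exists i.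
move: v; apply: lspan_min; last first.
  move=> _ [i _ <-]; exists (fun j => (j == i)%:R); rewrite (bigD1 i) //=.
  by rewrite eqxx scale1r big1 ?addr0 // => j /negbTE->; rewrite scale0r.
split=> [|_ _ [a ->] [b ->]|d _ [a ->]].
- by exists (fun=> 0); rewrite big1 // => i _; rewrite scale0r.
- exists (fun i => a i + b i); rewrite -big_split; apply: eq_bigr => i _.
  exact/esym/scalerDl.
- exists (fun i => d * a i); rewrite scaler_sumr.
  by apply: eq_bigr => i _; rewrite scalerA.
Qed.

Definition ideal_smul (J : set A) (N : set V) : set V :=
  lspan [set a *: v | a in J & v in N].

Lemma mem_ideal_smul (J : set A) N a v : J a -> N v -> ideal_smul J N (a *: v).
Proof. by move=> Ja Nv; apply: mem_lspan; exists a => //; exists v. Qed.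

Lemma ideal_smul_set0 N v : ideal_smul [set 0] N v -> v = 0.
Proof.
move: v; apply: lspan_min => [|_ [a -> [v _ <-]]]; last exact: scale0r.
by split=> [//|u v -> ->|a v ->]; rewrite ?addr0 ?scaler0.
Qed.

Definition lin_indep (I : eqType) (e : I -> V) : Prop :=
  forall (s : seq I) (a : I -> A), uniq s -> \sum_(i <- s) a i *: e i = 0 ->
    forall i, i \in s -> a i = 0.

Lemma lin_indep_fin (I : finType) (e : I -> V) :
  (forall a : I -> A, \sum_i a i *: e i = 0 -> forall i, a i = 0) -> lin_indep e.
Proof.
move=> ind s a us s0 i si.
rewrite -[LHS](_ : (if i \in s then a i else 0) = _); last by rewrite si.
apply: (ind (fun i => if i \in s then a i else 0)); rewrite -[RHS]s0 [RHS]big_uniq //=.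
rewrite [RHS]big_mkcond; apply: eq_bigr => j _.
by case: ifP => //; rewrite scale0r.
Qed.

End LinearSpan.

Section SemilinearFunctions.
Variables (A A' : comNzRingType) (h : A -> A') (V : lmodType A) (W : lmodType A').
Variable f : V -> W.
Hypothesis fD : {morph f : x y / x + y}.
Hypothesis fZ : forall a v, f (a *: v) = h a *: f v.

Lemma submodule_preimage (N : set W) : submodule N -> submodule (f @^-1` N).
Proof.
case=> N0 ND NZ; split=> [|u v Nu Nv|a v Nv] /=.
- by rewrite morphD0.
- by rewrite fD; exact: ND.
- by rewrite fZ; exact: NZ.
Qed.

Lemma lspan_image (X : set V) (Y : set W) v :
  (forall x, X x -> lspan Y (f x)) -> lspan X v -> lspan Y (f v).
Proof.
move=> XY Xv; apply: (lspan_min (N := f @^-1` lspan Y) _ _ Xv) => //.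
exact/submodule_preimage/lspan_submodule.
Qed.

End SemilinearFunctions.

Section Coefficients.
Variables (A : comNzRingType) (V : lmodType A) (I : choiceType) (e : I -> V).

Definition coef_of (s : seq (A * I)) (i : I) : A := \sum_(t <- s | t.2 == i) t.1.

Lemma sum_coef_of s : \sum_(t <- s) t.1 *: e t.2 =
  \sum_(i <- undup (map snd s)) coef_of s i *: e i.
Proof.
under [RHS]eq_bigr do rewrite scaler_suml.
rewrite (exchange_big_dep xpredT) //= big_seq [RHS]big_seq; apply: eq_bigr => t ts.
rewrite (eq_bigl (fun j => j == t.2)); last by move=> j; rewrite eq_sym.
rewrite -big_filter filter_pred1_uniq ?undup_uniq ?big_seq1 //.
by rewrite mem_undup map_f.
Qed.

Lemma coef_of_notin s i : i \notin undup (map snd s) -> coef_of s i = 0.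
Proof.
move=> si; apply: big1_seq => t /andP[/eqP ti ts]; case/negP: si.
by rewrite mem_undup -ti map_f.
Qed.

Lemma coef_of_cat s s' i : coef_of (s ++ s') i = coef_of s i + coef_of s' i.
Proof. exact: big_cat. Qed.

Lemma coef_of_scale a s i :
  coef_of [seq (a * t.1, t.2) | t <- s] i = a * coef_of s i.
Proof. by rewrite /coef_of big_map mulr_sumr. Qed.

Lemma sum_scale a s : \sum_(t <- [seq (a * t.1, t.2) | t <- s]) t.1 *: e t.2 =
  a *: \sum_(t <- s) t.1 *: e t.2.
Proof.
by rewrite big_map scaler_sumr; apply: eq_bigr => t _; rewrite scalerA.
Qed.

Hypothesis indep : lin_indep e.

Lemma coef_of_eq s s' : \sum_(t <- s) t.1 *: e t.2 = \sum_(t <- s') t.1 *: e t.2 ->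
  coef_of s =1 coef_of s'.
Proof.
move=> ss' i; pose r := s ++ [seq (-1 * t.1, t.2) | t <- s'].
suff : coef_of r i = 0.
  by rewrite coef_of_cat coef_of_scale mulN1r => /eqP; rewrite subr_eq0 => /eqP.
have [ir|] := boolP (i \in undup (map snd r)); last exact: coef_of_notin.
apply: indep ir; first exact: undup_uniq.
by rewrite -sum_coef_of big_cat /= sum_scale ss' scaleN1r subrr.
Qed.

Lemma coordinates_ex : (forall v, lspan (range e) v) ->
  exists co : I -> {linear V -> A^o}, (forall i j, co i (e j) = (j == i)%:R) /\
    forall v, exists2 s : seq I, uniq s & v = \sum_(i <- s) co i v *: e i.
Proof.
move=> span; have [rep repE] := choice (fun v => (lspan_rangeP e v).1 (span v)).
have lin i : linear (fun v => coef_of (rep v) i : A^o).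
  move=> a u v; pose r := [seq (a * t.1, t.2) | t <- rep u] ++ rep v.
  rewrite (@coef_of_eq _ r) ?coef_of_cat ?coef_of_scale //.
  by rewrite big_cat /= sum_scale -!repE.
pose co i : {linear V -> A^o} := HB.pack (fun v => coef_of (rep v) i : A^o)
  (GRing.isLinear.Build A V A^o *:%R _ (lin i)).
exists co; split=> [i j|v].
  rewrite /= (@coef_of_eq _ [:: (1, j)]) -?repE ?big_seq1 ?scale1r //.
  by rewrite /coef_of big_cons big_nil /=; case: eqP; rewrite ?addr0.
exists (undup (map snd (rep v))); first exact: undup_uniq.
by rewrite -sum_coef_of.
Qed.

End Coefficients.

Section LinearImages.
Variables (A : comNzRingType) (V W : lmodType A) (f : {linear V -> W}).
Variables (I : choiceType) (e : I -> V).

Lemma linear_combination (T : Type) (s : seq T) (a : T -> A) (x : T -> V) :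
  f (\sum_(t <- s) a t *: x t) = \sum_(t <- s) a t *: f (x t).
Proof. by rewrite linear_sum; apply: eq_bigr => t _; rewrite linearZ_LR. Qed.

Lemma lspan_range_inj v :
  injective f -> lspan (range (f \o e)) (f v) -> lspan (range e) v.
Proof.
move=> f_inj /lspan_rangeP[s fv]; apply/lspan_rangeP; exists s; apply: f_inj.
by rewrite fv linear_combination.
Qed.

Lemma lin_indep_linear : lin_indep (f \o e) -> lin_indep e.
Proof.
move=> indep s a us s0; apply: indep us _.
by rewrite -linear_combination s0 linear0.
Qed.

End LinearImages.

Section InvertiblePowers.
Variables (R : comNzRingType) (u u' : R).
Hypothesis uV : u * u' = 1.

Definition zpow (i : int) : R := match i with Posz n => u ^+ n | Negz n => u' ^+ n.+1 end.

Lemma zpow_subn m n : zpow (m%:Z - n%:Z) = u ^+ m * u' ^+ n.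
Proof.
have cancel j : u ^+ j * u' ^+ j = 1 by rewrite -exprMn uV expr1n.
have [nm|mn] := leqP n m.
  rewrite subzn // -{2}(subnK nm) exprD -mulrA cancel mulr1.
  by [].
have -> : m%:Z - n%:Z = Negz (n - m).-1 by rewrite NegzE; lia.
by rewrite /= prednK ?subn_gt0 // -{2}(subnKC (ltnW mn)) exprD mulrA cancel mul1r.
Qed.

Lemma zpowD i j : zpow (i + j) = zpow i * zpow j.
Proof.
have sub (k : int) : exists m n : nat, k = m%:Z - n%:Z.
  by case: k => n; [exists n, 0%N|exists 0%N, n.+1]; rewrite ?NegzE; lia.
have [[m [n ->]] [m' [n' ->]]] := (sub i, sub j).
have -> : m%:Z - n%:Z + (m'%:Z - n'%:Z) = (m + m')%N%:Z - (n + n')%N%:Z by lia.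
by rewrite !zpow_subn !exprD mulrACA.
Qed.

End InvertiblePowers.

(** * Ideals of Artinian local algebras *)

Section ArtinianLocalAlgebras.
Variables (O : comNzRingType) (k : fieldType) (res : {rmorphism O -> k}).
Hypothesis res_surj : forall y, exists x, res x = y.
Variable A : artAlg res.
Local Notation rA := (art_res A).
Implicit Types (I J : set A) (P : set (set A)).

Definition maxid : set A := [set a | rA a = 0].

Lemma ideal_submodule I : ideal I -> submodule (I : set A^o).
Proof. by []. Qed.

Lemma art_res_surj (y : k) : exists a : A, rA a = y.
Proof. by have [x xy] := res_surj y; exists (art_str A x); rewrite art_resE. Qed.

Lemma ideal_setT : ideal [set: A].
Proof. by split. Qed.

Lemma ideal_principal (a : A) : ideal [set b * a | b in [set: A]].
Proof.
split=> [|_ _ [b _ <-] [b' _ <-]|d _ [b _ <-]].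
- by exists 0; rewrite ?mul0r.
- by exists (b + b'); rewrite ?mulrDl.
- by exists (d * b); rewrite ?mulrA.
Qed.

Lemma ideal_add_principal J (x : A) : ideal J -> ideal [set y | exists b, J (y - b * x)].
Proof.
case=> J0 JD JM; split=> [|u v [b Jb] [b' Jb']|d u [b Jb]].
- by exists 0; rewrite mul0r subr0.
- by exists (b + b'); rewrite mulrDl opprD addrACA; exact: JD.
- by exists (d * b); rewrite -mulrA -mulrBr; exact: JM.
Qed.

Lemma maxid_ideal : ideal maxid.
Proof.
rewrite /maxid; split=> /= [|x y x0 y0|a x x0]; first exact: rmorph0.
  by rewrite rmorphD x0 y0 addr0.
by rewrite rmorphM x0 mulr0.
Qed.

Lemma maxid_maximal : maximal_ideal maxid.
Proof.
split; [exact: maxid_ideal|by apply/eqP; rewrite rmorph1 oner_eq0|].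
move=> J [_ JD JM] J1 mJ; apply/seteqP; split=> // x Jx; apply: contrapT => /eqP x0.
have [b bx] := art_res_surj (rA x)^-1; apply: J1.
rewrite -(subrK (b * x) 1); apply: JD; last exact: JM.
by apply: mJ; rewrite /maxid /= rmorphB rmorphM bx mulVf // rmorph1 subrr.
Qed.

Lemma art_unit (a : A) : rA a != 0 -> exists b, a * b = 1.
Proof.
move=> /eqP a0; apply: contrapT => nu.
have sa := ideal_submodule (ideal_principal a).
have [|J [iJ aJ J1 Jmax]] := submodule_maximal_avoiding (v := 1 : A^o) sa.
  by move=> [b _ ba]; apply: nu; exists b; rewrite mulrC.
have Jm : maximal_ideal J by split=> // J' iJ' J'1 JJ'; exact: Jmax.
have [I [_ Iuniq]] := art_local A; apply: a0.
have : J a by apply: aJ; exists 1; rewrite ?mul1r.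
by rewrite -(Iuniq _ Jm) (Iuniq _ maxid_maximal).
Qed.

Lemma art_mulf_eq0 (a b : A) : rA a != 0 -> b * a = 0 -> b = 0.
Proof.
move=> /art_unit[a' aa'] ba; rewrite -[b]mulr1 -aa' mulrA ba.
by rewrite mul0r.
Qed.

Lemma artinian_minimal P : (forall I, P I -> ideal I) -> (exists I, P I) ->
  exists I, P I /\ forall J, P J -> J `<=` I -> J = I.
Proof.
move=> Pid [I0 PI0]; apply: contrapT => nomin.
have next (I : {I | P I}) : exists J : {I | P I},
    sval J `<=` sval I /\ sval J <> sval I.
  case: I => I PI; apply: contrapT => h; apply: nomin; exists I; split=> // J PJ JI.
  by apply: contrapT => ne; apply: h; exists (exist _ J PJ).
have [f fP] := choice next.
pose s n := iter n f (exist _ I0 PI0).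
have [N sN] := art_artinian (fun n => Pid _ (svalP (s n))) (fun n => (fP (s n)).1).
exact: (fP (s N)).2 (sN _ (leqnSn N)).
Qed.

(* An ideal minimal among those that do not annihilate I is generated by some x,
   and x = x b t with t in the maximal ideal if I were equal to its multiple. *)
Lemma art_nakayama I x0 : ideal I -> I x0 -> x0 <> 0 ->
  exists2 a, I a & ~ ideal_smul (V := A^o) maxid I a.
Proof.
move=> iI Ix0 x00; apply: contrapT => nak.
have {}nak a : I a -> ideal_smul (V := A^o) maxid I a.
  by move=> Ia; apply: contrapT => mIa; apply: nak; exists a.
pose P := [set J | ideal J /\ exists2 x, J x & exists2 y, I y & x * y <> 0].
have [||J [[iJ [x Jx [y Iy xy]]] Jmin]] := artinian_minimal (P := P).
- by move=> J [].
- exists setT; split; first exact: ideal_setT.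
  by exists 1 => //; exists x0; rewrite ?mul1r.
have [t t0 [z Iz xtz]] : exists2 t, maxid t & exists2 z, I z & x * t * z <> 0.
  apply: contrapT => h; apply: xy.
  apply: (lspan_min (N := [set y : A^o | x * y = 0]) _ _ (nak _ Iy)).
    split=> [|u v /= xu xv|a v /= xv]; first exact: mulr0.
      by rewrite mulrDr xu xv addr0.
    by rewrite -[a *: v]/(a * v) mulrCA xv mulr0.
  move=> _ [t t0 [z Iz <-]] /=; apply: contrapT => ne; apply: h.
  by exists t => //; exists z => //; rewrite -mulrA.
have [_ _ JM] := iJ.
have JE : [set b * (x * t) | b in [set: A]] = J.
  apply: Jmin => [|_ [b _ <-]]; last by apply: (JM b); rewrite mulrC; exact: JM.
  split; first exact: ideal_principal.
  by exists (x * t); [exists 1; rewrite ?mul1r|exists z].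
move: Jx; rewrite -JE => -[b _ bx]; apply: xy.
suff -> : x = 0 by rewrite mul0r.
apply: (@art_mulf_eq0 (1 - b * t)).
  by rewrite rmorphB rmorph1 rmorphM t0 mulr0 subr0 oner_eq0.
by rewrite mulrBr mulr1 -{1}bx; ring.
Qed.

(* I/J is a one-dimensional vector space over k, spanned by the class of a. *)
Record simple_step I J (a : A) : Prop := SimpleStep {
  step_ideal : ideal J;
  step_sub : J `<=` I;
  step_mem : I a;
  step_notin : ~ J a;
  step_gen : forall x, I x -> exists b, J (x - b * a);
  step_maxid : forall b, maxid b -> J (b * a)
}.

Lemma simple_step_ex I x0 : ideal I -> I x0 -> x0 <> 0 ->
  exists J a, simple_step I J a.
Proof.
move=> iI Ix0 x00; have [a Ia mIa] := art_nakayama iI Ix0 x00.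
have smI : submodule (ideal_smul (V := A^o) maxid I) by exact: lspan_submodule.
have [J [iJ mJ Ja Jmax]] := submodule_maximal_avoiding smI mIa.
have {}mJ b x : maxid b -> I x -> J (b * x).
  by move=> b0 Ix; exact: mJ _ (mem_ideal_smul b0 Ix).
have [I0 ID IM] := iI; have [J0 JD JM] := iJ.
exists (J `&` I), a; split=> //.
- split=> [//|x y [? ?] [? ?]|b x [? ?]]; first by split; [exact: JD|exact: ID].
  by split; [exact: JM|exact: IM].
- by case.
- move=> x Ix; have [Jx|Jx] := pselect (J x); first by exists 0; rewrite mul0r subr0.
  have [r Jr] : exists r, J (a - r * x).
    apply: contrapT => nJa; apply: Jx.
    suff <- : [set y | exists b, J (y - b * x)] = J by exists 1; rewrite mul1r subrr.
    apply: Jmax nJa => [|y Jy]; first exact: ideal_add_principal.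
    by exists 0; rewrite mul0r subr0.
  have r0 : rA r != 0.
    apply/eqP => r0; apply: Ja; rewrite -(subrK (r * x) a); apply: JD => //.
    exact: mJ.
  have [r' rr'] := art_unit r0; exists r'; split; last first.
    exact: (submoduleB (ideal_submodule iI) Ix (IM _ _ Ia)).
  rewrite (_ : _ - _ = - r' * (a - r * x)); first exact: JM.
  transitivity (r * r' * x - r' * a); first by rewrite rr' mul1r.
  by ring.
- by move=> b b0; split; [exact: mJ|exact: IM].
Qed.

Lemma artinian_ind P I0 : ideal I0 -> P I0 ->
  (forall I J a, I `<=` I0 -> simple_step I J a -> P I -> P J) -> P [set 0].
Proof.
move=> iI0 PI0 step.
pose Q := [set I | [/\ ideal I, I `<=` I0 & P I]].
have [||I [[iI II0 PI] Imin]] := artinian_minimal (P := Q); first by move=> I [].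
  by exists I0; split.
have [[x Ix x0]|h] := pselect (exists2 x, I x & x <> 0); last first.
  rewrite -(_ : I = [set 0]) //; apply/seteqP; split=> x /=.
    by move=> Ix; apply: contrapT => x0; apply: h; exists x.
  by move=> ->; case: iI.
have [J [a IJ]] := simple_step_ex iI Ix x0.
case: (step_notin IJ); rewrite (_ : J = I); first exact: step_mem IJ.
apply: Imin; last exact: step_sub IJ.
split; first exact: step_ideal IJ.
  exact: subset_trans (step_sub IJ) II0.
exact: step IJ PI.
Qed.

End ArtinianLocalAlgebras.

Arguments maxid {O k res} A.

(** * Bases and base change of lifts *)

Lemma ideal_smul_linear (A : comNzRingType) (V W : lmodType A) (f : {linear V -> W})
    (J : set A) v :
  ideal_smul J [set: V] v -> ideal_smul J [set: W] (f v).
Proof.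
apply: (lspan_image (h := id) (linearD f) (linearZ_LR f)) => _ [a Ja [u _ <-]].
by rewrite linearZ_LR; exact: mem_ideal_smul.
Qed.

Section Lifts.
Variables (O : comNzRingType) (k : fieldType) (res : {rmorphism O -> k}).
Hypothesis res_surj : forall y, exists x, res x = y.
Variables (G : groupTopType) (pi0 : srep G k).
Variables (A : artAlg res) (V : srep G A) (phi : V -> pi0).
Hypothesis L : is_lift phi.
Local Notation rA := (art_res A).
Local Notation mulV J := (ideal_smul J [set: V]).

Lemma lift_balanced : balanced rA (fun x (v : V) => x *: phi v).
Proof.
split=> [x y v|x u v|x a v]; first by rewrite scalerDl.
  by rewrite (lift_add L) scalerDr.
by rewrite (lift_scale L) scalerA.
Qed.

Lemma lift_ker_functional (f : {linear V -> A^o}) y : phi y = 0 -> rA (f y) = 0.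
Proof.
move=> y0; have bP : balanced rA (fun x (v : V) => x * rA (f v)).
  split=> [x u v|x u v|x b v]; first by rewrite mulrDl.
    by rewrite linearD rmorphD mulrDr.
  by rewrite linearZ_LR rmorphM mulrA.
have [g gK _] := lift_red L.
have pure0 : pure rA 1 y = 0.
  apply: (can_inj gK); rewrite (morphD0 (fun x y => tens_liftD x y lift_balanced)).
  by rewrite tens_lift_pure ?y0 ?scaler0 //; exact: lift_balanced.
have := congr1 (tens_lift rA (fun x (v : V) => x * rA (f v))) pure0.
by rewrite (morphD0 (fun x y => tens_liftD x y bP)) tens_lift_pure // mul1r.
Qed.

Lemma lift_coordinates :
  exists (I : choiceType) (e : I -> V) (co : I -> {linear V -> A^o}),
  forall v, exists2 s : seq I, uniq s & v = \sum_(i <- s) co i v *: e i.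
Proof.
have [I [e [span indep]]] := lift_free L.
have [|co [_ coP]] := coordinates_ex indep; last by exists I, e, co.
by move=> v; apply/lspan_rangeP.
Qed.

Lemma lift_ker y : phi y = 0 -> mulV (maxid A) y.
Proof.
move=> y0; have [I [e [co coP]]] := lift_coordinates; have [s _ ->] := coP y.
apply: lspan_sum => i _ _; apply: mem_ideal_smul => //.
exact: lift_ker_functional.
Qed.

Lemma ideal_smul_cancel (J : set A) a y :
  ideal J -> ~ J a -> mulV J (a *: y) -> phi y = 0.
Proof.
move=> iJ Ja Jay; have [I [e [co coP]]] := lift_coordinates.
have [s _ ->] := coP y; rewrite (morphD_sum (lift_add L)) big1 // => i _.
rewrite (lift_scale L); have [->|/(art_unit res_surj)[b yb]] := eqVneq (rA (co i y)) 0.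
  by rewrite scale0r.
have Jco : J (a * co i y).
  rewrite -[a * _]/(a *: co i y) -linearZ_LR.
  apply: (lspan_min (N := co i @^-1` (J : set A^o)) _ _ Jay).
    apply: (submodule_preimage (h := id)); [exact: linearD|exact: linearZ_LR|].
    exact: (ideal_submodule iJ).
  move=> _ [c Jc [v _ <-]] /=; rewrite linearZ_LR [_ *: _]mulrC.
  by case: iJ => _ _; apply.
by case: Ja; case: iJ => _ _ /(_ b _ Jco); rewrite mulrCA (mulrC b) yb mulr1.
Qed.

Section Step.
Variables (I J : set A) (a : A).
Hypothesis IJ : simple_step I J a.

Lemma ideal_smul_step v : mulV I v -> exists y, mulV J (v - a *: y).
Proof.
move: v; apply: (lspan_min (N := [set v | exists y, mulV J (v - a *: y)])).
  split=> [|u v [y hy] [z hz]|b v [y hy]].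
  - by exists 0; rewrite scaler0 subr0; exact: lspan0.
  - by exists (y + z); rewrite scalerDr opprD addrACA; exact: lspanD.
  - by exists (b *: y); rewrite scalerA mulrC -scalerA -scalerBr; exact: lspanZ.
move=> _ [x Ix [v _ <-]]; have [b Jb] := step_gen IJ Ix.
by exists (b *: v); rewrite scalerA mulrC -scalerBl; exact: mem_ideal_smul.
Qed.

Lemma ideal_smul_stepP y : mulV J (a *: y) <-> phi y = 0.
Proof.
split=> [|/lift_ker]; first exact: ideal_smul_cancel (step_ideal IJ) (step_notin IJ).
apply: (lspan_image (h := id)) => [u v|b v|_ [b b0 [v _ <-]]].
- exact: scalerDr.
- by rewrite !scalerA mulrC.
- by rewrite scalerA mulrC; apply: mem_ideal_smul => //; exact: step_maxid IJ _ b0.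
Qed.

Lemma ideal_smul_step_eqP y z : mulV J (a *: y - a *: z) <-> phi y = phi z.
Proof.
rewrite -scalerBr; apply: (iff_trans (ideal_smul_stepP _)).
by rewrite (morphDB (lift_add L)); split=> [/eqP|->]; rewrite ?subrr // subr_eq0 => /eqP.
Qed.

End Step.

Lemma lift_span_image (X : set V) y : lspan (phi @` X) y ->
  exists2 z, lspan X z & phi z = y.
Proof.
move: y; apply: lspan_min; last by move=> _ [x Xx <-]; exists x => //; exact: mem_lspan.
split=> [|_ _ [u Xu <-] [v Xv <-]|d _ [v Xv <-]].
- by exists 0; [exact: lspan0|exact: morphD0 (lift_add L)].
- by exists (u + v); [exact: lspanD|rewrite (lift_add L)].
- have [b <-] := art_res_surj res_surj A d.
  by exists (b *: v); [exact: lspanZ|rewrite (lift_scale L)].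
Qed.

Lemma lspan_fixed (H : set G) (X : set V) :
  (forall h x, H h -> X x -> srep_act h x = x) ->
  forall u, lspan X u -> forall h, H h -> srep_act h u = u.
Proof.
move=> HX u Xu h Hh; apply: (lspan_min (N := [set u | srep_act h u = u]) _ _ Xu).
  split=> [|x y /= hx hy|b x /= hx]; first exact: linear0.
    by rewrite /= srep_actD hx hy.
  by rewrite /= srep_actZ hx.
by move=> x Xx; exact: HX.
Qed.

(* Nakayama, relative to the vectors fixed by H. *)
Lemma lift_fixed_span (H : set G) (X : set V) :
  (forall h x, H h -> X x -> srep_act h x = x) ->
  (forall y : pi0, (forall h, H h -> srep_act h y = y) -> lspan (phi @` X) y) ->
  forall v : V, (forall h, H h -> srep_act h v = v) -> lspan X v.
Proof.
move=> HX Xspan v Hv.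
suff [u Xu] : exists2 u, lspan X u & mulV [set 0] (v - u).
  by move=> /ideal_smul_set0/eqP; rewrite subr_eq0 => /eqP->.
apply: (artinian_ind res_surj (P := fun I => exists2 u, lspan X u & mulV I (v - u))
  (ideal_setT A)).
  exists 0; first exact: lspan0.
  by rewrite subr0 -[v]scale1r; exact: mem_ideal_smul.
move=> I J a _ IJ [u Xu Iu]; have [y Jy] := ideal_smul_step IJ Iu.
have [|z Xz zy] := lift_span_image (Xspan (phi y) _).
  move=> h Hh; rewrite -(lift_equiv L); apply/(ideal_smul_step_eqP IJ).
  have := lspanB Jy (ideal_smul_linear (srep_act h) Jy).
  rewrite /= !srep_actB srep_actZ Hv // (lspan_fixed HX Xu) //.
  by rewrite opprB addrC addrA subrK.
exists (u + a *: z); first by apply: lspanD => //; exact: lspanZ.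
have := lspanD Jy ((ideal_smul_step_eqP IJ _ _).2 (esym zy)).
by rewrite addrA subrK opprD addrA.
Qed.

Lemma lift_lin_indep (I : choiceType) (x : I -> V) :
  lin_indep (phi \o x) -> lin_indep x.
Proof.
move=> indep s a us a0; suff : forall i, i \in s -> [set (0 : A)] (a i) by [].
apply: (artinian_ind res_surj (P := fun J => forall i, i \in s -> J (a i))
  (ideal_setT A)) => // J J' b _ JJ' Ja.
have [d dP] : exists d : I -> A, forall i, i \in s -> J' (a i - d i * b).
  have ex i : exists d, i \in s -> J' (a i - d * b).
    have [si|] := boolP (i \in s); last by exists 0.
    by have [d hd] := step_gen JJ' (Ja i si); exists d.
  by have [d dP] := choice ex; exists d.
have d0 : forall i, i \in s -> rA (d i) = 0.
  apply: (indep s (rA \o d) us) => /=.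
  transitivity (phi (\sum_(i <- s) d i *: x i)).
    by rewrite (morphD_sum (lift_add L)); apply: eq_bigr => i _; rewrite (lift_scale L).
  apply/(ideal_smul_stepP JJ').
  have E : b *: (\sum_(i <- s) d i *: x i) = - \sum_(i <- s) (a i - d i * b) *: x i.
    under [in RHS]eq_bigr do rewrite scalerBl.
    rewrite sumrB a0 sub0r opprK scaler_sumr.
    by apply: eq_bigr => i _; rewrite scalerA mulrC.
  rewrite E; apply: (submoduleN (lspan_submodule _)); apply: lspan_sum => i si _.
  by apply: mem_ideal_smul => //; exact: dP.
move=> i si; rewrite -(subrK (d i * b) (a i)).
have [_ J'D _] := step_ideal JJ'.
by apply: J'D; [exact: dP|exact/(step_maxid JJ')/d0].
Qed.

Lemma lift_scale_inj v : phi v != 0 -> injective (fun a : A => a *: v).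
Proof.
move=> v0; have indep : lin_indep (fun _ : unit => v).
  apply: lift_lin_indep; apply: lin_indep_fin => b.
  rewrite (bigD1 tt) //= big1 => [/eqP|[]//]; rewrite addr0 scaler_eq0 (negbTE v0) orbF.
  by move=> /eqP b0 [].
move=> a b /eqP; rewrite -subr_eq0 -scalerBl => /eqP ab; apply/eqP; rewrite -subr_eq0.
by apply/eqP; apply: (indep [:: tt] (fun=> a - b)) (mem_head _ _); rewrite ?big_seq1.
Qed.

End Lifts.

Section LiftMorphisms.
Variables (O : comNzRingType) (k : fieldType) (res : {rmorphism O -> k}).
Hypothesis res_surj : forall y, exists x, res x = y.
Variables (G : groupTopType) (pi0 : srep G k) (A : artAlg res).
Local Notation rA := (art_res A).

Lemma lift_morphism_iso (l l' : Defs.lift pi0 A) (psi : lift_rep l -> lift_rep l') :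
  linear psi -> (forall g v, psi (srep_act g v) = srep_act g (psi v)) ->
  (forall v, lift_map (psi v) = lift_map v) -> lift_iso l l'.
Proof.
move=> psi_lin psi_act psi_map; exists psi; split=> //.
pose Psi : {linear _ -> _} := HB.pack psi (GRing.isLinear.Build _ _ _ _ psi psi_lin).
have L := liftP l; have L' := liftP l'.
apply: inj_surj_bij => [|y].
  apply: (morphD_inj (linearD Psi)) => v /= v0; apply: (@ideal_smul_set0 _ _ setT).
  apply: (artinian_ind res_surj (P := fun I => ideal_smul I setT v) (ideal_setT A)).
    by rewrite -[v]scale1r; exact: mem_ideal_smul.
  move=> I J a _ IJ Iv; have [y Jy] := ideal_smul_step IJ Iv.
  rewrite -(subrK (a *: y) v); apply: lspanD => //.
  apply/(ideal_smul_stepP res_surj L IJ); rewrite -psi_map.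
  apply/(ideal_smul_stepP res_surj L' IJ).
  have := lspanZ (-1) (ideal_smul_linear Psi Jy).
  by rewrite linearB linearZ_LR /= v0 sub0r scaleN1r opprK.
have /lspan_rangeP[s ->] : lspan (range psi) y.
  apply: (lift_fixed_span res_surj L' (H := set0)) => // z _; apply: mem_lspan.
  by have [v <-] := lift_surj L z; exists (psi v); [exists v|].
exists (\sum_(t <- s) t.1 *: t.2).
by rewrite -[psi]/(Psi : _ -> _) linear_sum; apply: eq_bigr => t _; rewrite linearZ_LR.
Qed.

Lemma is_lift_of_basis (V : srep G A) (phi : V -> pi0) (I : choiceType) (e : I -> V) :
  {morph phi : u v / u + v} -> (forall a v, phi (a *: v) = rA a *: phi v) ->
  (forall g v, phi (srep_act g v) = srep_act g (phi v)) ->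
  (forall v, lspan (range e) v) -> lin_indep e ->
  (forall w, lspan (range (phi \o e)) w) -> lin_indep (phi \o e) ->
  is_lift phi.
Proof.
move=> phiD phiZ phi_act span indep span0 indep0.
have phi_surj w : exists v, phi v = w.
  move: w (span0 w); apply: lspan_min => [|_ [i _ <-]]; last by exists (e i).
  split=> [|_ _ [u <-] [v <-]|d _ [v <-]]; first by exists 0; exact: morphD0.
    by exists (u + v).
  by have [b <-] := art_res_surj res_surj A d; exists (b *: v).
have bP : balanced rA (fun x (v : V) => x *: phi v).
  split=> [x y v|x u v|x a v]; first by rewrite scalerDl.
    by rewrite phiD scalerDr.
  by rewrite phiZ scalerA.
split=> //; first by exists I, e; split=> // v; apply/lspan_rangeP.
set K := tens_lift _ _.
have KD : {morph K : x y / x + y} by move=> x y; exact: tens_liftD.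
have Kpure x v : K (pure rA x v) = x *: phi v by exact: tens_lift_pure.
apply: inj_surj_bij => [|w]; last first.
  by have [v <-] := phi_surj w; exists (pure rA 1 v); rewrite Kpure scale1r.
have pb := pure_balanced rA V.
have tspan x : lspan (range (pure rA 1 \o e)) x.
  elim/tensorW: x => [|b v|y z hy hz]; [exact: lspan0| |exact: lspanD].
  rewrite -[b]mulr1 -scale_pure; apply: lspanZ.
  apply: (lspan_image (h := rA) (f := pure rA 1) _ _ _ (span v)).
  - by move=> u u'; rewrite (balancedDr pb).
  - by move=> a u; rewrite -(balancedM pb) scale_pure mulrC.
  - by move=> _ [i _ <-]; apply: mem_lspan; exists i.
apply: (morphD_inj KD) => x; have /lspan_rangeP[s ->] := tspan x.
rewrite sum_coef_of /= (morphD_sum KD) big_seq => K0; rewrite big_seq big1 // => i si.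
rewrite (indep0 _ (coef_of s) (undup_uniq _) _ _ si) ?scale0r //.
by rewrite big_seq -[RHS]K0; apply: eq_bigr => j _; rewrite scale_pure Kpure mulr1.
Qed.

End LiftMorphisms.

Section SemilinearBaseChange.
Variables (O : comNzRingType) (k : fieldType) (res : {rmorphism O -> k}).
Hypothesis res_surj : forall y, exists x, res x = y.
Variables (G : groupTopType) (pi0 : srep G k) (A A' : artAlg res).
Variables (h : artHom A A') (l : Defs.lift pi0 A) (l' : Defs.lift pi0 A').
Variable f : lift_rep l -> lift_rep l'.
Hypothesis fD : {morph f : u v / u + v}.
Hypothesis fZ : forall a v, f (a *: v) = h a *: f v.
Hypothesis f_act : forall g v, f (srep_act g v) = srep_act g (f v).
Hypothesis f_map : forall v, lift_map (f v) = lift_map v.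

Lemma bc_lift_semilinear_iso : lift_iso (bc_lift res_surj h l) l'.
Proof.
have L' := liftP l'.
have bP : balanced h (fun x v => x *: f v).
  split=> [x y v|x u v|x a v]; first by rewrite scalerDl.
    by rewrite fD scalerDr.
  by rewrite fZ scalerA.
pose F : tensor h (lift_rep l) -> lift_rep l' := tens_lift h (fun x v => x *: f v).
have FD : {morph F : x y / x + y} by move=> x y; exact: tens_liftD.
have Fpure x v : F (pure h x v) = x *: f v by exact: tens_lift_pure.
have FZ r x : F (r *: x) = r *: F x.
  move: x; apply: (tensor_ext (h := fun x => F (r *: x)) (h' := fun x => r *: F x)).
  - by move=> x y; rewrite scalerDr FD.
  - by move=> x y; rewrite FD scalerDr.
  - by move=> x v; rewrite scale_pure !Fpure scalerA.
apply: (lift_morphism_iso res_surj (l := bc_lift res_surj h l) (psi := F)).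
- by move=> r x y; rewrite FD FZ.
- move=> g; apply: (tensor_ext (h := fun x => F (bc_act g x))
    (h' := fun x => srep_act g (F x))).
  + by move=> x y; rewrite bc_actD FD.
  + by move=> x y; rewrite FD srep_actD.
  + by move=> x v; rewrite bc_act_pure !Fpure f_act srep_actZ.
- suff E : (fun x => lift_map (F x)) =1 @bc_map _ _ _ _ _ _ _ h l by exact: E.
  apply: tensor_ext => [x y|x y|x v] /=; first by rewrite FD (lift_add L').
    exact: bc_mapD.
  by rewrite Fpure (lift_scale L') f_map bc_map_pure.
Qed.

End SemilinearBaseChange.

(** * Deformations of characters *)

Section Characters.
Variable G : groupTopType.

Lemma schar_ext (R : comNzRingType) (s s' : schar G R) : s =1 s' -> s = s'.
Proof.
case: s s' => [f f1 fM fs] [g g1 gM gs] /= /funext fg; rewrite -fg in g1 gM gs *.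
congr SChar; exact: Prop_irrelevance.
Qed.

Lemma schar_neq0 (F : fieldType) (s : schar G F) g : s g != 0.
Proof.
apply/eqP => sg0; have := scharV s g; rewrite sg0 mul0r => /eqP.
by rewrite eq_sym oner_eq0.
Qed.

Lemma schar_eq_div (R : comNzRingType) (s s' : schar G R) g h :
  s (g * h)%g = s' (g * h)%g -> s h = s' h -> s g = s' g.
Proof.
rewrite !scharM => E Eh; have := congr1 ( *%R^~ (s (h^-1)%g)) E.
by rewrite /= Eh -!mulrA -[in X in _ = X -> _]Eh !scharV !mulr1 -Eh scharV mulr1.
Qed.

Variables (O : comNzRingType) (k : fieldType) (res : {rmorphism O -> k}).
Hypothesis res_surj : forall y, exists x, res x = y.
Variable chi : schar G k.

Lemma char_lift_ext (A : artAlg res) (s s' : char_lift chi A) : s =1 s' -> s = s'.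
Proof.
case: s s' => [s hs] [s' hs'] /= /schar_ext ss'; rewrite -ss' in hs' *.
congr CharLift; exact: Prop_irrelevance.
Qed.

Lemma char_lift_gen (A : artAlg res) (l : Defs.lift (char_rep chi) A) (v : lift_rep l) :
  lift_map v = 1 -> forall x, exists a, x = a *: v.
Proof.
move=> v1 x; have /lspan_finP[a ->] : lspan (range (fun _ : unit => v)) x.
  apply: (lift_fixed_span res_surj (liftP l) (H := set0)) => // y _.
  rewrite (_ : y = (y : k) *: lift_map v); last by rewrite v1 -[RHS]/(_ * _) mulr1.
  by apply: lspanZ; apply: mem_lspan; exists v => //; exists tt.
by exists (a tt); rewrite (bigD1 tt) //= big1 ?addr0 // => -[].
Qed.

Lemma char_lift_ex (A : artAlg res) (l : Defs.lift (char_rep chi) A) :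
  exists s : char_lift chi A, lift_iso (lift_of_char res_surj s) l.
Proof.
have L := liftP l; have [v v1] := lift_surj L 1.
have inj : injective (fun a : A => a *: v).
  by apply: (lift_scale_inj res_surj L); rewrite v1; exact: oner_neq0.
have [f fE] := choice (fun g => char_lift_gen v1 (srep_act g v)).
have f1 : f 1%g = 1 by apply: inj; rewrite -fE srep_act1 scale1r.
have fM g h : f (g * h)%g = f g * f h.
  by apply: inj; rewrite -fE srep_actM fE srep_actZ fE scalerA mulrC.
have fs : exists2 K : set G, open_subgroup K & forall g, K g -> f g = 1.
  have [K oK Kv] := srep_smooth v; exists K => // g /Kv e.
  by apply: inj; rewrite -fE e scale1r.
have f_res g : art_res A (SChar f1 fM fs g) = chi g.
  have := lift_equiv L g v; rewrite fE (lift_scale L) v1 -[LHS]/(_ * _) mulr1 => ->.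
  by rewrite /= mulr1.
exists (CharLift f_res).
apply: (lift_morphism_iso res_surj (l := lift_of_char res_surj (CharLift f_res))
  (psi := fun a : A^o => (a : A) *: v)).
- by move=> a x y; rewrite scalerDl -scalerA.
- by move=> g x; rewrite srep_actZ fE scalerA mulrC.
- move=> x; rewrite (lift_scale L) v1 -[LHS]/(_ * _) mulr1.
  by [].
Qed.

Lemma lift_of_char_inj (A : artAlg res) (s s' : char_lift chi A) :
  lift_iso (lift_of_char res_surj s) (lift_of_char res_surj s') -> s = s'.
Proof.
case=> psi [psi_lin _ psi_act psi_map]; apply: char_lift_ext => g.
have psi1 : art_res A (psi (1 : A^o)) = 1.
  by have := psi_map (1 : A^o); rewrite /= /char_map => ->; rewrite rmorph1.
apply/eqP; rewrite -subr_eq0; apply/eqP.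
apply: (@art_mulf_eq0 _ _ _ res_surj _ (psi (1 : A^o))); first by rewrite psi1 oner_eq0.
have := scalable_linear psi_lin (s g) (1 : A^o).
rewrite -[s g *: (1 : A^o)]/(srep_act g (1 : char_rep s)) psi_act => E.
by rewrite mulrBl -[s' g * _]/(srep_act g (psi 1)) E subrr.
Qed.

Definition char_def (A : artAlg res) (s : char_lift chi A) :
  Def res_surj (char_rep chi) A := lift_class (lift_of_char res_surj s).

Lemma char_def_surj (A : artAlg res) (X : Def res_surj (char_rep chi) A) :
  exists s, char_def s = X.
Proof.
have [s hs] := char_lift_ex (class_rep X); exists s.
by rewrite -[RHS]class_repK; apply/lift_classP.
Qed.

Definition char_of_def (A : artAlg res) (X : Def res_surj (char_rep chi) A) :
  char_lift chi A := projT1 (cid (char_def_surj X)).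

Lemma char_of_defK (A : artAlg res) : cancel (@char_of_def A) (@char_def A).
Proof. by move=> X; rewrite /char_of_def; case: cid. Qed.

Lemma char_defK (A : artAlg res) : cancel (@char_def A) (@char_of_def A).
Proof. by move=> s; apply/lift_of_char_inj/lift_classP; exact: char_of_defK. Qed.

Section PushForward.
Variables (A A' : artAlg res) (h : artHom A A') (s : char_lift chi A).

Fact push_char1 : h (s 1%g) = 1. Proof. by rewrite schar1 rmorph1. Qed.
Fact push_charM g g' : h (s (g * g')%g) = h (s g) * h (s g').
Proof. by rewrite scharM rmorphM. Qed.
Fact push_char_smooth : exists2 K : set G, open_subgroup K &
  forall g, K g -> h (s g) = 1.
Proof.
by have [K oK K1] := schar_smooth s; exists K => // g /K1 ->; rewrite rmorph1.
Qed.
Definition push_schar : schar G A' := SChar push_char1 push_charM push_char_smooth.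
Fact push_char_res g : art_res A' (push_schar g) = chi g.
Proof. by rewrite /= art_hom_res // char_lift_res. Qed.
Definition push_char : char_lift chi A' := CharLift push_char_res.

Lemma bc_char_iso : lift_iso (bc_lift res_surj h (lift_of_char res_surj s))
  (lift_of_char res_surj push_char).
Proof.
apply: (bc_lift_semilinear_iso res_surj (l := lift_of_char res_surj s)
  (l' := lift_of_char res_surj push_char) (f := h : A^o -> A'^o)) => [u v|a v|g v|v].
- exact: rmorphD.
- exact: rmorphM.
- exact: rmorphM.
- exact: (art_hom_res res_surj h).
Qed.

Lemma def_map_char_def : af_map h (char_def s) = char_def push_char.
Proof. by rewrite /= def_map_class; apply/lift_classP; exact: bc_char_iso. Qed.

End PushForward.

End Characters.

(** * Quadratic conjugations and two by two matrices *)

Section QuadraticConjugation.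
Variables (F : fieldType) (L : fieldExtType F) (c : {lrmorphism L -> L}).

Record tracelessGen := TracelessGen {
  traceless :> L;
  traceless_char : (2%:R : L) != 0;
  traceless_neq0 : traceless != 0;
  traceless_conj : c traceless = - traceless;
  traceless_dec : forall y : L, exists a b : F, y = a%:A + b *: traceless
}.

Lemma alg_inj : injective (fun a : F => a%:A : L).
Proof. exact: (fmorph_inj (in_alg L)). Qed.

Lemma algM (a b : F) : (a * b)%:A = a%:A * b%:A :> L.
Proof. exact: (rmorphM (in_alg L)). Qed.

Lemma algV (a : F) : a^-1%:A = a%:A^-1 :> L.
Proof. exact: (fmorphV (in_alg L)). Qed.

Lemma alg_nat n : n%:R%:A = n%:R :> L.
Proof. exact: (rmorph_nat (in_alg L)). Qed.

Lemma conj_alg (a : F) : c a%:A = a%:A.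
Proof. exact: rmorph_alg. Qed.

Lemma conjZ (a : F) x : c (a *: x) = a *: c x.
Proof. exact: linearZ. Qed.

Lemma conjD x y : c (x + y) = c x + c y. Proof. exact: rmorphD. Qed.
Lemma conjN x : c (- x) = - c x. Proof. exact: rmorphN. Qed.
Lemma conjB x y : c (x - y) = c x - c y. Proof. exact: rmorphB. Qed.
Lemma conjM x y : c (x * y) = c x * c y. Proof. exact: rmorphM. Qed.
Lemma conjV x : c x^-1 = (c x)^-1. Proof. exact: fmorphV. Qed.
Lemma conj1 : c 1 = 1. Proof. exact: rmorph1. Qed.
Lemma conj0 : c 0 = 0. Proof. exact: rmorph0. Qed.
Lemma conj_eq0 x : (c x == 0) = (x == 0). Proof. exact: fmorph_eq0. Qed.

(* c exchanges the two roots x and v - x of the minimal polynomial of x. *)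
Lemma conj_quadratic_root (u v : F) (x : L) :
  x * x = u%:A + v *: x -> c x <> x -> c x = v%:A - x.
Proof.
rewrite -(mulr_algl v x) => xx cx.
have cxx : c x * c x = u%:A + v%:A * c x.
  by rewrite -conjM xx conjD conjM !conj_alg.
have : (c x - x) * (c x - (v%:A - x)) = 0.
  transitivity ((c x * c x) - v%:A * c x - (x * x - v%:A * x)); first by ring.
  by rewrite xx cxx; ring.
by move/eqP; rewrite mulf_eq0 !subr_eq0 => /orP[/eqP//|/eqP].
Qed.

Lemma quadratic_span (x : L) : \dim {: L} = 2%N -> x \notin <[1 : L]>%VS ->
  forall y, exists a b : F, y = a%:A + b *: x.
Proof.
move=> dimL x1 y; have : y \in span [:: 1; x].
  rewrite (_ : span _ = fullv) ?memvf //; apply/eqP; rewrite eqEdim subvf dimL.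
  suff : free [:: 1; x] by move=> /eqP->.
  rewrite (perm_free (_ : perm_eq _ [:: x; 1])) ?(perm_catC [:: 1] [:: x]) //.
  by rewrite free_cons span_seq1 x1 seq1_free oner_neq0.
rewrite span_cons span_seq1 => /memv_addP[_ /vlineP[a ->] [_ /vlineP[b ->] ->]].
by exists a, b.
Qed.

Lemma tracelessGen_ex : (2%:R : L) != 0 -> \dim {: L} = 2%N ->
  (exists x, c x <> x) -> inhabited tracelessGen.
Proof.
move=> two0 dimL [x cx].
have x1 : x \notin <[1 : L]>%VS.
  by apply/negP => /vlineP[a e]; apply: cx; rewrite e conj_alg.
have dec := quadratic_span dimL x1.
have [u [v xx]] := dec (x * x); have cxE := conj_quadratic_root xx cx.
constructor; apply: (@TracelessGen (x - c x)) => // [||y].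
- by rewrite subr_eq0 eq_sym; apply/eqP.
- by rewrite cxE !conjB cxE conj_alg; ring.
have [a [b ->]] := dec y; exists (a + b * v / 2%:R), (b / 2%:R).
rewrite cxE scalerDl -!(mulr_algl _ (_ - _)) -(mulr_algl b x) -addrA; congr (_ + _).
by apply: (mulfI two0); rewrite !algM algV alg_nat; field.
Qed.

Definition Nm (x : L) : F := xget 0 [set a | x * c x = a%:A].

Variable e : tracelessGen.

Lemma conjK : involutive c.
Proof.
move=> y; have [a [b ->]] := traceless_dec e y.
by rewrite !(conjD, conj_alg, conjZ, conjN, traceless_conj) !(scalerN, opprK).
Qed.

Lemma eqNr_eq0 (x : L) : (x == - x) = (x == 0).
Proof.
rewrite -addr_eq0 -mulr2n -mulr_natl mulf_eq0.
by rewrite (negbTE (traceless_char e)).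
Qed.

Lemma conj_fixedP x : c x = x -> exists a : F, x = a%:A.
Proof.
have [a [b ->]] := traceless_dec e x.
rewrite conjD conj_alg conjZ traceless_conj scalerN => /addrI/eqP.
by rewrite eq_sym eqNr_eq0 => /eqP->; exists a; rewrite addr0.
Qed.

Lemma conj_tracelessP y : c y = - y -> exists b : F, y = b *: (e : L).
Proof.
have [a [b ->]] := traceless_dec e y.
rewrite conjD conj_alg conjZ traceless_conj scalerN opprD => /addIr/eqP.
by rewrite eqNr_eq0 => /eqP->; exists b; rewrite add0r.
Qed.

Lemma NmE x : x * c x = (Nm x)%:A.
Proof.
have [a ha] : exists a : F, x * c x = a%:A.
  by apply: conj_fixedP; rewrite conjM conjK mulrC.
exact: (@xgetI _ 0 [set a | x * c x = a%:A] a).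
Qed.

Lemma Nm_unique x a : x * c x = a%:A -> Nm x = a.
Proof. by move=> xa; apply: alg_inj; rewrite -NmE. Qed.

Lemma NmM x y : Nm (x * y) = Nm x * Nm y.
Proof. by apply: Nm_unique; rewrite conjM mulrACA !NmE algM. Qed.

Lemma Nm_alg (a : F) : Nm a%:A = a * a.
Proof. by apply: Nm_unique; rewrite conj_alg algM. Qed.

Lemma Nm_nat n : Nm n%:R = (n * n)%:R.
Proof. by rewrite -alg_nat Nm_alg natrM. Qed.

Lemma Nm1 : Nm 1 = 1.
Proof. exact: (Nm_nat 1). Qed.

Lemma NmX x n : Nm (x ^+ n) = Nm x ^+ n.
Proof. by elim: n => [|n IHn]; rewrite ?Nm1 // !exprS NmM IHn. Qed.

Lemma Nm_eq0 x : (Nm x == 0) = (x == 0).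
Proof.
apply/eqP/eqP => [n0|->]; last by apply: Nm_unique; rewrite mul0r scale0r.
have /eqP := NmE x; rewrite n0 scale0r mulf_eq0 conj_eq0 orbb.
by move/eqP.
Qed.

Lemma NmV x : Nm x^-1 = (Nm x)^-1.
Proof.
have Nm0 : Nm 0 = 0 by apply/eqP; rewrite Nm_eq0.
have [->|x0] := eqVneq x 0; first by rewrite invr0 Nm0 invr0.
have n0 : Nm x != 0 by rewrite Nm_eq0.
by apply: (mulfI n0); rewrite -NmM !mulfV ?Nm1.
Qed.

Lemma Nm_conj x : Nm (c x) = Nm x.
Proof. by apply: Nm_unique; rewrite conjK mulrC NmE. Qed.

Lemma Nm_traceless : traceless e * traceless e = (- Nm e)%:A.
Proof. by rewrite scaleNr -NmE traceless_conj mulrN opprK. Qed.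

End QuadraticConjugation.

Section Matrix2.
Variable R : comNzRingType.

Definition mx2 (x y z t : R) : 'M[R]_2 := \matrix_(i, j)
  (if i == ord0 then (if j == ord0 then x else y)
   else (if j == ord0 then z else t)).

Lemma ord2E (i : 'I_2) : i = if i == ord0 then ord0 else ord_max.
Proof. by case: i => [[|[|//]] hi]; apply: val_inj. Qed.

Lemma mx2E (M : 'M[R]_2) :
  M = mx2 (M ord0 ord0) (M ord0 ord_max) (M ord_max ord0) (M ord_max ord_max).
Proof.
apply/matrixP => i j; rewrite !mxE [in LHS](ord2E i) [in LHS](ord2E j).
by do 2!case: ifP.
Qed.

Lemma mx2M x y z t x' y' z' t' : mx2 x y z t *m mx2 x' y' z' t' =
  mx2 (x * x' + y * z') (x * y' + y * t') (z * x' + t * z') (z * y' + t * t').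
Proof.
apply/matrixP => i j; rewrite !mxE !big_ord_recl big_ord0 !mxE /= addr0.
by case: ifP => _; case: ifP.
Qed.

Lemma mx2_tr x y z t : (mx2 x y z t)^T = mx2 x z y t.
Proof. by apply/matrixP => i j; rewrite !mxE; do 2!case: ifP. Qed.

Lemma mx2_inj x y z t x' y' z' t' : mx2 x y z t = mx2 x' y' z' t' ->
  [/\ x = x', y = y', z = z' & t = t'].
Proof.
by move=> /matrixP E; split; [have := E ord0 ord0|have := E ord0 ord_max|
  have := E ord_max ord0|have := E ord_max ord_max]; rewrite !mxE.
Qed.

Lemma mx2_1 : 1%:M = mx2 1 0 0 1.
Proof.
apply/matrixP => i j; rewrite !mxE [in LHS](ord2E i) [in LHS](ord2E j).
by do 2!case: ifP.
Qed.

End Matrix2.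

Lemma map_mx2 (R S : comNzRingType) (f : R -> S) x y z t :
  map_mx f (mx2 x y z t) = mx2 (f x) (f y) (f z) (f t).
Proof. by apply/matrixP => i j; rewrite !mxE; do 2!case: ifP. Qed.

(** * Balls in the p-adic numbers *)

Section UnitarySteinberg.
Variables (p : nat) (hp : prime p) (Qp : padicField p).
Local Notation q := (p ^ 2)%N.
Local Notation N := (@padic_norm p Qp).

Lemma padic_norm0 : N 0 = 0.
Proof. by apply/eqP; rewrite padic_norm_eq0. Qed.

Lemma padic_normN a : N (- a) = N a.
Proof. by rewrite -mulN1r padic_normM padic_normN1 mul1r. Qed.

Lemma padic_normV a : N a^-1 = (N a)^-1.
Proof.
have [->|a0] := eqVneq a 0; first by rewrite invr0 padic_norm0 invr0.
have n0 : N a != 0 by rewrite padic_norm_eq0.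
by apply: (mulfI n0); rewrite -padic_normM !mulfV // padic_norm1.
Qed.

Lemma padic_normX a n : N (a ^+ n) = N a ^+ n.
Proof.
by elim: n => [|n IHn]; rewrite ?expr0 ?padic_norm1 // !exprS padic_normM IHn.
Qed.

Lemma padic_norm_gt0 a : (0 < N a) = (a != 0).
Proof. by rewrite lt0r padic_norm_eq0 padic_norm_ge0 andbT. Qed.

Lemma padic_normD_eq a b : N b < N a -> N (a + b) = N a.
Proof.
move=> ba; apply/eqP; rewrite eq_le; apply/andP; split.
  by apply: le_trans (padic_normD _ _) _; rewrite ge_max lexx ltW.
have := padic_normD (a + b) (- b); rewrite addrK padic_normN le_max.
by rewrite [N a <= N b]leNgt ba orbF.
Qed.

Lemma padic_norm_sum (I : Type) (r : seq I) (F : I -> Qp) (B : rat) : 0 <= B ->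
  (forall i, N (F i) <= B) -> N (\sum_(i <- r) F i) <= B.
Proof.
move=> B0 FB; elim/big_rec: _ => [|i x _ h]; first by rewrite padic_norm0.
by apply: le_trans (padic_normD _ _) _; rewrite ge_max FB.
Qed.

Lemma ratq_gt1 : 1 < (q%:R : rat).
Proof. by rewrite ltr1n (ltn_exp2l 0) ?prime_gt1. Qed.

Lemma ratq_gt0 : 0 < (q%:R : rat).
Proof. exact: lt_trans ratq_gt1. Qed.

Lemma ratq_neq0 : (q%:R : rat) != 0.
Proof. by rewrite lt0r_neq0 ?ratq_gt0. Qed.

Lemma q_gt0 : (0 < q)%N.
Proof. by rewrite expn_gt0 prime_gt0. Qed.

Lemma padic_natr_norm (n : nat) : (0 < n)%N -> N n%:R = p%:R ^- logn p n.
Proof.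
move=> n0; rewrite -(ratr_nat Qp) padic_norm_ratr /padic_abs pnatr_eq0 eqn0Ngt n0.
rewrite /padic_val -[(n%:R : rat)]/(n%:~R) numq_int denq_int /= logn1 subr0.
by rewrite exprnN.
Qed.

Lemma padic_natr0 (n : nat) : (0 < n)%N -> (n%:R : Qp) != 0.
Proof. by move=> n0; have := padic_natr_neq0 hp (Qp^o : fieldExtType Qp) n0. Qed.

Lemma padicq_neq0 : (q%:R : Qp) != 0.
Proof. exact/padic_natr0/q_gt0. Qed.

Lemma padic_normq : N q%:R = q%:R^-1.
Proof. by rewrite !natrX padic_normX padic_normp // exprVn. Qed.

Lemma padic_normqz (i : int) : N (q%:R ^ i) = q%:R ^ (- i).
Proof.
by case: i => n; rewrite ?NegzE ?opprK -?exprnN ?padic_normV padic_normX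
  padic_normq exprVn ?invrK -?exprnN.
Qed.

Definition ball (n : int) (a : Qp) : bool := N a <= q%:R ^ (- n).

Lemma ball0 n : ball n 0.
Proof. by rewrite /ball padic_norm0 exprz_ge0 // ltW ?ratq_gt0. Qed.
Hint Resolve ball0 : core.

Lemma ballN n a : ball n (- a) = ball n a.
Proof. by rewrite /ball padic_normN. Qed.

Lemma ballD n a b : ball n a -> ball n b -> ball n (a + b).
Proof.
by move=> ha hb; apply: le_trans (padic_normD _ _) _; rewrite ge_max; apply/andP.
Qed.

Lemma ballB n a b : ball n a -> ball n b -> ball n (a - b).
Proof. by move=> ha hb; rewrite ballD ?ballN. Qed.

Lemma ballBC n a b : ball n (a - b) = ball n (b - a).
Proof. by rewrite -ballN opprB. Qed.

Lemma ballDr n a b : ball n b -> ball n (a + b) = ball n a.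
Proof.
move=> hb; apply/idP/idP => [h|h]; last exact: ballD.
by rewrite -(addrK b a) ballB.
Qed.

Lemma ballM n m a b : ball n a -> ball m b -> ball (n + m) (a * b).
Proof.
move=> ha hb; rewrite /ball padic_normM opprD expfzDr ?ratq_neq0 //.
by rewrite ler_pM ?padic_norm_ge0.
Qed.

Lemma ballMqz n (i : int) a : ball n (q%:R ^ i * a) = ball (n - i) a.
Proof.
rewrite /ball padic_normM padic_normqz opprB expfzDr ?ratq_neq0 //.
by rewrite -ler_pdivlMl ?exprz_gt0 ?ratq_gt0 // invr_expz opprK.
Qed.

Lemma ballMqX n (i : nat) a : ball n (q%:R ^+ i * a) = ball (n - i%:Z) a.
Proof. exact: (ballMqz n i). Qed.

Lemma ballMqV n a : ball n (q%:R^-1 * a) = ball (n + 1) a.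
Proof. by rewrite -[X in X^-1]expr1z invr_expz ballMqz opprK. Qed.

Lemma ballMnorm1 n a b : N b = 1 -> ball n (b * a) = ball n a.
Proof. by move=> b1; rewrite /ball padic_normM b1 mul1r. Qed.

Lemma ball_le m n a : m <= n -> ball n a -> ball m a.
Proof.
move=> mn ha; apply: le_trans ha _; rewrite ler_weXz2l ?lerN2 //.
by rewrite ltW ?ratq_gt1.
Qed.

Lemma ball_ex a : exists n : nat, ball (- n%:Z) a.
Proof.
exists (Num.bound (N a)); rewrite /ball opprK.
apply/ltW/(lt_le_trans (archi_boundP (padic_norm_ge0 a))).
rewrite -exprnP -natrX ler_nat ltnW // ltn_expl //.
by rewrite -(ltr_nat rat) ratq_gt1.
Qed.

Lemma ballV (n : nat) (a : Qp) : ~~ ball (- n%:Z) a -> ball n%:Z a^-1.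
Proof.
rewrite /ball opprK -ltNge => ha.
have qn0 : 0 < (q%:R : rat) ^ n%:Z by rewrite exprz_gt0 ?ratq_gt0.
rewrite padic_normV -invr_expz lef_pV2 ?ltW ?qualifE //=.
exact: lt_trans ha.
Qed.

Lemma ball_natr n : ball 0 n%:R.
Proof.
have [->|n0] := posnP n; first exact: ball0.
rewrite /ball oppr0 expr0z padic_natr_norm // invf_le1 ?exprn_gt0 ?ltr0n ?prime_gt0 //.
by rewrite exprn_ege1 // ler1n prime_gt0.
Qed.

Lemma ball_intr (z : int) : ball 0 z%:~R.
Proof. by case: z => z; rewrite ?NegzE ?mulrNz ?ballN ball_natr. Qed.

Lemma ball_natr_dvd (n m : nat) : ball n%:Z m%:R = (q ^ n %| m)%N.
Proof.
have [->|m0] := posnP m; first by rewrite ball0 dvdn0.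
rewrite /ball padic_natr_norm // -!exprnN natrX -exprM.
rewrite lef_pV2 ?qualifE /= ?exprn_gt0 ?ltr0n ?prime_gt0 //.
rewrite ler_eXn2l ?ltr1n ?prime_gt1 // -expnM.
by rewrite pfactor_dvdn.
Qed.

Lemma ball_natrB_inj n (i j : nat) : (i < q ^ n)%N -> (j < q ^ n)%N ->
  ball n%:Z (i%:R - j%:R) -> i = j.
Proof.
wlog ij : i j / (i <= j)%N.
  move=> H hi hj h; case/orP: (leq_total i j) => ij; first exact: H.
  by apply/esym/H => //; rewrite ballBC.
move=> hi hj; rewrite ballBC -natrB // ball_natr_dvd => /dvdnP[[|m] e].
  by apply/eqP; rewrite eqn_leq ij -subn_eq0 e.
have := leq_subr i j; rewrite e mulSn => h.
by move: (leq_ltn_trans (leq_trans (leq_addr _ _) h) hj); rewrite ltnn.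
Qed.

Lemma coprime_denq (x : rat) : ball 0 (ratr x) -> coprime p `|denq x|%N.
Proof.
move=> xint; have [x0|x0] := eqVneq x 0; first by rewrite x0 coprimen1.
rewrite prime_coprime //; apply/negP => pd.
have pn : ~~ (p %| `|numq x|)%N.
  apply/negP => pn; have /eqP e := coprime_num_den x.
  have := dvdn_gcd p `|numq x| `|denq x|; rewrite pn pd e dvdn1.
  by rewrite eqn_leq leqNgt prime_gt1.
move: xint; rewrite /ball padic_norm_ratr /padic_abs (negbTE x0) /padic_val.
rewrite lognE (negbTE pn) !andbF sub0r opprK oppr0 expr0z.
have l1 : (0 < logn p `|denq x|)%N.
  by rewrite logn_gt0 mem_primes hp absz_gt0 denq_neq0.
rewrite -exprnP leNgt => /negP; apply.
by rewrite exprn_egt1 ?ltr1n ?prime_gt1 // -lt0n.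
Qed.

Lemma ball_intr_approx n (x : rat) : ball 0 (ratr x) ->
  exists z : int, ball n%:Z (ratr x - z%:~R).
Proof.
move=> xint; have d0 : (0 < `|denq x|)%N by rewrite absz_gt0 denq_neq0.
have : coprime `|denq x|%N (q ^ n)%N.
  by rewrite coprime_sym -expnM coprimeXl ?coprime_denq.
case/(coprimeP _ d0) => -[u v] /= uv; exists (numq x * u%:Z).
have dE : ratr x * `|denq x|%N%:R = (numq x)%:~R :> Qp.
  rewrite -[_%:R]/(`|denq x|%N%:~R) gez0_abs ?denq_ge0 // /ratr divfK //.
  rewrite -[denq x]gez0_abs ?denq_ge0 //.
  by rewrite -[_%:~R]/(`|denq x|%N%:R) padic_natr0.
have vq : (v * q ^ n)%N%:R = u%:R * `|denq x|%N%:R - 1 :> Qp.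
  suff e : (u * `|denq x| = v * q ^ n + 1)%N by rewrite -natrM e natrD addrK.
  by move: uv; lia.
rewrite intrM -dE -[u%:~R]/(u%:R).
rewrite (_ : _ - _ = - ratr x * (v * q ^ n)%N%:R); last by rewrite vq; ring.
by rewrite -[n%:Z]add0r ballM ?ballN // ball_natr_dvd dvdn_mull.
Qed.

Lemma ball_natr_approx n a : ball 0 a -> exists i : 'I_(q ^ n), ball n%:Z (a - i%:R).
Proof.
move=> aint; have qe : 0 < (q%:R : rat) ^ (- n%:Z) by rewrite exprz_gt0 ?ratq_gt0.
have [x /ltW xa] := padic_dense a qe.
have xint : ball 0 (ratr x) by rewrite -(subKr a (ratr x)) ballB //; apply: ball_le xa.
have [z zx] := ball_intr_approx n xint.
have q0 : (q ^ n)%N%:Z != 0 by rewrite eqz_nat -lt0n expn_gt0 q_gt0.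
have mlt : (`|(z %% (q ^ n)%N%:Z)%Z|%N < q ^ n)%N.
  rewrite -ltz_nat gez0_abs ?modz_ge0 //; apply: ltz_pmod.
  by rewrite ltz_nat expn_gt0 q_gt0.
exists (Ordinal mlt) => /=; rewrite -[X in ball _ (_ - X)]/(`|_|%N%:~R).
rewrite gez0_abs ?modz_ge0 // -(subrKA (ratr x)) ballD // -(subrKA z%:~R) ballD //.
rewrite {1}(divz_eq z (q ^ n)%N) intrD addrK intrM mulrC.
by rewrite -[n%:Z]addr0 ballM ?ball_intr // -[_%:~R]/((q ^ n)%N%:R) ball_natr_dvd.
Qed.

Definition grid (m i : nat) : Qp := q%:R ^ (- m%:Z) * i%:R.

Lemma grid0n i : grid 0 i = i%:R.
Proof. by rewrite /grid oppr0 expr0z mul1r. Qed.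

Lemma ball_grid m i : ball (- m%:Z) (grid m i).
Proof. by rewrite ballMqz addrC addNr ball_natr. Qed.

Lemma ball_gridB m n a i :
  ball n%:Z (a - grid m i) = ball (m + n)%N%:Z (q%:R ^ m%:Z * a - i%:R).
Proof.
have -> : a - grid m i = q%:R ^ (- m%:Z) * (q%:R ^ m%:Z * a - i%:R).
  by rewrite mulrBr mulrA -expfzDr ?padicq_neq0 // addNr expr0z mul1r.
by rewrite ballMqz opprK addrC -PoszD.
Qed.

Lemma grid_shift m d i : grid m i = grid (m + d) (q ^ d * i).
Proof.
rewrite /grid natrM mulrA; congr (_ * _).
by rewrite (natrX _ q d) exprnP -expfzDr ?padicq_neq0 //; congr (_ ^ _); lia.
Qed.

Lemma grid_inj m n i j : (i < q ^ (m + n))%N -> (j < q ^ (m + n))%N ->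
  ball n%:Z (grid m i - grid m j) -> i = j.
Proof.
rewrite ball_gridB [q%:R ^ _ * _]mulrA -expfzDr ?padicq_neq0 // subrr mul1r.
exact: ball_natrB_inj.
Qed.

(* The balls of radius q^-n around the points grid m i, for i < q^(m + n),
   partition the ball of radius q^m around 0. *)
Lemma grid_partition m n a : ball (- m%:Z) a ->
  exists i : 'I_(q ^ (m + n)), forall j : 'I_(q ^ (m + n)),
    ball n%:Z (a - grid m j) = (j == i).
Proof.
move=> ha; have [|i hi] := @ball_natr_approx (m + n) (q%:R ^ m%:Z * a).
  by rewrite ballMqz sub0r.
rewrite -ball_gridB in hi; exists i => j; apply/idP/eqP => [hj|-> //].
apply/val_inj/(@grid_inj m n); rewrite ?ltn_ord //.
by rewrite -(subrKA a) ballD // ballBC.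
Qed.

Lemma natr_partition a : ball 0 a ->
  exists i : 'I_q, forall j : 'I_q, ball 1 (a - j%:R) = (j == i).
Proof.
move=> a0; have [|i hi] := @grid_partition 0 1 a; first by rewrite oppr0.
by exists i => j; rewrite -hi grid0n.
Qed.

Lemma big_ord_pred1 (R : nzRingType) (n : nat) (F : 'I_n -> R) (P : pred 'I_n) i :
  (forall j, P j = (j == i)) -> \sum_j F j * (P j)%:R = F i.
Proof.
move=> Pi; rewrite (bigD1 i) //= Pi eqxx mulr1 big1 ?addr0 // => j /negbTE ji.
by rewrite Pi ji mulr0.
Qed.

Lemma sum_ball_natr (R : nzRingType) a :
  \sum_(i < q) (ball 1 (a + i%:R))%:R = (ball 0 a)%:R :> R.
Proof.
have [a0|a0] := boolP (ball 0 a); last first.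
  rewrite big1 // => i _; case: (boolP (ball 1 _)) => // /(ball_le ler01).
  by rewrite ballDr ?(negbTE a0) // ball_natr.
have [i hi] := natr_partition (etrans (ballN 0 a) a0).
rewrite -[RHS](@big_ord_pred1 _ _ (fun=> 1) _ i hi); apply: eq_bigr => j _.
by rewrite mul1r -ballN opprD.
Qed.

Lemma sum_transversal (W : zmodType) (h : Qp -> W) (psi : 'I_q -> Qp) :
  (forall a b, ball 0 a -> ball 1 b -> h (a + b) = h a) ->
  (forall i, ball 0 (psi i)) ->
  (forall i j, ball 1 (psi i - psi j) -> i = j) ->
  \sum_i h (psi i) = \sum_(i < q) h i%:R.
Proof.
move=> hper psi0 psi_inj.
have [r rP] := choice (fun i => natr_partition (psi0 i)).
have {}rP i : ball 1 (psi i - (r i)%:R) by rewrite rP.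
have r_inj : injective r.
  move=> i j e; apply: psi_inj; rewrite -(subrKA (r i)%:R) ballD //.
  by rewrite e ballBC.
rewrite [RHS](reindex r) /=; last exact/onW_bij/injF_bij.
by apply: eq_bigr => i _; rewrite -[psi i](subrKC (r i)%:R) hper ?ball_natr.
Qed.

(** * Step functions and the basis of van der Put *)

Section StepFunctions.
Variable R : comNzRingType.
Implicit Types h : Qp -> R^o.

Definition stepfun (m n : nat) h : Prop :=
  (forall a b, ball n%:Z b -> h (a + b) = h a) /\
  (forall a, ~~ ball (- m%:Z) a -> h a = 0).

Definition ball_indic (n : nat) (r : Qp) : Qp -> R^o :=
  fun a => (ball n%:Z (a - r))%:R.

Lemma stepfun_le m n m' n' h : (m <= m')%N -> (n <= n')%N ->
  stepfun m n h -> stepfun m' n' h.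
Proof.
move=> mm nn [hper hsupp]; split=> [a b hb|a ha].
  by apply: hper; apply: ball_le hb; rewrite lez_nat.
by apply: hsupp; apply: contra ha; apply: ball_le; rewrite lerN2 lez_nat.
Qed.

Lemma stepfun_ball m n r : ball (- m%:Z) r -> stepfun m n (ball_indic n r).
Proof.
rewrite /ball_indic => rm; split=> [a b hb|a ha]; first by rewrite addrAC (ballDr _ hb).
rewrite (_ : ball _ _ = false) //; apply/negP => hn; case/negP: ha.
by rewrite -(subrK r a) ballD //; apply: ball_le hn => //; lia.
Qed.

Lemma stepfun_expand m n h : stepfun m n h ->
  h = \sum_(i < q ^ (m + n)) h (grid m i) *: ball_indic n (grid m i).
Proof.
move=> [hper hsupp]; apply/funext => a; rewrite fct_sumE.
have [ha|ha] := boolP (ball (- m%:Z) a).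
  have [i hi] := grid_partition n ha.
  have := @big_ord_pred1 _ _ (fun j : 'I_(q ^ (m + n)) => h (grid m j)) _ i hi.
  by move=> ->; rewrite -[a in LHS](subrKC (grid m i)) hper ?hi.
rewrite hsupp // big1 // => i _; have [_ ind0] := @stepfun_ball m n _ (ball_grid m i).
by rewrite -[LHS]/(_ * ball_indic _ _ _) ind0 ?mulr0.
Qed.

(* The indices (n, i) such that the ball of radius q^-n around grid n i is not
   centred at a point of the previous grid; the corresponding characteristic
   functions form van der Put's basis. *)
Definition new_gridpoint (x : nat * nat) : bool :=
  (x.2 < q ^ (x.1 + x.1))%N &&
  ((x.1 == 0%N) || ~~ ((q %| x.2) && (x.2 %/ q < q ^ (x.1.-1 + x.1.-1))))%N.

Definition van_der_put := {x : nat * nat | new_gridpoint x}.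
HB.instance Definition _ := Choice.on van_der_put.

Definition vdp_fun (x : van_der_put) : Qp -> R^o :=
  ball_indic (val x).1 (grid (val x).1 (val x).2).

Lemma lspan_new_gridpoint n i : new_gridpoint (n, i) ->
  lspan (range vdp_fun) (ball_indic n (grid n i)).
Proof. by move=> ni; apply: mem_lspan; exists (exist _ (n, i) ni). Qed.

Lemma lspan_vdp_ball n (i : nat) : (i < q ^ (n + n))%N ->
  lspan (range vdp_fun) (ball_indic n (grid n i)).
Proof.
elim: n i => [|n IHn] i hi.
  by apply: lspan_new_gridpoint; rewrite /new_gridpoint /= hi.
have [|] := boolP (new_gridpoint (n.+1, i)); first exact: lspan_new_gridpoint.
rewrite /new_gridpoint /= hi /= negbK => /andP[/dvdnP[j ij]].
rewrite ij mulnK ?q_gt0 // => jn; rewrite mulnC in ij *.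
have gridE (j' : nat) : grid n j' = grid n.+1 (q * j') by rewrite (grid_shift n 1) addn1.
have jball : stepfun n.+1 n.+1 (ball_indic n (grid n j)).
  exact: stepfun_le (stepfun_ball _ (ball_grid n j)).
have qjn : (q * j < q ^ (n.+1 + n.+1))%N by rewrite -ij.
pose rest := \sum_(i' < q ^ (n.+1 + n.+1) | i' != Ordinal qjn)
  ball_indic n (grid n j) (grid n.+1 i') *: ball_indic n.+1 (grid n.+1 i').
have E : ball_indic n (grid n j) = ball_indic n.+1 (grid n j) + rest.
  rewrite {1}(stepfun_expand jball) (bigD1 (Ordinal qjn)) //= -gridE.
  by rewrite {1}/ball_indic subrr ball0 scale1r.
rewrite -gridE (_ : ball_indic n.+1 _ = ball_indic n (grid n j) - rest); last first.
  by rewrite E addrK.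
apply: lspanB; first exact: IHn.
apply: lspan_sum => i' _ ne; rewrite {1}/ball_indic.
have [close|far] := boolP (ball n%:Z _); last by rewrite scale0r; exact: lspan0.
rewrite scale1r; apply: lspan_new_gridpoint; rewrite /new_gridpoint /= ltn_ord /=.
apply/negP => /andP[/dvdnP[j' ij']]; rewrite ij' mulnK ?q_gt0 // => j'n.
case/eqP: ne; apply: val_inj; rewrite /= ij' mulnC; congr (_ * _)%N.
by apply: (@grid_inj n n) => //; rewrite gridE mulnC -ij'.
Qed.

Lemma vdp_span n h : stepfun n n h -> lspan (range vdp_fun) h.
Proof.
move=> /stepfun_expand->; apply: lspan_sum => i _ _.
by apply: lspanZ; apply: lspan_vdp_ball.
Qed.

Lemma vdp_inj (x y : van_der_put) : ((val x).1 <= (val y).1)%N ->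
  ball (val y).1%:Z (grid (val x).1 (val x).2 - grid (val y).1 (val y).2) -> x = y.
Proof.
case: x y => [[n i] /= hx] [[m j] /= hy] nm /=.
move: (m - n)%N (subnKC nm) => d md {nm}; subst m.
rewrite (grid_shift n d i) => hb.
have [/= hi _] := andP hx; have [/= hj hnew] := andP hy.
have qXlt d' : (q ^ d' * i < q ^ (n + d' + (n + d')))%N.
  rewrite addnACA [X in (_ < X)%N]expnD mulnC.
  apply: (@leq_trans (q ^ (n + n) * q ^ d')%N).
    by rewrite ltn_pmul2r // !expn_gt0 prime_gt0.
  by rewrite leq_mul2l leq_exp2l ?leq_addr ?orbT // (ltn_exp2l 0) ?prime_gt1.
have ij := grid_inj (qXlt d) hj hb.
case: d => [|d] in ij hj hnew hb hy *.
  by apply: val_inj => /=; rewrite addn0 -ij mul1n.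
exfalso; move: hnew; rewrite addnS /= -ij (expnS q d) -mulnA dvdn_mulr //.
by rewrite mulKn ?q_gt0 //= => /negP[].
Qed.

Lemma vdp_lin_indep : lin_indep vdp_fun.
Proof.
move=> s a us s0 x; have [n] := ubnP (val x).1; elim: n x => // n IHn x.
rewrite ltnS => xn xs.
have := congr1 (fun h => h (grid (val x).1 (val x).2)) s0; rewrite /= fct_sumE.
rewrite (bigD1_seq x) //= -[X in X + _]/(a x * vdp_fun x _).
rewrite {1}/vdp_fun /ball_indic subrr ball0 // mulr1 big1_seq ?addr0 // => y.
case/andP=> yx ys; rewrite -[LHS]/(a y * vdp_fun y _).
case: (ltnP (val y).1 (val x).1) => [yltx|xley].
  by rewrite IHn ?mul0r // (leq_trans yltx).
rewrite /vdp_fun /ball_indic; case: (boolP (ball _ _)) => [hb|]; last by rewrite mulr0.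
by case/eqP: yx; apply/esym/vdp_inj.
Qed.

End StepFunctions.

(** * Decompositions of U(1,1) *)

Variables (L : fieldExtType Qp) (c : {lrmorphism L -> L}) (e : tracelessGen c).
Local Notation G := (U11 c).
Local Notation Nm := (Nm c).
Local Notation eps := (traceless e).

Lemma integers_conj x : x \in integers L -> c x \in integers L.
Proof.
move=> /integersP[P Pm /rootP Pr]; apply/integersP; exists P => //; apply/rootP.
have cP : map_poly c (map_poly (Zp_emb L) P) = map_poly (Zp_emb L) P.
  by apply/polyP => i; rewrite !coef_map /= conj_alg.
by rewrite -cP horner_map Pr rmorph0.
Qed.

Lemma padic_root_monic_le1 (P : {poly Qp}) (a : Qp) : P \is monic ->
  (forall i, N P`_i <= 1) -> P.[a] = 0 -> N a <= 1.
Proof.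
move=> Pm P1 Pa; rewrite leNgt; apply/negP => a1.
have [d szP] : exists d, size P = d.+1.
  by exists (size P).-1; rewrite prednK // size_poly_gt0 monic_neq0.
move: Pa; rewrite horner_coef szP big_ord_recr /=.
have -> : P`_d = 1 by move: Pm; rewrite monicE lead_coefE szP => /eqP.
rewrite mul1r => /eqP; rewrite addrC addr_eq0 => /eqP ad.
case: d => [|d] in szP ad; first by move/eqP: ad; rewrite big_ord0 oppr0 expr0 oner_eq0.
have : N (a ^+ d.+1) <= N a ^+ d.
  rewrite ad padic_normN; apply: padic_norm_sum => [|i].
    by rewrite exprn_ge0 ?padic_norm_ge0.
  rewrite padic_normM padic_normX -[leRHS]mul1r.
  rewrite ler_pM ?padic_norm_ge0 ?exprn_ge0 ?padic_norm_ge0 //.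
  by rewrite ler_weXn2l ?ltW // -ltnS.
by rewrite padic_normX ler_eXn2l // ltnn.
Qed.

Lemma integers_algE (a : Qp) : (a%:A \in integers L) = (N a <= 1).
Proof.
apply/idP/idP => [/integersP[P Pm /rootP Pr]|/padic_int_integral //].
apply: (@padic_root_monic_le1 (map_poly val P)) => [|i|].
- exact: monic_map.
- by rewrite coef_map; exact: (valP P`_i).
- apply: (fmorph_inj (in_alg L)); rewrite rmorph0 -horner_map -map_poly_comp.
  exact: Pr.
Qed.

Lemma p_neq0 : (p%:R : L) != 0.
Proof. by rewrite padic_natr_neq0 ?prime_gt0. Qed.

Lemma pX_neq0 n : (p%:R : L) ^+ n != 0.
Proof. by rewrite expf_neq0 ?p_neq0. Qed.

Lemma pXz_neq0 (i : int) : (p%:R : L) ^ i != 0.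
Proof. by rewrite expfz_neq0 ?p_neq0. Qed.

Lemma Nm_p : Nm p%:R = q%:R.
Proof. by rewrite (Nm_nat e) mulnn. Qed.

Lemma Nm_pX n : Nm (p%:R ^+ n) = q%:R ^+ n.
Proof. by rewrite (NmX e) Nm_p. Qed.

Lemma Nm_pXz (i : int) : Nm (p%:R ^ i) = q%:R ^ i.
Proof. by case: i => n; rewrite ?NegzE -?exprnN ?(NmV e) -?exprnP Nm_pX. Qed.

Lemma Nm_integers x : x \in integers L -> N (Nm x) <= 1.
Proof. by move=> xi; rewrite -integers_algE -(NmE e) rpredM // integers_conj. Qed.

Lemma Nm_norm1_neq0 x : N (Nm x) = 1 -> x != 0.
Proof.
move=> n1; rewrite -(Nm_eq0 e) -padic_norm_eq0 n1.
exact: oner_neq0.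
Qed.

Lemma Nm_norm1V x : N (Nm x) = 1 -> N (Nm x^-1) = 1.
Proof. by move=> n1; rewrite (NmV e) padic_normV n1 invr1. Qed.

Lemma Nm_norm1_conjV x : N (Nm x) = 1 -> N (Nm (c x)^-1) = 1.
Proof. by move=> n1; rewrite Nm_norm1V // (Nm_conj e). Qed.

Lemma integers_unit_Nm x : x != 0 -> x \in integers L -> x^-1 \in integers L ->
  N (Nm x) = 1.
Proof.
move=> x0 /Nm_integers h /Nm_integers; rewrite (NmV e) padic_normV => h'.
apply/eqP; rewrite eq_le h /=.
by move: h'; rewrite invf_le1 // padic_norm_gt0 (Nm_eq0 e).
Qed.

Lemma unramified_integers_decomp n y : unramified L ->
  y != 0 -> y \in integers L -> q%:R ^ (- n%:Z) <= N (Nm y) ->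
  exists (i : nat) z, N (Nm z) = 1 /\ y = p%:R ^+ i * z.
Proof.
move=> unr; elim: n y => [|n IHn] y y0 yi.
  rewrite oppr0 expr0z => h; exists 0%N, y; rewrite mul1r; split=> //.
  by apply/eqP; rewrite eq_le h Nm_integers.
move=> h; have [yv|yv] := boolP (y^-1 \in integers L).
  by exists 0%N, y; rewrite mul1r integers_unit_Nm.
have [z zi yz] := unr _ yi yv.
have z0 : z != 0 by apply: contra_neq y0 => z0; rewrite yz z0 mulr0.
have [|i [u [u1 zE]]] := IHn z z0 zi; last by exists i.+1, u; rewrite yz zE exprS mulrA.
move: h; rewrite yz (NmM e) padic_normM Nm_p padic_normq.
rewrite -(ler_pM2l ratq_gt0) mulVKf ?ratq_neq0 //.
by rewrite -{1}[q%:R]expr1z -expfzDr ?ratq_neq0 //; congr (q%:R ^ _ <= _); lia.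
Qed.

Lemma unramified_decomp x : unramified L -> x != 0 ->
  exists (i : int) z, N (Nm z) = 1 /\ x = p%:R ^ i * z.
Proof.
move=> unr x0; have [m xm] := padic_bounded hp x.
set y := p%:R ^+ m * x in xm; have y0 : y != 0 by rewrite mulf_neq0 ?pX_neq0.
have [n hn] := ball_ex (Nm y)^-1.
have [|i [z [z1 yE]]] := @unramified_integers_decomp n y unr y0 xm.
  move: hn; rewrite /ball opprK padic_normV -exprnN -exprnP => hn.
  by rewrite -lef_pV2 ?qualifE /= ?invr_gt0 ?padic_norm_gt0 ?(Nm_eq0 e) ?exprn_gt0
    ?ratq_gt0 // invrK.
exists (i%:Z - m%:Z), z; split=> //.
by rewrite expfzDr ?p_neq0 // -mulrA mulrCA -exprnP -yE -exprnN /y mulKf ?pX_neq0.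
Qed.

Lemma mx2_antidiag : antidiag L = mx2 0 1 1 0.
Proof.
apply/matrixP => i j; rewrite !mxE [in LHS](ord2E i) [in LHS](ord2E j).
by do 2!case: ifP.
Qed.

Definition unitary_eqs (x y z t : L) : Prop :=
  [/\ c z * x + c x * z = 0, c z * y + c x * t = 1,
      c t * x + c y * z = 1 & c t * y + c y * t = 0].

Lemma mulVmx2_unitary x y z t : unitary_eqs x y z t ->
  mx2 (c t) (c y) (c z) (c x) *m mx2 x y z t = 1%:M.
Proof. by case=> h1 h2 h3 h4; rewrite mx2M mx2_1 h1 h2 h3 h4. Qed.

Lemma mx2_unitaryP x y z t : mx2 x y z t \in unitary c <-> unitary_eqs x y z t.
Proof.
have formE : (map_mx c (mx2 x y z t))^T *m antidiag L *m mx2 x y z t =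
    mx2 (c z * x + c x * z) (c z * y + c x * t) (c t * x + c y * z) (c t * y + c y * t).
  by rewrite mx2_antidiag map_mx2 mx2_tr !mx2M; congr mx2; ring.
rewrite inE formE mx2_antidiag; split=> [/andP[_ /eqP/mx2_inj]//|eqs].
have /mulmx1_unit[_ ->] := mulVmx2_unitary eqs.
by case: eqs => -> -> -> ->; rewrite eqxx.
Qed.

Definition weyl : G := insubd (1%g : G) (mx2 0 1 1 0).
Definition upper (a : Qp) : G := insubd (1%g : G) (mx2 1 (a *: eps) 0 1).
Definition tor (x : L) : G := insubd (1%g : G) (mx2 x 0 0 (c x)^-1).
Definition lower (a : Qp) : G := (weyl * upper a * weyl)%g.

Lemma val_U11M (g h : G) : val (g * h)%g = val g *m val h. Proof. by []. Qed.
Lemma val_U11_1 : val (1%g : G) = mx2 1 0 0 1. Proof. exact: mx2_1. Qed.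

Lemma U11_mx2P (g : G) x y z t : val g = mx2 x y z t -> unitary_eqs x y z t.
Proof. by move=> gE; apply/mx2_unitaryP; rewrite -gE; exact: U11P. Qed.

Lemma val_U11V (g : G) x y z t : val g = mx2 x y z t ->
  val (g^-1)%g = mx2 (c t) (c y) (c z) (c x).
Proof.
move=> gE; have := mulVmx2_unitary (U11_mx2P gE); rewrite -gE.
move=> /(congr1 (mulmx^~ (val (g^-1)%g))).
by rewrite -mulmxA -val_U11M mulgV mulmx1 mul1mx.
Qed.

Lemma val_weyl : val weyl = mx2 0 1 1 0.
Proof.
by apply/insubdK/mx2_unitaryP; rewrite /unitary_eqs !(conj0, conj1); split; ring.
Qed.

Lemma val_upper a : val (upper a) = mx2 1 (a *: eps) 0 1.
Proof.
apply/insubdK/mx2_unitaryP.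
rewrite /unitary_eqs !(conj0, conj1) conjZ traceless_conj scalerN.
by split; ring.
Qed.

Lemma val_tor x : x != 0 -> val (tor x) = mx2 x 0 0 (c x)^-1.
Proof.
move=> x0; apply/insubdK/mx2_unitaryP; rewrite /unitary_eqs !conj0 conjV (conjK e).
by rewrite mulVf // mulfV ?conj_eq0 //; split; ring.
Qed.

Lemma val_lower a : val (lower a) = mx2 1 0 (a *: eps) 1.
Proof. by rewrite !val_U11M val_weyl val_upper !mx2M; congr mx2; ring. Qed.

Lemma upper0 : upper 0 = 1%g.
Proof. by apply: val_inj; rewrite val_upper val_U11_1 scale0r. Qed.

Lemma upperD a b : upper (a + b) = (upper a * upper b)%g.
Proof.
by apply: val_inj; rewrite val_U11M !val_upper mx2M scalerDl; congr mx2; ring.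
Qed.

Lemma upperV a : ((upper a)^-1)%g = upper (- a).
Proof. by apply: (mulgI (upper a)); rewrite mulgV -upperD subrr upper0. Qed.

Lemma weylK : (weyl * weyl)%g = 1%g.
Proof. by apply: val_inj; rewrite val_U11M !val_weyl mx2M val_U11_1; congr mx2; ring. Qed.

Lemma weylV : (weyl^-1)%g = weyl.
Proof. by apply: (mulgI weyl); rewrite mulgV weylK. Qed.

Lemma tor1 : tor 1 = 1%g.
Proof.
by apply: val_inj; rewrite val_tor ?oner_neq0 // val_U11_1 conj1 invr1.
Qed.

Lemma torM x y : x != 0 -> y != 0 -> tor (x * y) = (tor x * tor y)%g.
Proof.
move=> x0 y0; apply: val_inj; rewrite val_U11M !val_tor ?mulf_neq0 // mx2M.
by congr mx2; rewrite ?conjM ?invfM; ring.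
Qed.

Lemma tor_upper x a : x != 0 -> (tor x * upper a = upper (Nm x * a) * tor x)%g.
Proof.
move=> x0; apply: val_inj; rewrite !val_U11M !val_upper !val_tor // !mx2M.
congr mx2; rewrite ?(mulr1, mulr0, mul0r, mul1r, addr0, add0r) //.
rewrite -scalerA -[Nm x *: _]mulr_algl -(NmE e) -!mulrA; congr (_ * _).
by rewrite mulrC divfK // conj_eq0.
Qed.

Lemma upper_tor x b : x != 0 -> (upper b * tor x = tor x * upper ((Nm x)^-1 * b))%g.
Proof. by move=> x0; rewrite tor_upper // mulVKf // (Nm_eq0 e). Qed.

Lemma weyl_tor x : x != 0 -> (weyl * tor x = tor (c x)^-1 * weyl)%g.
Proof.
move=> x0; apply: val_inj; rewrite !val_U11M !val_weyl !val_tor ?invr_neq0 ?conj_eq0 //.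
by rewrite !mx2M conjV (conjK e) invrK; congr mx2; ring.
Qed.

Lemma tor_weyl x : x != 0 -> (tor x * weyl = weyl * tor (c x)^-1)%g.
Proof. by move=> x0; rewrite weyl_tor ?invr_eq0 ?conj_eq0 // conjV (conjK e) invrK. Qed.

Lemma lower_tor x a : x != 0 -> (lower a * tor x = tor x * lower (Nm x * a))%g.
Proof.
move=> x0; have cx0 : (c x)^-1 != 0 by rewrite invr_eq0 conj_eq0.
rewrite /lower -!mulgA weyl_tor // (mulgA (upper a)) upper_tor //.
by rewrite (NmV e) (Nm_conj e) invrK !mulgA tor_weyl.
Qed.

Definition inv_upper (a : Qp) : Qp := - (a * Nm e)^-1.

Lemma inv_upperE a : a != 0 -> inv_upper a *: eps = (a *: eps)^-1.
Proof.
move=> a0; have ae0 : a *: eps != 0 by rewrite scaler_eq0 negb_or a0 traceless_neq0.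
have n0 : Nm e != 0 by rewrite (Nm_eq0 e) traceless_neq0.
apply: (mulIf ae0); rewrite mulVf // -scalerAl -scalerAr Nm_traceless.
rewrite !scalerA /inv_upper -[RHS]scale1r; congr (_ *: _).
by field; rewrite a0 n0.
Qed.

Lemma scale_traceless_neq0 a : a != 0 -> a *: eps != 0.
Proof. by move=> a0; rewrite scaler_eq0 negb_or a0 traceless_neq0. Qed.

Lemma weyl_upper a : a != 0 -> (weyl * upper a =
  upper (inv_upper a) * tor (- (a *: eps)^-1) * lower (inv_upper a))%g.
Proof.
move=> a0; have ae0 := scale_traceless_neq0 a0.
apply: val_inj; rewrite val_U11M val_weyl val_upper val_U11M val_lower val_U11M.
rewrite val_upper val_tor ?oppr_eq0 ?invr_eq0 // inv_upperE //.
rewrite conjN conjV conjZ traceless_conj scalerN !invrN opprK invrK !mx2M.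
by congr mx2; field.
Qed.

Lemma torus_tor (g : G) : torus g -> exists2 x, x != 0 & g = tor x.
Proof.
case=> h1 h2; have gE := mx2E (val g); rewrite h1 h2 in gE.
have [_ xt _ _] := U11_mx2P gE.
set x := val g ord0 ord0 in gE xt; set t := val g ord_max ord_max in gE xt.
rewrite mulr0 add0r in xt.
have x0 : x != 0.
  by apply/eqP => x0; move/eqP: xt; rewrite x0 conj0 mul0r eq_sym oner_eq0.
have cx0 : c x != 0 by rewrite conj_eq0.
exists x => //; apply: val_inj; rewrite val_tor // gE; congr mx2.
by apply: (mulfI cx0); rewrite mulfV.
Qed.

Lemma unipotent_upper (g : G) : unipotent g -> exists a, g = upper a.
Proof.
case=> h1 [h2 h3]; have gE := mx2E (val g); rewrite h1 h2 h3 in gE.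
have [_ _ _] := U11_mx2P gE.
rewrite conj1 mul1r mulr1 addrC => /eqP; rewrite addr_eq0 => /eqP.
move=> /(conj_tracelessP e)[a ya]; exists a.
by apply: val_inj; rewrite val_upper gE ya.
Qed.

Lemma upper_unipotent a : unipotent (upper a).
Proof. by rewrite /unipotent /= -!/(val (upper a)) val_upper !mxE. Qed.

Lemma tor_torus x : x != 0 -> torus (tor x).
Proof. by move=> x0; rewrite /torus /= -!/(val (tor x)) val_tor // !mxE. Qed.

Definition bot_left (g : G) : L := val g ord_max ord0.
Definition bot_right (g : G) : L := val g ord_max ord_max.

(* On the big cell, the complement of the Borel subgroup, the bottom row of g is
   proportional to (1, cell_coord g e); the value on the Borel subgroup is junk. *)
Definition cell_coord (g : G) : Qp :=
  xget 0 [set a | bot_right g = a *: eps * bot_left g].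

Lemma borel_decomp (g : G) : bot_left g = 0 ->
  exists x a, x != 0 /\ g = (tor x * upper a)%g.
Proof.
rewrite /bot_left => h1; have gE := mx2E (val g); rewrite h1 in gE.
have [_ xt _ xy] := U11_mx2P gE.
set x := val g ord0 ord0 in gE xt; set t := val g ord_max ord_max in gE xt xy.
set y := val g ord0 ord_max in gE xt xy; rewrite conj0 mul0r add0r in xt.
have x0 : x != 0.
  by apply/eqP => x0; move/eqP: xt; rewrite x0 conj0 mul0r eq_sym oner_eq0.
have cx0 : c x != 0 by rewrite conj_eq0.
have tE : t = (c x)^-1 by apply: (mulfI cx0); rewrite xt mulfV.
have [a ya] : exists a : Qp, x^-1 * y = a *: eps.
  apply: (conj_tracelessP e); rewrite conjM conjV.
  move: xy; rewrite tE conjV (conjK e) => /eqP; rewrite addrC addr_eq0 => /eqP xy.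
  by rewrite mulrC xy.
exists x, a; split=> //; apply: val_inj.
rewrite val_U11M val_tor // val_upper gE mx2M.
by rewrite -ya mulVKf // tE; congr mx2; ring.
Qed.

Lemma cell_coordE (g : G) : bot_left g != 0 ->
  bot_right g = cell_coord g *: eps * bot_left g.
Proof.
move=> z0; suff [a ga] : exists a, bot_right g = a *: eps * bot_left g.
  exact: (@xgetI _ 0 [set a | bot_right g = a *: eps * bot_left g] a).
rewrite /bot_left /bot_right in z0 *; have gE := mx2E (val g).
have := congr1 val (mulgV g); rewrite val_U11M (val_U11V gE) {1}gE val_U11_1 mx2M.
move=> /mx2_inj[_ _ + _].
set z := val g ord_max ord0 in z0 *; set t := val g ord_max ord_max => zt.
have cz0 : c z != 0 by rewrite conj_eq0.
have [a ya] : exists a : Qp, t * z^-1 = a *: eps.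
  apply: (conj_tracelessP e); rewrite conjM conjV.
  apply: (mulIf z0); rewrite mulNr divfK //; apply: (mulIf cz0).
  rewrite mulrAC divfK // mulNr; apply/eqP.
  by rewrite -addr_eq0 mulrC zt.
by exists a; rewrite -ya divfK.
Qed.

Lemma cell_coord_unique (g : G) a : bot_left g != 0 ->
  bot_right g = a *: eps * bot_left g -> cell_coord g = a.
Proof.
move=> z0; rewrite cell_coordE // => /(mulIf z0)/eqP; rewrite -subr_eq0 -scalerBl.
by rewrite scaler_eq0 (negbTE (traceless_neq0 e)) orbF subr_eq0 => /eqP.
Qed.

Lemma bigcell_decomp (g : G) : bot_left g != 0 ->
  exists b, g = (tor (c (bot_left g))^-1 * upper b * weyl * upper (cell_coord g))%g.
Proof.
move=> z0; have cz0 : c (bot_left g) != 0 by rewrite conj_eq0.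
pose h := (g * upper (- cell_coord g) * weyl)%g.
have hE : val h =
    mx2 (val g ord0 ord_max - val g ord0 ord0 * (cell_coord g *: eps))
    (val g ord0 ord0) 0 (bot_left g).
  rewrite !val_U11M val_upper val_weyl {1}(mx2E (val g)) !mx2M.
  rewrite -/(bot_right g) -/(bot_left g) cell_coordE //.
  by rewrite scaleNr; congr mx2; ring.
have h10 : bot_left h = 0 by rewrite /bot_left hE !mxE.
have [x [b [x0 hb]]] := borel_decomp h10.
exists b; have -> : (c (bot_left g))^-1 = x.
  have : val h ord_max ord_max = (c x)^-1.
    by rewrite hb val_U11M val_tor // val_upper mx2M !mxE /= mul0r add0r mulr1.
  by rewrite hE !mxE /= => ->; rewrite conjV (conjK e) invrK.
rewrite -hb /h -[X in (X * upper _)%g]mulgA weylK mulg1 -mulgA -upperD addNr upper0.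
by rewrite mulg1.
Qed.

Lemma bot_leftM (g h : G) : bot_left (g * h)%g =
  bot_left g * val h ord0 ord0 + bot_right g * val h ord_max ord0.
Proof.
by rewrite /bot_left val_U11M {1}(mx2E (val g)) {1}(mx2E (val h)) mx2M !mxE.
Qed.

Lemma bot_rightM (g h : G) : bot_right (g * h)%g =
  bot_left g * val h ord0 ord_max + bot_right g * val h ord_max ord_max.
Proof.
by rewrite /bot_right val_U11M {1}(mx2E (val g)) {1}(mx2E (val h)) mx2M !mxE.
Qed.

Lemma bot_left_upper a : bot_left (upper a) = 0.
Proof. by rewrite /bot_left val_upper // !mxE. Qed.

Lemma bot_left_tor x : x != 0 -> bot_left (tor x) = 0.
Proof. by move=> x0; rewrite /bot_left val_tor // !mxE. Qed.

Lemma bot_left_borelM g h : bot_left g = 0 -> bot_left h = 0 -> bot_left (g * h)%g = 0.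
Proof.
by move=> g0 h0; rewrite bot_leftM g0 mul0r -/(bot_left h) h0 mulr0 addr0.
Qed.

Lemma bot_left_weyl : bot_left weyl = 1.
Proof. by rewrite /bot_left val_weyl !mxE. Qed.

Lemma bot_left1 : bot_left 1%g = 0.
Proof. by rewrite /bot_left val_U11_1 !mxE. Qed.

Lemma bot_leftMupper g a : bot_left (g * upper a)%g = bot_left g.
Proof. by rewrite bot_leftM val_upper !mxE /= mulr1 mulr0 addr0. Qed.

Lemma bot_leftMtor g x : x != 0 -> bot_left (g * tor x)%g = bot_left g * x.
Proof. by move=> x0; rewrite bot_leftM val_tor // !mxE /= mulr0 addr0. Qed.

Lemma bot_left_borel_mul g x b : x != 0 ->
  bot_left (tor x * upper b * g)%g = (c x)^-1 * bot_left g.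
Proof.
move=> x0; rewrite !bot_leftM /bot_left /bot_right !val_U11M val_tor // val_upper.
by rewrite mx2M !mxE /=; ring.
Qed.

Lemma cell_coord_weyl : cell_coord weyl = 0.
Proof.
apply: cell_coord_unique; rewrite bot_left_weyl ?oner_neq0 //.
by rewrite /bot_right val_weyl !mxE /= scale0r mul0r.
Qed.

Lemma cell_coordMupper g a : bot_left g != 0 ->
  cell_coord (g * upper a)%g = cell_coord g + a.
Proof.
move=> z0; apply: cell_coord_unique; rewrite bot_leftMupper //.
by rewrite bot_rightM val_upper !mxE /= cell_coordE // scalerDl; ring.
Qed.

Lemma cell_coordMtor g x : x != 0 -> bot_left g != 0 ->
  cell_coord (g * tor x)%g = (Nm x)^-1 * cell_coord g.
Proof.
move=> x0 z0; apply: cell_coord_unique; rewrite bot_leftMtor ?mulf_neq0 //.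
rewrite bot_rightM val_tor // !mxE /= cell_coordE // mulr0 add0r.
have cx0 : c x != 0 by rewrite conj_eq0.
have -> : ((Nm x)^-1 * cell_coord g) *: eps = (x * c x)^-1 * (cell_coord g *: eps).
  by rewrite -[LHS]mulr_algl algM algV -mulrA (NmE e) mulr_algl.
by field; rewrite x0 cx0.
Qed.

Lemma cell_coord_borel_mul g x b : x != 0 -> bot_left g != 0 ->
  cell_coord (tor x * upper b * g)%g = cell_coord g.
Proof.
move=> x0 z0.
apply: cell_coord_unique; rewrite bot_left_borel_mul ?mulf_neq0 ?invr_neq0 ?conj_eq0 //.
rewrite bot_rightM /bot_left /bot_right !val_U11M val_tor // val_upper mx2M !mxE /=.
by rewrite -/(bot_right g) -/(bot_left g) cell_coordE //; ring.
Qed.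

Definition pint (m : nat) : {pred L} := [pred x | p%:R ^- m * x \in integers L].

Lemma pintE m x : (x \in pint m) = (p%:R ^- m * x \in integers L).
Proof. by []. Qed.

Lemma pintP m x :
  reflect (exists2 z, z \in integers L & x = p%:R ^+ m * z) (x \in pint m).
Proof.
apply: (iffP idP) => [xm|[z zi ->]]; last by rewrite pintE mulKf ?pX_neq0.
by exists (p%:R ^- m * x); [exact: xm|rewrite mulVKf ?pX_neq0].
Qed.

Fact pint_zmod_closed m : zmod_closed (pint m).
Proof. by split=> [|x y]; rewrite !pintE ?mulr0 ?rpred0 // mulrBr; exact: rpredB. Qed.
HB.instance Definition _ m :=
  GRing.isZmodClosed.Build L (pint m) (pint_zmod_closed m).

Lemma pintMl m x y : x \in integers L -> y \in pint m -> x * y \in pint m.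
Proof. by move=> xi; rewrite !pintE mulrCA; exact: rpredM. Qed.

Lemma pintMr m x y : x \in pint m -> y \in integers L -> x * y \in pint m.
Proof. by move=> xm yi; rewrite mulrC pintMl. Qed.

Lemma pint_conj m x : x \in pint m -> c x \in pint m.
Proof.
move=> /pintP[z zi ->]; apply/pintP; exists (c z); first exact: integers_conj.
by rewrite conjM rmorphXn /= -alg_nat conj_alg.
Qed.

Lemma pint_le m n x : (m <= n)%N -> x \in pint n -> x \in pint m.
Proof.
move=> /subnKC <- /pintP[z zi ->]; apply/pintP; exists (p%:R ^+ (n - m) * z).
  by rewrite rpredM // rpredX // rpred_nat.
by rewrite mulrA exprD.
Qed.

Lemma pint_integers m x : x \in pint m -> x \in integers L.
Proof. by move=> /pintP[z zi ->]; rewrite rpredM // rpredX // rpred_nat. Qed.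

Lemma pint_sub1_integers m x : x - 1 \in pint m -> x \in integers L.
Proof. by move=> /pint_integers h; rewrite -(subrK 1 x) rpredD ?rpred1. Qed.

Lemma pint_mul_bounded y : exists m0, forall m x, x \in pint (m + m0) -> x * y \in pint m.
Proof.
have [m0 yi] := padic_bounded hp y; exists m0 => m x /pintP[z zi ->].
apply/pintP; exists (z * (p%:R ^+ m0 * y)); first by rewrite rpredM.
by rewrite exprD; ring.
Qed.

Lemma pint_ball (n : nat) (a : Qp) : ball n%:Z a -> a%:A \in pint n.
Proof.
move=> an; rewrite pintE; have -> : p%:R ^- n * a%:A = (p%:R ^- n * a)%:A :> L.
  by rewrite algM algV -!/(in_alg L _) rmorphXn rmorph_nat.
rewrite integers_algE padic_normM padic_normV padic_normX padic_normp // exprVn invrK.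
rewrite mulrC -ler_pdivlMr ?exprn_gt0 ?ltr0n ?prime_gt0 // div1r.
apply: le_trans an _; rewrite -exprnN natrX -exprM.
rewrite lef_pV2 ?qualifE /= ?exprn_gt0 ?ltr0n ?prime_gt0 //.
by rewrite ler_eXn2l ?ltr1n ?prime_gt1 // leq_pmull.
Qed.

Lemma pint_alg_lt1 (a : Qp) : a%:A \in pint 1 -> N a < 1.
Proof.
move=> a1; have {a1} : p%:R^-1%:A * a%:A \in integers L.
  by move: a1; rewrite pintE expr1 algV alg_nat.
rewrite -algM integers_algE padic_normM padic_normV padic_normp // invrK => h.
apply: le_lt_trans (_ : p%:R^-1 < 1); last first.
  by rewrite invf_lt1 ?ltr1n ?ltr0n ?prime_gt1 ?prime_gt0.
by rewrite -[leRHS]mulr1 ler_pdivlMl // ltr0n prime_gt0.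
Qed.

Lemma pint_Nm_sub1 m x : x - 1 \in pint m -> (Nm x - 1)%:A \in pint m.
Proof.
move=> x1; rewrite scalerBl scale1r -(NmE e).
rewrite (_ : _ - 1 = (x - 1) * c x + c (x - 1)); last by rewrite conjB conj1; ring.
rewrite rpredD ?pint_conj // pintMr //.
exact/integers_conj/(pint_sub1_integers x1).
Qed.

Lemma pint_sub1_Nm m x : x - 1 \in pint m.+1 -> N (Nm x) = 1.
Proof.
move=> /pint_Nm_sub1/(pint_le (ltn0Sn m))/pint_alg_lt1 h.
by rewrite -(subrKC 1 (Nm x)) padic_normD_eq ?padic_norm1.
Qed.

Lemma pint_sub1_invr m x : x - 1 \in pint m.+1 -> x^-1 \in integers L.
Proof.
move=> x1; have n1 := pint_sub1_Nm x1; have x0 := Nm_norm1_neq0 n1.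
have -> : x^-1 = c x * (Nm x)^-1%:A.
  have cx0 : c x != 0 by rewrite conj_eq0.
  by rewrite algV -(NmE e); field; rewrite x0 cx0.
rewrite rpredM ?integers_conj ?(pint_sub1_integers x1) //.
by rewrite integers_algE padic_normV n1 invr1.
Qed.

Definition congruence (m : nat) : set G :=
  [set g : G | forall i j, val g i j - (1%:M : 'M[L]_2) i j \in pint m].

Lemma congruenceP m (g : G) x y z t : val g = mx2 x y z t ->
  congruence m g <-> [/\ x - 1 \in pint m, y \in pint m, z \in pint m & t - 1 \in pint m].
Proof.
move=> gE; rewrite /congruence /= -[U11_val g]/(val g) gE mx2_1.
split=> [h|[h1 h2 h3 h4] i j].
  have := (h ord0 ord0, h ord0 ord_max, h ord_max ord0, h ord_max ord_max).
  by rewrite !mxE /= !subr0 => -[[[]]].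
by rewrite (ord2E i) (ord2E j) !mxE; do 2!case: ifP => _; rewrite //= subr0.
Qed.

Lemma congruence_integers m (g : G) i j : congruence m g -> val g i j \in integers L.
Proof.
move=> /(_ i j)/pint_integers gi; rewrite -(subrK ((1%:M : 'M[L]_2) i j) (val g i j)).
by rewrite rpredD // mxE rpred_nat.
Qed.

Lemma congruence_open_subgroup m : open_subgroup (congruence m).
Proof.
split.
- suff : U11_open (congruence m) by [].
  move=> g gm; exists m => h hg i j; rewrite -(subrKA (val g i j)) rpredD ?gm //.
  by apply/pintP; exact: hg.
- by move=> i j; rewrite subrr rpred0.
- move=> g h gm hm i j.
  pose g1 := val g - 1%:M; have g1m k l : g1 k l \in pint m.
    by have := gm k l; rewrite /g1 !mxE.
  have -> : val (g * h)%g = g1 *m val h + val h.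
    by rewrite val_U11M mulmxBl mul1mx subrK.
  rewrite [(_ + _ : 'M_2) i j]mxE -addrA rpredD ?hm // mxE rpred_sum // => l _.
  by rewrite pintMr ?(congruence_integers _ _ hm).
- move=> g /(congruenceP m (mx2E (val g)))[h1 h2 h3 h4].
  apply/(congruenceP m (val_U11V (mx2E (val g)))).
  have cB x : c x - 1 = c (x - 1) by rewrite conjB conj1.
  by rewrite !cB; split; exact: pint_conj.
Qed.

Lemma open_subgroup_congruence (K : set G) :
  open_subgroup K -> exists m, congruence m `<=` K.
Proof.
case=> oK K1 _ _; have oK' : U11_open K by [].
have [m hm] := oK' _ K1; exists m => g gm; apply: hm => i j.
exact/pintP/gm.
Qed.

Lemma pint_scale_traceless m :
  exists n : nat, forall a : Qp, ball n%:Z a -> a *: eps \in pint m.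
Proof.
have [m0 h] := pint_mul_bounded eps; exists (m + m0)%N => a /pint_ball/h.
by rewrite mulr_algl.
Qed.

Lemma upper_congruence m :
  exists n : nat, forall a, ball n%:Z a -> congruence m (upper a).
Proof.
have [n hn] := pint_scale_traceless m; exists n => a /hn h.
by apply/(congruenceP m (val_upper a)); rewrite subrr !rpred0.
Qed.

Lemma lower_congruence m :
  exists n : nat, forall a, ball n%:Z a -> congruence m (lower a).
Proof.
have [n hn] := pint_scale_traceless m; exists n => a /hn h.
by apply/(congruenceP m (val_lower a)); rewrite subrr !rpred0.
Qed.

Lemma tor_congruence m x : x - 1 \in pint m.+1 -> congruence m.+1 (tor x).
Proof.
move=> x1; have x0 := Nm_norm1_neq0 (pint_sub1_Nm x1).
apply/(congruenceP _ (val_tor x0)); rewrite x1 !rpred0 -conjV; split=> //.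
rewrite (_ : _ - 1 = - (c (x - 1) * c x^-1)).
  rewrite rpredN pintMr ?pint_conj ?integers_conj //.
  exact: pint_sub1_invr x1.
have cx0 : c x != 0 by rewrite conj_eq0.
by rewrite conjV conjB conj1; field.
Qed.

Lemma open_subgroup_upper (K : set G) : open_subgroup K ->
  exists n : nat, forall a, ball n%:Z a -> K (upper a).
Proof.
move=> /open_subgroup_congruence[m mK]; have [n hn] := upper_congruence m.
by exists n => a /hn/mK.
Qed.

Lemma open_subgroup_lower (K : set G) : open_subgroup K ->
  exists n : nat, forall a, ball n%:Z a -> K (lower a).
Proof.
move=> /open_subgroup_congruence[m mK]; have [n hn] := lower_congruence m.
by exists n => a /hn/mK.
Qed.

Lemma open_subgroup_tor (K : set G) : open_subgroup K ->
  exists m, forall x, x - 1 \in pint m.+1 -> K (tor x).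
Proof.
move=> /open_subgroup_congruence[m mK]; exists m => x /tor_congruence xm.
by apply: mK => i j; exact: pint_le (xm i j).
Qed.

(** * The big cell and the Hecke operator *)

Definition automorphy_factor (g k : G) : L :=
  val k ord0 ord0 + (cell_coord g)%:A * (val k ord_max ord0 * eps).

Lemma bot_leftM_automorphy g k : bot_left g != 0 ->
  bot_left (g * k)%g = bot_left g * automorphy_factor g k.
Proof.
move=> g0; rewrite bot_leftM cell_coordE // /automorphy_factor.
by rewrite -(mulr_algl (cell_coord g) eps); ring.
Qed.

Lemma cell_coordM_automorphy g k : bot_left g != 0 -> bot_left (g * k)%g != 0 ->
  (cell_coord (g * k)%g)%:A * automorphy_factor g k =
  val k ord0 ord_max * eps^-1 + (cell_coord g)%:A * val k ord_max ord_max.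
Proof.
move=> g0 gk0; have := cell_coordE gk0.
rewrite bot_rightM (cell_coordE g0) bot_leftM_automorphy //.
rewrite -!(mulr_algl (cell_coord _) eps).
set u := automorphy_factor g k; set y := val k ord0 ord_max.
set t := val k ord_max ord_max => E; have e0 := traceless_neq0 e.
apply: (mulIf e0); apply: (mulIf g0).
transitivity (bot_left g * y + (cell_coord g)%:A * eps * bot_left g * t).
  by rewrite E; ring.
by field.
Qed.

Lemma congruence_automorphy m : exists M, forall g k, congruence M k ->
  ball 0 (cell_coord g) ->
  automorphy_factor g k - 1 \in pint m /\
  val k ord0 ord_max * eps^-1 + (cell_coord g)%:A * val k ord_max ord_max \in integers L.
Proof.
have [me he] := pint_mul_bounded eps; have [mi hi] := pint_mul_bounded eps^-1.
pose M := (m + me + mi)%N; exists M => g k /(congruenceP M (mx2E (val k)))[].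
rewrite /automorphy_factor; set x := val k ord0 ord0; set y := val k ord0 ord_max.
set z := val k ord_max ord0; set t := val k ord_max ord_max => kx ky kz kt b0.
have gi : (cell_coord g)%:A \in integers L.
  by rewrite integers_algE; move: b0; rewrite /ball oppr0 expr0z.
split.
  rewrite addrAC rpredD //; first by apply: pint_le kx; rewrite /M; lia.
  by apply: (pintMl gi); apply: he; apply: pint_le kz; rewrite /M; lia.
rewrite rpredD //; last by rewrite rpredM ?(pint_sub1_integers kt).
apply: (@pint_integers 0); apply: hi; apply: pint_le ky.
by rewrite add0n leq_addl.
Qed.

Section CellFunction.
Variables (A : comNzRingType) (tau : L -> A).
Hypothesis tauM : forall x y, x != 0 -> y != 0 -> tau (x * y) = tau x * tau y.
Hypothesis tau1 : tau 1 = 1.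

Definition cell_fun (g : G) : A^o :=
  ((bot_left g != 0) && ball 0 (cell_coord g))%:R * tau (bot_left g).

Lemma cell_fun_borel_mul x b g : x != 0 ->
  cell_fun (tor x * upper b * g)%g = tau (c x)^-1 * cell_fun g.
Proof.
move=> x0; have cx0 : (c x)^-1 != 0 by rewrite invr_eq0 conj_eq0.
rewrite /cell_fun bot_left_borel_mul // mulf_eq0 (negbTE cx0) /=.
have [z0|z0] := eqVneq (bot_left g) 0; first by rewrite !mul0r mulr0.
by rewrite cell_coord_borel_mul // tauM // mulrCA.
Qed.

Lemma cell_fun_upper g a : ball 0 a -> cell_fun (g * upper a)%g = cell_fun g.
Proof.
move=> a0; rewrite /cell_fun bot_leftMupper.
have [//|z0] := eqVneq (bot_left g) 0.
by rewrite cell_coordMupper // ballDr.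
Qed.

Lemma cell_fun_torE x g : x != 0 -> cell_fun (g * tor x)%g = tau x *
  (((bot_left g != 0) && ball 0 ((Nm x)^-1 * cell_coord g))%:R * tau (bot_left g)).
Proof.
move=> x0; rewrite /cell_fun bot_leftMtor // mulf_eq0 (negbTE x0) orbF.
have [z0|z0] := eqVneq (bot_left g) 0; first by rewrite !mul0r mulr0.
by rewrite cell_coordMtor // tauM //; ring.
Qed.

Lemma cell_fun_tor x g : N (Nm x) = 1 -> cell_fun (g * tor x)%g = tau x * cell_fun g.
Proof.
move=> n1; rewrite cell_fun_torE ?(Nm_norm1_neq0 n1) // ballMnorm1 //.
by rewrite padic_normV n1 invr1.
Qed.

Lemma cell_fun_hecke g :
  \sum_(i < q) cell_fun (g * upper i%:R * tor p%:R)%g = tau p%:R * cell_fun g.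
Proof.
under eq_bigr do rewrite cell_fun_torE ?p_neq0 // bot_leftMupper Nm_p ballMqV.
rewrite -mulr_sumr -mulr_suml /cell_fun; congr (_ * (_ * _)).
have [z0|z0] := eqVneq (bot_left g) 0; first by rewrite big1.
rewrite -(sum_ball_natr _ (cell_coord g)); apply: eq_bigr => i _.
by rewrite cell_coordMupper.
Qed.

Lemma cell_fun_weyl_upper a : cell_fun (weyl * upper a)%g = (ball 0 a)%:R.
Proof.
have w0 : bot_left weyl != 0 by rewrite bot_left_weyl oner_neq0.
rewrite /cell_fun bot_leftMupper w0 cell_coordMupper // cell_coord_weyl add0r.
by rewrite bot_left_weyl tau1 mulr1.
Qed.

Lemma cell_fun_weyl : cell_fun weyl = 1.
Proof. by have := cell_fun_weyl_upper 0; rewrite upper0 mulg1 ball0. Qed.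

Lemma cell_fun_borel g : bot_left g = 0 -> cell_fun g = 0.
Proof. by move=> g0; rewrite /cell_fun g0 eqxx mul0r. Qed.

Lemma cell_fun_weyl_ball n r a :
  cell_fun (weyl * upper a * upper (- r) * tor (p%:R ^+ n))%g =
  tau (p%:R ^+ n) * (ball n%:Z (a - r))%:R.
Proof.
rewrite -(mulgA weyl) -upperD cell_fun_torE ?pX_neq0 // bot_leftMupper.
rewrite bot_left_weyl oner_neq0 cell_coordMupper ?bot_left_weyl ?oner_neq0 //.
by rewrite cell_coord_weyl add0r Nm_pX exprnN ballMqz sub0r opprK tau1 mulr1.
Qed.

(* A small k multiplies the bottom left entry of an element of the cell by a unit
   close to 1 and preserves the integrality of its coordinate. *)
Lemma cell_fun_smooth : (exists m, forall x, x - 1 \in pint m -> tau x = 1) ->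
  exists2 K : set G, open_subgroup K &
    forall g h, K h -> cell_fun (g * h)%g = cell_fun g.
Proof.
case=> m taum; have [M hM] := congruence_automorphy m.+1.
exists (congruence M); first exact: congruence_open_subgroup.
have inside g k : congruence M k -> (bot_left g != 0) && ball 0 (cell_coord g) ->
    cell_fun (g * k)%g = cell_fun g.
  move=> kM /andP[g0 b0]; have [u1 int] := hM g k kM b0.
  have u0 := Nm_norm1_neq0 (pint_sub1_Nm u1).
  have gk0 : bot_left (g * k)%g != 0 by rewrite bot_leftM_automorphy // mulf_neq0.
  have b0' : ball 0 (cell_coord (g * k)%g).
    rewrite /ball oppr0 expr0z -integers_algE -[X in X \in _](mulfK u0).
    by rewrite cell_coordM_automorphy // rpredM ?(pint_sub1_invr u1).
  rewrite /cell_fun gk0 b0' g0 b0 bot_leftM_automorphy // tauM //.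
  by rewrite (taum (automorphy_factor g k)) ?mulr1 // (pint_le _ u1).
move=> g k kM.
have [/inside->//|gb] := boolP ((bot_left g != 0) && ball 0 (cell_coord g)).
have [gkb|gkb] := boolP ((bot_left (g * k)%g != 0) && ball 0 (cell_coord (g * k)%g)).
  have [_ _ _ inv] := congruence_open_subgroup M.
  by have := inside _ _ (inv _ kM) gkb; rewrite mulgK => <-.
by rewrite /cell_fun (negbTE gb) (negbTE gkb) !mul0r.
Qed.

End CellFunction.

Section HeckeOperator.
Variables (W : nmodType) (act : G -> W -> W).

Definition hecke_op (x : W) : W :=
  \sum_(i < q) act (upper i%:R) (act (tor p%:R) x).

Definition upper_fixed (x : W) : Prop := forall b, ball 0 b -> act (upper b) x = x.

End HeckeOperator.

Section Hecke.
Variables (R : comNzRingType) (V : srep G R).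
Implicit Types x v : V.
Local Notation hecke := (hecke_op (@srep_act G R V)).
Local Notation upper_fixed := (upper_fixed (@srep_act G R V)).

Lemma act_upperD a b x :
  srep_act (upper (a + b)) x = srep_act (upper a) (srep_act (upper b) x).
Proof. by rewrite upperD srep_actM. Qed.

Lemma act_tor_upper y a x : y != 0 ->
  srep_act (tor y) (srep_act (upper a) x) =
  srep_act (upper (Nm y * a)) (srep_act (tor y) x).
Proof. by move=> y0; rewrite -!srep_actM tor_upper. Qed.

Lemma act_torM y z x : y != 0 -> z != 0 ->
  srep_act (tor y) (srep_act (tor z) x) = srep_act (tor (y * z)) x.
Proof. by move=> y0 z0; rewrite -srep_actM torM. Qed.

Lemma heckeD x y : hecke (x + y) = hecke x + hecke y.
Proof. by rewrite -big_split; apply: eq_bigr => i _; rewrite !srep_actD. Qed.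

Lemma heckeZ r x : hecke (r *: x) = r *: hecke x.
Proof. by rewrite scaler_sumr; apply: eq_bigr => i _; rewrite !srep_actZ. Qed.

Lemma hecke_iterD n x y : iter n hecke (x + y) = iter n hecke x + iter n hecke y.
Proof. by elim: n => [|n IHn] //=; rewrite IHn heckeD. Qed.

Lemma hecke_iterZ n r x : iter n hecke (r *: x) = r *: iter n hecke x.
Proof. by elim: n => [|n IHn] //=; rewrite IHn heckeZ. Qed.

Lemma hecke_upper r x :
  hecke (srep_act (upper r) x) = srep_act (upper (q%:R * r)) (hecke x).
Proof.
rewrite srep_act_sum; apply: eq_bigr => i _.
by rewrite act_tor_upper ?p_neq0 // -!act_upperD addrC Nm_p.
Qed.

Lemma hecke_iter_upper n r x :
  iter n hecke (srep_act (upper r) x) = srep_act (upper (q%:R ^+ n * r)) (iter n hecke x).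
Proof.
elim: n => [|n IHn]; first by rewrite mul1r.
by rewrite /= IHn hecke_upper mulrA -exprS.
Qed.

Lemma upper_fixed_periodic x : upper_fixed x -> forall a b, ball 0 a -> ball 1 b ->
  srep_act (upper (a + b)) (srep_act (tor p%:R) x) =
  srep_act (upper a) (srep_act (tor p%:R) x).
Proof.
move=> fx a b _ hb; rewrite act_upperD; congr srep_act.
have -> : b = Nm p%:R * (q%:R^-1 * b) by rewrite Nm_p mulVKf // padicq_neq0.
by rewrite -act_tor_upper ?p_neq0 // fx // ballMqV.
Qed.

Lemma hecke_fixed x : upper_fixed x -> upper_fixed (hecke x).
Proof.
move=> fx b hb; rewrite srep_act_sum.
under eq_bigr do rewrite -act_upperD.
apply: (sum_transversal (upper_fixed_periodic fx)
  (psi := fun i : 'I_q => b + i%:R)) => [i|i j].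
  by rewrite ballD ?ball_natr.
rewrite opprD addrACA subrr add0r => ij.
exact/val_inj/(@ball_natrB_inj 1 _ _ (ltn_ord i) (ltn_ord j)).
Qed.

Lemma hecke_iter_fixed n x : upper_fixed x -> upper_fixed (iter n hecke x).
Proof. by move=> fx; elim: n => [|n IHn] //=; exact: hecke_fixed. Qed.

Lemma upper_fixed_tor y x :
  N (Nm y) = 1 -> upper_fixed x -> upper_fixed (srep_act (tor y) x).
Proof.
move=> y1 fx b hb; have y0 := Nm_norm1_neq0 y1.
have n0 : Nm y != 0 by rewrite (Nm_eq0 e).
rewrite -(mulVKf n0 b) -act_tor_upper // fx // ballMnorm1 // padic_normV y1 invr1.
by [].
Qed.

Lemma hecke_tor y x : N (Nm y) = 1 -> upper_fixed x ->
  hecke (srep_act (tor y) x) = srep_act (tor y) (hecke x).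
Proof.
move=> y1 fx; have y0 := Nm_norm1_neq0 y1; rewrite srep_act_sum.
under [RHS]eq_bigr do
  rewrite act_tor_upper // act_torM ?p_neq0 // (mulrC y) -act_torM ?p_neq0 //.
apply/esym; apply: (sum_transversal (upper_fixed_periodic (upper_fixed_tor y1 fx))
  (psi := fun i : 'I_q => Nm y * i%:R)) => [i|i j].
  by rewrite ballMnorm1 ?ball_natr.
rewrite -mulrBr ballMnorm1 // => ij.
exact/val_inj/(@ball_natrB_inj 1 _ _ (ltn_ord i) (ltn_ord j)).
Qed.

Lemma hecke_iter_eigen n lam x : hecke x = lam *: x -> iter n hecke x = lam ^+ n *: x.
Proof.
move=> hx; elim: n => [|n IHn] /=; first by rewrite scale1r.
by rewrite IHn heckeZ hx scalerA -exprSr.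
Qed.

Definition upper_span (v : V) : set V := lspan (range (fun b => srep_act (upper b) v)).

Lemma hecke_upper_span v lam x : upper_fixed v -> hecke v = lam *: v ->
  upper_span v x -> exists n d, iter n hecke x = d *: v.
Proof.
move=> fv hv; have iterv n := hecke_iter_eigen n hv.
move: x; apply: lspan_min.
  split=> [|x y [n [d hx]] [m [d' hy]]|r x [n [d hx]]].
  - by exists 0%N, 0; rewrite scale0r.
  - exists (n + m)%N, (d * lam ^+ m + d' * lam ^+ n).
    rewrite hecke_iterD {1}addnC !iterD hx hy !hecke_iterZ !iterv.
    by rewrite !scalerA scalerDl.
  - by exists n, (r * d); rewrite hecke_iterZ hx scalerA.
move=> _ [b _ <-]; have [n hn] := ball_ex b; exists n, (lam ^+ n).
by rewrite hecke_iter_upper iterv srep_actZ fv // ballMqX sub0r.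
Qed.

Lemma ordinary_line v lam x mu mu' : upper_fixed v -> hecke v = lam *: v ->
  upper_span v x -> hecke x = mu *: x -> mu * mu' = 1 -> exists d, x = d *: v.
Proof.
move=> fv hv xs hx mm; have [n [d E]] := hecke_upper_span fv hv xs.
exists (mu' ^+ n * d); rewrite -scalerA -E (hecke_iter_eigen n hx) scalerA.
by rewrite -exprMn mulrC mm expr1n scale1r.
Qed.

End Hecke.

(** * Models on the big cell *)

(* The restriction of St(s) to the Borel subgroup acts on the locally constant
   functions of compact support on the big cell, identified with Q_p. *)
Record cellModel (R : comNzRingType) (V : srep G R) (s : schar G R) := CellModel {
  cm_eval :> {linear V -> (Qp -> R^o)};
  cm_inj : injective cm_eval;
  cm_upper : forall b x a, cm_eval (srep_act (upper b) x) a = cm_eval x (a + b);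
  cm_tor : forall y x a, y != 0 ->
    cm_eval (srep_act (tor y) x) a = s (tor y) * cm_eval x ((Nm y)^-1 * a);
  cm_stepfun : forall x, exists n, stepfun n n (cm_eval x);
  cm_base : V;
  cm_baseE : cm_eval cm_base = ball_indic R 0 0
}.

Section CellModelTheory.
Variables (R : comNzRingType) (V : srep G R) (s : schar G R) (M : cellModel V s).
Local Notation base := (cm_base M).
Local Notation translate n r :=
  (srep_act (upper r) (srep_act (tor (p%:R ^+ n)) base)).

Lemma cellmD x y a : M (x + y) a = M x a + M y a.
Proof. by rewrite linearD. Qed.

Lemma cellmB x y a : M (x - y) a = M x a - M y a.
Proof. by rewrite linearB. Qed.

Lemma cellmZ r x a : M (r *: x) a = r * M x a.
Proof. by rewrite linearZ_LR. Qed.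

Lemma cellm0 a : M 0 a = 0.
Proof. by rewrite linear0. Qed.

Lemma cellm_sum (I : Type) (r : seq I) (F : I -> V) a :
  M (\sum_(i <- r) F i) a = \sum_(i <- r) M (F i) a.
Proof. by rewrite linear_sum fct_sumE. Qed.

Lemma cellm_ext x y : M x =1 M y -> x = y.
Proof. by move=> xy; apply/(cm_inj (c := M))/funext. Qed.

Lemma base_eval a : M base a = (ball 0 a)%:R.
Proof. by rewrite cm_baseE /ball_indic subr0. Qed.

Lemma base_fixed : upper_fixed (@srep_act G R V) base.
Proof.
by move=> b hb; apply: cellm_ext => a; rewrite cm_upper !base_eval ballDr.
Qed.

Lemma base_tor y : N (Nm y) = 1 -> srep_act (tor y) base = s (tor y) *: base.
Proof.
move=> y1; apply: cellm_ext => a; rewrite cm_tor ?(Nm_norm1_neq0 y1) // cellmZ.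
by rewrite !base_eval ballMnorm1 // padic_normV y1 invr1.
Qed.

Lemma base_hecke : hecke_op (@srep_act G R V) base = s (tor p%:R) *: base.
Proof.
apply: cellm_ext => a; rewrite cellm_sum cellmZ base_eval -sum_ball_natr mulr_sumr.
by apply: eq_bigr => i _; rewrite cm_upper cm_tor ?p_neq0 // Nm_p base_eval ballMqV.
Qed.

Lemma translate_eval n r a :
  M (translate n r) a = s (tor (p%:R ^+ n)) * (ball n%:Z (a + r))%:R.
Proof.
rewrite cm_upper cm_tor ?pX_neq0 // base_eval Nm_pX exprnN ballMqz.
by rewrite sub0r opprK.
Qed.

Lemma cellm_surj m n h : stepfun m n h -> exists x, M x = h.
Proof.
move=> /stepfun_expand->.
exists (\sum_(i < q ^ (m + n)) (h (grid m i) * s ((tor (p%:R ^+ n))^-1)%g) *: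
  translate n (- grid m i)).
apply/funext => a; rewrite cellm_sum fct_sumE; apply: eq_bigr => i _.
rewrite cellmZ translate_eval -mulrA; congr (_ * _).
by rewrite mulrA [s _ * _]mulrC scharV mul1r.
Qed.

Lemma translate_span y : lspan (range (fun nr : nat * Qp => translate nr.1 nr.2)) y.
Proof.
have [n] := cm_stepfun M y => /stepfun_expand yE.
suff -> : y = \sum_(i < q ^ (n + n)) (M y (grid n i) * s ((tor (p%:R ^+ n))^-1)%g) *:
    translate n (- grid n i).
  apply: lspan_sum => i _ _; apply: lspanZ; apply: mem_lspan.
  by exists (n, - grid n i).
apply: cellm_ext => a; rewrite [in LHS]yE fct_sumE cellm_sum; apply: eq_bigr => i _.
rewrite cellmZ translate_eval -mulrA; congr (_ * _).
by rewrite mulrA [s _ * _]mulrC scharV mul1r.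
Qed.

Lemma fixed_upper_span y : upper_fixed (@srep_act G R V) y -> upper_span base y.
Proof.
move=> fy; have [n [_ hsupp]] := cm_stepfun M y.
have /stepfun_expand yE : stepfun n 0 (M y).
  by split=> // a b hb; rewrite -cm_upper fy.
suff -> : y = \sum_(i < q ^ (n + 0)) M y (grid n i) *: srep_act (upper (- grid n i)) base.
  by apply: lspan_sum => i _ _; apply: lspanZ; apply: mem_lspan; exists (- grid n i).
apply: cellm_ext => a; rewrite [in LHS]yE fct_sumE cellm_sum; apply: eq_bigr => i _.
by rewrite cellmZ cm_upper base_eval.
Qed.

Section Cocycle.
Variables (z : Qp -> V) (n : nat).
Hypothesis zD : forall b b', ball 0 b -> ball 0 b' ->
  z (b + b') = z b + srep_act (upper b) (z b').
Hypothesis z0 : forall b, ball n%:Z b -> z b = 0.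

Let rep (a : Qp) : Qp := xget 0 [set b | ball 0 (a - b)].
Let repP a : ball 0 (a - rep a).
Proof. by apply: (@xgetI _ 0 [set b | ball 0 (a - b)] a); rewrite /= subrr. Qed.
Let repD a b : ball 0 b -> rep (a + b) = rep a.
Proof.
move=> hb; congr xget; apply/seteqP.
by split=> x /=; rewrite addrAC (ballDr _ hb).
Qed.

(* On the coset rep a + Z_p the primitive of the cocycle is x |-> z_x (rep a). *)
Let primitive (a : Qp) : R^o := M (z (a - rep a)) (rep a).

Let primitiveD a b : ball 0 b -> primitive (a + b) = primitive a + M (z b) a.
Proof.
move=> hb; rewrite /primitive repD // (addrAC a) (zD (repP a) hb) cellmD cm_upper.
by rewrite subrKC.
Qed.

Lemma cocycle_support : exists m : nat, forall b, ball 0 b ->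
  forall a, ~~ ball (- m%:Z) a -> M (z b) a = 0.
Proof.
have ball0W b : ball n%:Z b -> ball 0 b by apply: ball_le.
have [m hm] : exists m : nat, forall i : 'I_(q ^ n), forall a,
    ~~ ball (- m%:Z) a -> M (z i%:R) a = 0.
  have [f hf] := choice (fun i : 'I_(q ^ n) => cm_stepfun M (z i%:R)).
  exists (\max_i f i)%N => i a ha; have [_] := hf i; apply.
  by apply: contra ha; apply: ball_le; rewrite lerN2 lez_nat leq_bigmax.
exists m => b hb a ha; have [i hi] := ball_natr_approx n hb.
by rewrite -(subrKC i%:R b) zD ?ball_natr ?ball0W // (z0 hi) linear0 addr0 hm.
Qed.

Lemma cocycle_split : exists y : V, forall b, ball 0 b -> srep_act (upper b) y - y = z b.
Proof.
have [m hm] := cocycle_support.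
have [|y yE] := @cellm_surj m n primitive; last first.
  exists y => b hb; apply: cellm_ext => a.
  by rewrite cellmB cm_upper yE primitiveD // addrC addKr.
split=> [a b hb|a ha].
  by rewrite primitiveD ?z0 ?cellm0 ?addr0 //; apply: ball_le hb.
apply: hm; first exact: repP.
apply: contra ha => ha; rewrite -(subrK (rep a) a) ballD //.
by apply: ball_le (repP a); lia.
Qed.

End Cocycle.

End CellModelTheory.

Lemma cell_model_is_lift (O : comNzRingType) (k : fieldType) (res : {rmorphism O -> k})
    (res_surj : forall y, exists x, res x = y) (A : artAlg res)
    (V : srep G A) (s : schar G A) (M : cellModel V s)
    (V0 : srep G k) (s0 : schar G k) (M0 : cellModel V0 s0) (phi : V -> V0) :
  (forall g x, phi (srep_act g x) = srep_act g (phi x)) ->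
  (forall x a, M0 (phi x) a = art_res A (M x a)) -> is_lift phi.
Proof.
move=> phi_act phiE.
have vdp_surj (x : van_der_put) : exists v, M v = vdp_fun A x.
  exact: cellm_surj (stepfun_ball _ _ (ball_grid _ _)).
have [X XE] := choice vdp_surj.
have XE0 : M0 \o (phi \o X) = @vdp_fun k.
  apply/funext => x; apply/funext => a /=.
  by rewrite phiE XE /vdp_fun /ball_indic rmorph_nat.
have {}XE : M \o X = @vdp_fun A by apply/funext => x; exact: XE.
apply: (is_lift_of_basis res_surj (e := X)) => //.
- by move=> u v; apply: (cellm_ext (M := M0)) => a; rewrite cellmD !phiE cellmD rmorphD.
- by move=> r v; apply: (cellm_ext (M := M0)) => a; rewrite cellmZ !phiE cellmZ rmorphM.
- move=> v; apply: (lspan_range_inj (cm_inj (c := M))); rewrite XE.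
  by have [n] := cm_stepfun M v; exact: vdp_span.
- by apply: (@lin_indep_linear _ _ _ M); rewrite XE; exact: vdp_lin_indep.
- move=> v; apply: (lspan_range_inj (cm_inj (c := M0))); rewrite XE0.
  by have [n] := cm_stepfun M0 v; exact: vdp_span.
- by apply: (@lin_indep_linear _ _ _ M0); rewrite XE0; exact: vdp_lin_indep.
Qed.

Section CharacterValues.
Variables (R : comNzRingType) (s : schar G R).

Lemma schar_upper a : s (upper a) = 1.
Proof. exact: (schar_unipotent hp s (upper_unipotent a)). Qed.

Lemma schar_weylK : s weyl * s weyl = 1.
Proof. by rewrite -scharM weylK schar1. Qed.

Lemma schar_weyl_tor x : x != 0 -> s (tor (c x)^-1) = s (tor x).
Proof.
move=> x0; have /(congr1 s) := weyl_tor x0; rewrite !scharM mulrC => E.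
by rewrite -[LHS]mulr1 -schar_weylK mulrA -E -mulrA schar_weylK mulr1.
Qed.

Lemma schar_weylE : s weyl = s (tor (- eps^-1)).
Proof.
have := congr1 s (weyl_upper (oner_neq0 _)).
by rewrite !scharM !schar_upper !mulr1 schar_weylK scale1r mulr1 mul1r.
Qed.

Lemma schar_bigcell g : bot_left g != 0 -> s g = s (tor (bot_left g)) * s weyl.
Proof.
move=> g0; have [b gE] := bigcell_decomp g0; rewrite {1}gE !scharM !schar_upper.
by rewrite !mulr1 schar_weyl_tor.
Qed.

End CharacterValues.

Section SteinbergModel.
Variables (R : comNzRingType) (s : schar G R).
Local Notation St := (St_rep hp s).

Lemma St_classW (P : St -> Prop) : (forall f, P (St_class hp f)) -> forall x, P x.
Proof. exact: (mqW (M := quotient_pre (char_line_sub hp s))). Qed.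

Lemma St_classD (f f' : ind s) : St_class hp (f + f') = St_class hp f + St_class hp f'.
Proof. exact: (mqD (M := quotient_pre (char_line_sub hp s))). Qed.

Lemma St_classZ r (f : ind s) : St_class hp (r *: f) = r *: St_class hp f.
Proof. exact: (mqZ (M := quotient_pre (char_line_sub hp s))). Qed.

Lemma St_class0 : St_class hp (0 : ind s) = 0.
Proof. by rewrite -[X in St_class hp X](scale0r (0 : ind s)) St_classZ scale0r. Qed.

Lemma St_class_act g (f : ind s) :
  srep_act g (St_class hp f) = St_class hp (ind_act hp g f).
Proof. exact: (quot_act_class (char_line_sub hp s) (@char_line_act _ hp _ _ _ _ s)). Qed.

Lemma ind_borel_mul (f : ind s) x b g : x != 0 ->
  f (tor x * upper b * g)%g = s (tor x) * f g.
Proof.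
move=> x0; have /ind_predP[fB _] := indP f; apply: fB; first exact: tor_torus.
exact: upper_unipotent.
Qed.

Lemma ind_upper_mul (f : ind s) b g : f (upper b * g)%g = f g.
Proof. by have := ind_borel_mul f b g (oner_neq0 L); rewrite tor1 mul1g schar1 mul1r. Qed.

Lemma ind_tor_mul (f : ind s) x g : x != 0 -> f (tor x * g)%g = s (tor x) * f g.
Proof. by move=> x0; have := ind_borel_mul f 0 g x0; rewrite upper0 mulg1. Qed.

Lemma ind_ext (f f' : ind s) : f 1%g = f' 1%g ->
  (forall a, f (weyl * upper a)%g = f' (weyl * upper a)%g) -> f = f'.
Proof.
move=> f1 fw; apply: val_inj; apply/funext => g /=.
have [g0|g0] := eqVneq (bot_left g) 0.
  have [x [b [x0 ->]]] := borel_decomp g0.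
  by rewrite -[(_ * _)%g]mulg1 !ind_borel_mul // f1.
have [b ->] := bigcell_decomp g0.
have x0 : (c (bot_left g))^-1 != 0 by rewrite invr_eq0 conj_eq0.
by rewrite -[(_ * weyl * _)%g]mulgA !ind_borel_mul // fw.
Qed.

(* Subtracting the multiple of s that agrees with f at 1 makes f vanish near the
   Borel subgroup, so that the result has compact support on the big cell. *)
Definition ind_eval (f : ind s) : Qp -> R^o :=
  fun a => f (weyl * upper a)%g - f 1%g * s weyl.

Lemma ind_evalP r f f' a : ind_eval (r *: f + f') a = r * ind_eval f a + ind_eval f' a.
Proof.
rewrite /ind_eval -![(r *: f + f') _]/(r * f _ + f' _).
by ring.
Qed.

Lemma ind_eval_char (f : ind s) r : (forall g, f g = r * s g) -> ind_eval f =1 fun=> 0.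
Proof.
move=> fE a; rewrite /ind_eval !fE !scharM schar_upper schar1.
by ring.
Qed.

Definition St_eval (x : St) : Qp -> R^o := ind_eval (mrepr x).

Lemma St_eval_class f : St_eval (St_class hp f) = ind_eval f.
Proof.
apply/funext => a; have [r fr] := quotient_repr (char_line_sub hp s) f.
apply/eqP; rewrite -subr_eq0 -(ind_eval_char fr a) /St_eval.
rewrite -mulN1r addrC -ind_evalP scaleN1r addrC.
by [].
Qed.

Lemma St_eval_linear : linear St_eval.
Proof.
move=> r; elim/St_classW=> f; elim/St_classW=> f'; apply/funext => a.
rewrite -St_classZ -St_classD -[RHS]/(r * St_eval _ a + St_eval _ a).
by rewrite !St_eval_class ind_evalP.
Qed.

Lemma St_eval_upper b x a : St_eval (srep_act (upper b) x) a = St_eval x (a + b).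
Proof.
elim/St_classW: x => f; rewrite St_class_act !St_eval_class /ind_eval /= mul1g.
by rewrite -mulgA -upperD -[upper b]mulg1 ind_upper_mul.
Qed.

Lemma St_eval_tor y x a : y != 0 ->
  St_eval (srep_act (tor y) x) a = s (tor y) * St_eval x ((Nm y)^-1 * a).
Proof.
move=> y0; elim/St_classW: x => f; rewrite St_class_act !St_eval_class /ind_eval /= mul1g.
rewrite -mulgA upper_tor // !mulgA weyl_tor // -!mulgA.
have -> : f (tor y) = s (tor y) * f 1%g by rewrite -{1}(mulg1 (tor y)) ind_tor_mul.
rewrite ind_tor_mul ?invr_eq0 ?conj_eq0 //.
by rewrite schar_weyl_tor //; ring.
Qed.

Lemma St_eval_inj : injective St_eval.
Proof.
elim/St_classW=> f; elim/St_classW=> f'; rewrite !St_eval_class => E.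
apply/quotient_classP; exists (f 1%g - f' 1%g).
have cf := char_fun_ind hp s (f 1%g - f' 1%g).
suff -> : f - f' = Ind cf by [].
apply: ind_ext; rewrite /= ?schar1 ?mulr1 // => a.
rewrite -[LHS]/(f _ - f' _) scharM schar_upper mulr1.
have := congr1 (fun h => h a) E; rewrite /ind_eval => /eqP; rewrite subr_eq => /eqP ->.
by ring.
Qed.

(* Far from 0, w moves upper a into the product of the Borel subgroup with a small
   lower unipotent element, on which f and s take the same values as at 1. *)
Lemma ind_eval_stepfun (f : ind s) : exists n, stepfun n n (ind_eval f).
Proof.
have /ind_predP[_ [K oK fK]] := indP f; have [K' oK' sK] := schar_smooth s.
have [nu hu] := open_subgroup_upper oK.
have [nl hl] := open_subgroup_lower (open_subgroupI oK oK').
have [ne he] := ball_ex (- (Nm eps)^-1).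
exists (maxn nu (nl + ne)); split=> [a b hb|a ha].
  rewrite /ind_eval upperD (mulgA weyl) (fK _ (upper b)) //.
  by apply: hu; apply: ball_le hb; rewrite lez_nat leq_maxl.
have a0 : a != 0 by apply: contraNneq ha => ->; exact: ball0.
have hb : ball nl%:Z (inv_upper a).
  rewrite /inv_upper invfM -mulrN (_ : nl%:Z = (nl + ne)%N%:Z + - ne%:Z); last by lia.
  apply: ballM => //; apply: ball_le (ballV ha).
  by rewrite lez_nat leq_maxr.
have [Kl K'l] := hl _ hb.
have x0 : - (a *: eps)^-1 != 0 by rewrite oppr_eq0 invr_eq0 scale_traceless_neq0.
rewrite /ind_eval; have := congr1 s (weyl_upper a0).
rewrite scharM schar_upper mulr1 scharM (sK _ K'l) mulr1 scharM schar_upper mul1r => ->.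
rewrite weyl_upper // -mulgA ind_upper_mul ind_tor_mul // -[lower _]mul1g fK //.
by rewrite mulrC subrr.
Qed.

Lemma St_eval_stepfun x : exists n, stepfun n n (St_eval x).
Proof. by elim/St_classW: x => f; rewrite St_eval_class; exact: ind_eval_stepfun. Qed.

Lemma cell_fun_ind : cell_fun (fun x => s (tor x)) \in ind_pred s.
Proof.
pose tau (x : L) := s (tor x).
have tauM x y : x != 0 -> y != 0 -> tau (x * y) = tau x * tau y.
  by move=> x0 y0; rewrite /tau torM // scharM.
apply/ind_predP; split=> [t u g /torus_tor[x x0 ->] /unipotent_upper[b ->]|].
  by rewrite (cell_fun_borel_mul tauM) // [tau _]schar_weyl_tor.
apply: cell_fun_smooth => //; have [K oK sK] := schar_smooth s.
by have [m mK] := open_subgroup_tor oK; exists m.+1 => x /mK/sK.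
Qed.

Definition St_cell : ind s := Ind cell_fun_ind.

Lemma St_eval_cell : St_eval (St_class hp St_cell) = ball_indic R 0 0.
Proof.
rewrite St_eval_class; apply/funext => a; rewrite /ind_eval /= /ball_indic subr0.
rewrite cell_fun_weyl_upper ?tor1 ?schar1 // cell_fun_borel ?bot_left1 //.
by rewrite mul0r subr0.
Qed.

Definition St_eval_lin : {linear St -> (Qp -> R^o)} :=
  HB.pack St_eval (GRing.isLinear.Build _ _ _ _ St_eval St_eval_linear).

Definition St_model : cellModel St s :=
  @CellModel R St s St_eval_lin St_eval_inj St_eval_upper St_eval_tor St_eval_stepfun
    (St_class hp St_cell) St_eval_cell.

End SteinbergModel.

Section TwistedModel.
Variables (R : comNzRingType) (V : srep G R) (chi : schar G R).
Variable M : cellModel V (triv_char G R).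

Definition twist_eval (x : twist_rep chi V) : Qp -> R^o := chi weyl *: M x.

Lemma twist_eval_linear : linear twist_eval.
Proof. by move=> r x y; rewrite /twist_eval linearP scalerDr !scalerA mulrC. Qed.

Lemma twist_eval_inj : injective twist_eval.
Proof.
move=> x y /(congr1 ( *:%R (chi weyl))).
by rewrite /twist_eval !scalerA schar_weylK !scale1r; exact: cm_inj.
Qed.

Lemma twist_eval_act g (x : V) a :
  twist_eval (@srep_act G R (twist_rep chi V) g x) a =
  chi g * (chi weyl * M (srep_act g x) a).
Proof. by rewrite /twist_eval /= linearZ_LR -![LHS]/(_ * (_ * _)) mulrCA. Qed.

Lemma twist_eval_upper b (x : twist_rep chi V) a :
  twist_eval (srep_act (upper b) x) a = twist_eval x (a + b).
Proof. by rewrite twist_eval_act schar_upper mul1r cm_upper. Qed.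

Lemma twist_eval_tor y (x : twist_rep chi V) a : y != 0 ->
  twist_eval (srep_act (tor y) x) a = chi (tor y) * twist_eval x ((Nm y)^-1 * a).
Proof. by move=> y0; rewrite twist_eval_act cm_tor //= mul1r. Qed.

Lemma twist_eval_stepfun x : exists n, stepfun n n (twist_eval x).
Proof.
have [n [hper hsupp]] := cm_stepfun M x; exists n; split=> [a b hb|a ha].
  by rewrite -[LHS]/(_ * M x _) -[RHS]/(_ * M x _) hper.
by rewrite -[LHS]/(_ * M x _) hsupp // mulr0.
Qed.

Lemma twist_eval_base :
  twist_eval (chi weyl *: (cm_base M : twist_rep chi V)) = ball_indic R 0 0.
Proof. by rewrite /twist_eval linearZ_LR scalerA schar_weylK scale1r cm_baseE. Qed.

Definition twist_eval_lin : {linear twist_rep chi V -> (Qp -> R^o)} :=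
  HB.pack twist_eval (GRing.isLinear.Build _ _ _ _ twist_eval twist_eval_linear).

Definition twist_model : cellModel (twist_rep chi V) chi :=
  @CellModel R (twist_rep chi V) chi twist_eval_lin twist_eval_inj twist_eval_upper
    twist_eval_tor twist_eval_stepfun _ twist_eval_base.

End TwistedModel.

Variables (O : comNzRingType) (k : fieldType) (res : {rmorphism O -> k}).
Hypothesis res_surj : forall y, exists x, res x = y.

Section SteinbergLift.
Variables (chi : schar G k).
Local Notation St0_model := (twist_model chi (St_model (triv_char G k))).

Lemma St_map_eval (A : artAlg res) (s : char_lift chi A) x a :
  St0_model (St_map hp s x) a = art_res A (St_model s x a).
Proof.
elim/(St_classW (s := s)): x => f; rewrite St_map_class.
rewrite -[LHS]/(_ * St_eval _ a) -[St_model s _]/(St_eval _) !St_eval_class.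
rewrite /ind_eval /= invg1 schar1 invgM weylV scharM upperV schar_upper.
rewrite rmorphB !rmorphM char_lift_res !mulr1 !mul1r mulrBr.
by rewrite mulrA schar_weylK mul1r mulrC.
Qed.

Lemma St_map_is_lift (A : artAlg res) (s : char_lift chi A) : is_lift (St_map hp s).
Proof.
apply: (cell_model_is_lift res_surj (M := St_model s) (M0 := St0_model)).
  exact: St_map_act.
exact: St_map_eval.
Qed.

Section PushForward.
Variables (A A' : artAlg res) (h : artHom A A') (s : char_lift chi A).
Local Notation s' := (push_char res_surj h s).

Fact ind_push_subproof (f : ind s) : (fun g => h (f g)) \in ind_pred s'.
Proof.
case: f => f /= /ind_predP[fB [K oK fK]]; apply/ind_predP; split.
  by move=> t u g tt uu; rewrite fB // rmorphM.
by exists K => // g g' /fK ->.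
Qed.
Definition ind_push (f : ind s) : ind s' := Ind (ind_push_subproof f).

Definition St_push (x : St_rep hp s) : St_rep hp s' := St_class hp (ind_push (mrepr x)).

Lemma St_push_eval x a : St_model s' (St_push x) a = h (St_model s x a).
Proof.
rewrite -[LHS]/(St_eval _ a) St_eval_class /ind_eval /= -rmorphM -rmorphB.
by [].
Qed.

Lemma St_push_class f : St_push (St_class hp f) = St_class hp (ind_push f).
Proof.
apply: (cellm_ext (M := St_model s')) => a; rewrite St_push_eval.
rewrite -[RHS]/(St_eval _ a) -[St_model s _]/(St_eval _) !St_eval_class.
by rewrite /ind_eval /= rmorphB rmorphM.
Qed.

Lemma St_push_act g x : St_push (srep_act g x) = srep_act g (St_push x).
Proof.
elim/St_classW: x => f; rewrite St_class_act !St_push_class St_class_act.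
by congr St_class; apply: val_inj.
Qed.

Lemma bc_St_iso (H : is_lift (St_map hp s)) (H' : is_lift (St_map hp s')) :
  lift_iso (bc_lift res_surj h (Lift H)) (Lift H').
Proof.
apply: (bc_lift_semilinear_iso res_surj (l := Lift H) (l' := Lift H') (f := St_push)).
- move=> u v; apply: (cellm_ext (M := St_model s')) => a.
  by rewrite cellmD !St_push_eval cellmD rmorphD.
- move=> r v; apply: (cellm_ext (M := St_model s')) => a.
  by rewrite cellmZ !St_push_eval cellmZ rmorphM.
- exact: St_push_act.
- move=> v /=; apply: (cellm_ext (M := St0_model)) => a.
  by rewrite !St_map_eval St_push_eval art_hom_res.
Qed.

End PushForward.

End SteinbergLift.

(** * Ordinary vectors *)

Section OrdinaryVectors.
Variables (pi0 : srep G k) (chi : schar G k) (M0 : cellModel pi0 chi).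
Variables (A : artAlg res) (V : srep G A) (phi : V -> pi0).
Hypothesis L0 : is_lift phi.
Local Notation rA := (art_res A).
Local Notation base := (cm_base M0).
Local Notation mulV J := (ideal_smul J [set: V]).
Local Notation hecke := (hecke_op (@srep_act G A V)).
Local Notation hecke0 := (hecke_op (@srep_act G k pi0)).
Local Notation upper_fixed := (upper_fixed (@srep_act G A V)).

Lemma phi_hecke x : phi (hecke x) = hecke0 (phi x).
Proof.
rewrite (morphD_sum (lift_add L0)); apply: eq_bigr => i _.
by rewrite !(lift_equiv L0).
Qed.

Lemma phi_hecke_iter n x : phi (iter n hecke x) = iter n hecke0 (phi x).
Proof. by elim: n => [|n IHn] //=; rewrite phi_hecke IHn. Qed.

Lemma ideal_smul_act (J : set A) g x : mulV J x -> mulV J (srep_act g x).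
Proof. exact: (ideal_smul_linear (@srep_act G A V g)). Qed.

Lemma ideal_smul_hecke_iter (J : set A) n x : mulV J x -> mulV J (iter n hecke x).
Proof.
move=> Jx; elim: n => [|n IHn] //=; apply: lspan_sum => i _ _.
by do 2!apply: ideal_smul_act.
Qed.

Lemma ideal_smul_maxid x : phi x = 0 -> mulV (maxid A) x.
Proof. exact: lift_ker. Qed.

Section FixedStep.
Variables (I J : set A) (a : A) (IJ : simple_step I J a) (x : V).
Hypothesis Ix : forall b, ball 0 b -> mulV I (srep_act (upper b) x - x).

(* The obstruction to fixing x modulo J is a cocycle of U_0 in pi0. *)
Lemma fixed_obstruction : exists y : Qp -> V,
  (forall b, ball 0 b -> mulV J (srep_act (upper b) x - x - a *: y b)) /\
  exists y0 : pi0, forall b, ball 0 b -> srep_act (upper b) y0 - y0 = phi (y b).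
Proof.
have [y Jy] : exists y : Qp -> V, forall b, ball 0 b ->
    mulV J (srep_act (upper b) x - x - a *: y b).
  have ex b : exists y, ball 0 b -> mulV J (srep_act (upper b) x - x - a *: y).
    have [hb|] := boolP (ball 0 b); last by exists 0.
    by have [y hy] := ideal_smul_step IJ (Ix hb); exists y.
  by have [y hy] := choice ex; exists y.
exists y; split=> //.
have [m mx] : exists m : nat, forall b, ball m%:Z b -> srep_act (upper b) x = x.
  have [K oK Kx] := srep_smooth x; have [m mK] := open_subgroup_upper oK.
  by exists m => b /mK/Kx.
apply: (cocycle_split M0 (n := m)) => [b b' hb hb'|b hb].
  rewrite -(lift_equiv L0) -(lift_add L0); apply/(ideal_smul_step_eqP res_surj L0 IJ).
  have Jact := ideal_smul_act (upper b) (Jy _ hb').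
  have := lspanB (lspanD (Jy _ hb) Jact) (Jy _ (ballD hb hb')).
  rewrite !srep_actB srep_actZ act_upperD scalerDr.
  move: (srep_act (upper b) (srep_act _ x)) (srep_act (upper b) x) => u v.
  rewrite addrACA [v - x + _]addrC subrKA -opprD opprB [_ + (_ - _)]addrC addrA subrK.
  by [].
rewrite -(morphD0 (lift_add L0)); apply/(ideal_smul_step_eqP res_surj L0 IJ).
have hb0 : ball 0 b by apply: ball_le hb.
have := lspanZ (-1) (Jy _ hb0); rewrite mx // subrr sub0r scaleN1r opprK.
by rewrite scaler0 subr0.
Qed.

Lemma fixed_step : exists y, forall b, ball 0 b ->
  mulV J (srep_act (upper b) (x - a *: y) - (x - a *: y)).
Proof.
have [y [Jy [y0 y0E]]] := fixed_obstruction; have [z zE] := lift_surj L0 y0.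
exists z => b hb; rewrite srep_actB srep_actZ.
have Jcob : mulV J (a *: y b - a *: (srep_act (upper b) z - z)).
  apply/(ideal_smul_step_eqP res_surj L0 IJ).
  by rewrite (morphDB (lift_add L0)) (lift_equiv L0) zE y0E.
have := lspanD (Jy _ hb) Jcob; rewrite scalerBr addrA subrK.
by rewrite !opprD !opprK addrACA.
Qed.

End FixedStep.

Lemma fixed_lift : exists2 x : V, phi x = base & upper_fixed x.
Proof.
suff [x [xb x0]] : exists x : V, phi x = base /\
    forall b, ball 0 b -> mulV [set 0] (srep_act (upper b) x - x).
  by exists x => // b /x0/ideal_smul_set0/eqP; rewrite subr_eq0 => /eqP.
apply: (artinian_ind res_surj (P := fun I => exists x : V, phi x = base /\
    forall b, ball 0 b -> mulV I (srep_act (upper b) x - x)) (maxid_ideal A)).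
  have [x xb] := lift_surj L0 base; exists x; split=> // b hb; apply: ideal_smul_maxid.
  by rewrite (morphDB (lift_add L0)) (lift_equiv L0) xb (base_fixed M0) // subrr.
move=> I J a Im IJ [x [xb Ix]]; have [y Jy] := fixed_step IJ Ix.
exists (x - a *: y); split=> //; have a0 : rA a = 0 := Im _ (step_mem IJ).
by rewrite (morphDB (lift_add L0)) (lift_scale L0) a0 scale0r subr0.
Qed.

Record ordinary_mod (I : set A) (v : V) (lam : A) : Prop := OrdinaryMod {
  ord_base : phi v = base;
  ord_fixed : upper_fixed v;
  ord_mod : mulV I (hecke v - lam *: v);
  ord_eigen : rA lam = chi (tor p%:R)
}.

Lemma ordinary_unit I v lam : ordinary_mod I v lam -> exists lam', lam * lam' = 1.
Proof. by move=> ov; apply: (art_unit res_surj); rewrite (ord_eigen ov) schar_neq0. Qed.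

(* If the error term of v is a y modulo J, then lam^-n hecke^n v is again a lift of
   the base vector, and its error term is a multiple of itself for large n. *)
Lemma ordinary_step (I J : set A) (a : A) v lam : simple_step I J a -> rA a = 0 ->
  ordinary_mod I v lam -> exists v' lam', ordinary_mod J v' lam'.
Proof.
move=> IJ a0 ov; have [vb fv Iv lam_chi] := ov; have [y Jy] := ideal_smul_step IJ Iv.
have fy b : ball 0 b -> srep_act (upper b) (phi y) = phi y.
  move=> hb; rewrite -(lift_equiv L0); apply/(ideal_smul_step_eqP res_surj L0 IJ).
  have := lspanB Jy (ideal_smul_act (upper b) Jy).
  rewrite !srep_actB !srep_actZ (hecke_fixed fv) // fv //.
  by move: (hecke v - lam *: v) => x; rewrite opprB addrC addrA subrK.
have [n [mu En]] :=
  hecke_upper_span (base_fixed M0) (base_hecke M0) (fixed_upper_span (M := M0) fy).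
have [mu0 mu0E] := art_res_surj res_surj A mu; have [lam' ll] := ordinary_unit ov.
pose v' := lam' ^+ n *: iter n hecke v; pose d := lam' ^+ n * a.
have v'b : phi v' = base.
  rewrite (lift_scale L0) phi_hecke_iter vb (hecke_iter_eigen n (base_hecke M0)).
  by rewrite -lam_chi scalerA -!rmorphXn -rmorphM -exprMn mulrC ll expr1n rmorph1 scale1r.
exists v', (lam + d * mu0); split=> //.
- by move=> b hb; rewrite srep_actZ (hecke_iter_fixed n fv).
- have Jhecke : mulV J (hecke v' - lam *: v' - d *: iter n hecke y).
    have := lspanZ (lam' ^+ n) (ideal_smul_hecke_iter n Jy).
    rewrite -!(scaleN1r (_ *: _)) !hecke_iterD !hecke_iterZ -iterSr iterS.
    rewrite !scalerDr /v' heckeZ !scalerA.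
    by congr (mulV J (_ + _ + _)); congr (_ *: _); rewrite /d; ring.
  have Jerr : mulV J (lam' ^+ n *: (a *: iter n hecke y - a *: (mu0 *: v'))).
    apply: lspanZ; apply/(ideal_smul_step_eqP res_surj L0 IJ).
    by rewrite (lift_scale L0) phi_hecke_iter En v'b mu0E.
  clearbody v'; have := lspanD Jhecke Jerr; rewrite scalerBr !scalerA -/d addrA subrK.
  by rewrite /d -mulrA scalerDl opprD addrA.
- by rewrite rmorphD !rmorphM a0 mulr0 mul0r addr0.
Qed.

Definition ordinary (v : V) (lam : A) : Prop := ordinary_mod [set 0] v lam.

Lemma ordinary_ex : exists v lam, ordinary v lam.
Proof.
apply: (artinian_ind res_surj (P := fun I => exists v lam, ordinary_mod I v lam)
  (maxid_ideal A)).
  have [v vb fv] := fixed_lift.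
  have [lam lam_chi] := art_res_surj res_surj A (chi (tor p%:R)); exists v, lam.
  split=> //; apply: ideal_smul_maxid.
  rewrite (morphDB (lift_add L0)) (lift_scale L0) phi_hecke vb (base_hecke M0).
  by rewrite lam_chi subrr.
move=> I J a Im IJ [v [lam ov]]; apply: ordinary_step ov; first exact: IJ.
exact: Im _ (step_mem IJ).
Qed.

Section Ordinary.
Variables (v : V) (lam : A).
Hypothesis ov : ordinary v lam.
Local Notation translate n r := (srep_act (upper r) (srep_act (tor (p%:R ^+ n)) v)).

Lemma ordinary_hecke : hecke v = lam *: v.
Proof.
apply/eqP; rewrite -subr_eq0; apply/eqP.
exact: ideal_smul_set0 (ord_mod ov).
Qed.

Lemma phi_translate n r :
  phi (translate n r) = srep_act (upper r) (srep_act (tor (p%:R ^+ n)) base).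
Proof. by rewrite !(lift_equiv L0) (ord_base ov). Qed.

Lemma ordinary_translate_span x :
  lspan (range (fun nr : nat * Qp => translate nr.1 nr.2)) x.
Proof.
apply: (lift_fixed_span res_surj L0 (H := set0)) => // y _.
apply: (lspan_image (h := id) (f := id)) (translate_span (M := M0) y) => //.
move=> _ [nr _ <-]; apply: mem_lspan; exists (translate nr.1 nr.2); first by exists nr.
exact: phi_translate.
Qed.

Lemma ordinary_translate_indep n :
  lin_indep (fun i : 'I_(q ^ (n + n)) => translate n (- grid n i)).
Proof.
apply: (lift_lin_indep res_surj L0); apply: lin_indep_fin => b b0 j.
have [j' hj'] := grid_partition n (ball_grid n j).
have jj' : j = j' by apply/eqP; rewrite -hj' subrr ball0.
have := congr1 (fun x => M0 x (grid n j)) b0; rewrite /= cellm_sum cellm0.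
under eq_bigr do rewrite cellmZ phi_translate (translate_eval M0) /= mulrA.
rewrite (big_ord_pred1 _ hj') -jj' => /eqP; rewrite mulf_eq0 (negbTE (schar_neq0 _ _)).
by rewrite orbF => /eqP.
Qed.

Lemma ordinary_inj : injective (fun d : A => d *: v).
Proof.
apply: (lift_scale_inj res_surj L0); rewrite (ord_base ov); apply/eqP => base0.
have := base_eval M0 0; rewrite base0 cellm0 ball0 => /esym/eqP.
by rewrite oner_eq0.
Qed.

Lemma fixed_ordinary_span x : upper_fixed x -> upper_span v x.
Proof.
move=> fx; apply: (lift_fixed_span res_surj L0
    (H := [set upper b | b in [set b | ball 0 b]]))
  => [_ _ [b hb <-] [r _ <-]|y fy|_ [b hb <-]].
- by rewrite -act_upperD addrC act_upperD (ord_fixed ov hb).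
- have fy' b : ball 0 b -> srep_act (upper b) y = y by move=> hb; apply: fy; exists b.
  apply: (lspan_image (h := id) (f := id)) (fixed_upper_span (M := M0) fy') => //.
  move=> _ [r _ <-]; apply: mem_lspan; exists (srep_act (upper r) v); first by exists r.
  by rewrite (lift_equiv L0) (ord_base ov).
- exact: fx.
Qed.

Lemma ordinary_unique x mu : upper_fixed x -> hecke x = mu *: x -> rA mu != 0 ->
  exists d, x = d *: v.
Proof.
move=> fx hx /(art_unit res_surj)[mu' mm].
exact: ordinary_line (ord_fixed ov) ordinary_hecke (fixed_ordinary_span fx) hx mm.
Qed.

Lemma ordinary_tor_unit y : N (Nm y) = 1 -> exists d, srep_act (tor y) v = d *: v.
Proof.
move=> y1; have fv := ord_fixed ov; apply: (@ordinary_unique _ lam).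
- exact: upper_fixed_tor.
- by rewrite hecke_tor // ordinary_hecke srep_actZ.
- by rewrite (ord_eigen ov) schar_neq0.
Qed.

End Ordinary.

Lemma ordinary_proportional v v' lam lam' : ordinary v lam -> ordinary v' lam' ->
  exists2 d, v' = d *: v & rA d = 1.
Proof.
move=> ov ov'.
have [|d v'E] := ordinary_unique ov (ord_fixed ov') (ordinary_hecke ov').
  by rewrite (ord_eigen ov') schar_neq0.
exists d => //; have := ord_base ov'; rewrite v'E (lift_scale L0) (ord_base ov).
by move=> /(congr1 (fun x => M0 x 0)); rewrite cellmZ base_eval ball0 mulr1.
Qed.

Lemma ordinary_eigenvalue_unique (f : V -> V) v v' lam lam' a b :
  (forall r x, f (r *: x) = r *: f x) -> ordinary v lam -> ordinary v' lam' ->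
  f v = a *: v -> f v' = b *: v' -> a = b.
Proof.
move=> fZ ov ov' fv fv'; have [d v'E d1] := ordinary_proportional ov ov'.
have [d' dd] : exists d', d * d' = 1 by apply: (art_unit res_surj); rewrite d1 oner_eq0.
have : d * a = d * b.
  by apply: (ordinary_inj ov); rewrite -scalerA -fv -fZ -v'E fv' v'E scalerA mulrC.
by move=> /(congr1 ( *%R d')); rewrite !mulrA (mulrC d') dd !mul1r.
Qed.

End OrdinaryVectors.

Lemma ordinary_morphism (pi0 : srep G k) (chi : schar G k) (M0 : cellModel pi0 chi)
    (A : artAlg res) (V V' : srep G A) (phi : V -> pi0) (phi' : V' -> pi0)
    (psi : V -> V') v lam :
  linear psi -> (forall g x, psi (srep_act g x) = srep_act g (psi x)) ->
  (forall x, phi' (psi x) = phi x) ->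
  ordinary M0 phi v lam -> ordinary M0 phi' (psi v) lam.
Proof.
move=> psi_lin psi_act psi_phi ov; split; last exact: ord_eigen ov.
- by rewrite psi_phi (ord_base ov).
- by move=> b hb; rewrite -psi_act (ord_fixed ov).
- have -> : hecke_op (@srep_act G A V') (psi v) = psi (hecke_op (@srep_act G A V) v).
    rewrite (morphD_sum (linearD_unbundled psi_lin)); apply: eq_bigr => i _.
    by rewrite !psi_act.
  by rewrite (ordinary_hecke ov) (scalable_linear psi_lin) subrr; exact: lspan0.
Qed.

(** * The orbit of an ordinary vector *)

Hypothesis unr : unramified L.

Section OrdinarySpan.
Variables (R : comNzRingType) (W : lmodType R) (act : G -> W -> W).
Hypothesis act_linear : forall g, linear (act g).
Hypothesis act1 : forall x, act 1%g x = x.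
Hypothesis actM : forall g h x, act (g * h)%g x = act g (act h x).
Variables (E : W) (lam lam' : R).
Hypothesis lamV : lam * lam' = 1.
Hypothesis E_upper : upper_fixed act E.
Hypothesis E_hecke : hecke_op act E = lam *: E.
Hypothesis E_tor : forall y, N (Nm y) = 1 -> exists d, act (tor y) E = d *: E.
Hypothesis E_lower : exists m : nat, forall a, ball m%:Z a -> act (lower a) E = E.

Let actD g : {morph act g : x y / x + y}.
Proof. exact: linearD_unbundled. Qed.
Let actZ g r x : act g (r *: x) = r *: act g x.
Proof. exact: (scalable_linear (act_linear g)). Qed.
Let act_sum g (I : Type) (s : seq I) (F : I -> W) :
  act g (\sum_(i <- s) F i) = \sum_(i <- s) act g (F i).
Proof. exact: (morphD_sum (actD g)). Qed.

Local Notation torp n := (tor (p%:R ^+ n)).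

Definition borel_span : set W := lspan [set act g E | g in [set g | bot_left g = 0]].

Lemma mem_borel_span g : bot_left g = 0 -> borel_span (act g E).
Proof. by move=> g0; apply: mem_lspan; exists g. Qed.

Lemma borel_span_base : borel_span E.
Proof.
by rewrite -[X in borel_span X](act1 E); apply: mem_borel_span; exact: bot_left1.
Qed.

Lemma borel_span_act g x : bot_left g = 0 -> borel_span x -> borel_span (act g x).
Proof.
move=> g0; apply: (lspan_image (h := id) (actD g) (actZ g)) => _ [h h0 <-].
by rewrite -actM; apply: mem_borel_span; rewrite bot_left_borelM.
Qed.

Lemma tor_refine y : y != 0 -> act (tor y) E =
  lam' *: \sum_(j < q) act (upper (Nm y * j%:R)) (act (tor (y * p%:R)) E).
Proof.
move=> y0; have -> : act (tor y) E = lam' *: act (tor y) (lam *: E).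
  by rewrite actZ scalerA mulrC lamV scale1r.
rewrite -E_hecke act_sum; congr (_ *: _); apply: eq_bigr => j _.
by rewrite -!actM tor_upper // torM ?p_neq0 // mulgA.
Qed.

Lemma torp_refine n : act (torp n) E =
  lam' *: \sum_(j < q) act (upper (q%:R ^+ n * j%:R)) (act (torp n.+1) E).
Proof.
by rewrite tor_refine ?pX_neq0 // -exprSr; under eq_bigr do rewrite Nm_pX.
Qed.

(* The points close to r stay away from 0, so that w moves them into a bounded
   region where the lower unipotent part acts trivially on a small ball. *)
Lemma weyl_upper_borel_span_deep n r : ~~ ball n%:Z r -> exists M, forall m r',
  (M <= m)%N -> ball n%:Z (r' - r) ->
  borel_span (act (weyl * upper r')%g (act (torp m) E)).
Proof.
move=> rn; have [m hm] := E_lower; have [d hd] := ball_ex (inv_upper r).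
exists (m + d)%N => m' r' mm' hr.
have Nr : N r' = N r.
  rewrite -(subrKC r r') padic_normD_eq //.
  by move: rn; rewrite /ball -ltNge; exact: le_lt_trans hr.
have r0 : r != 0 by apply: contraNneq rn => ->; exact: ball0.
have r'0 : r' != 0 by rewrite -padic_norm_eq0 Nr padic_norm_eq0.
have hd' : ball (- d%:Z) (inv_upper r').
  by move: hd; rewrite /ball /inv_upper !padic_normN !padic_normV !padic_normM Nr.
have x0 : - (r' *: eps)^-1 != 0 by rewrite oppr_eq0 invr_eq0 scale_traceless_neq0.
rewrite (weyl_upper r'0) (actM _ (lower _)) -(actM (lower _)) lower_tor ?pX_neq0 //.
rewrite (actM (torp m')) hm.
  apply: borel_span_act; first by rewrite bot_left_borelM ?bot_left_upper ?bot_left_tor.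
  by apply: mem_borel_span; rewrite bot_left_tor ?pX_neq0.
by rewrite Nm_pX ballMqX; apply: ball_le hd'; lia.
Qed.

Lemma weyl_upper_borel_span n r : ~~ ball n%:Z r ->
  borel_span (act (weyl * upper r)%g (act (torp n) E)).
Proof.
move=> rn; have [M hM] := weyl_upper_borel_span_deep rn.
suff H d m r' : (M <= m + d)%N -> (n <= m)%N -> ball n%:Z (r' - r) ->
    borel_span (act (weyl * upper r')%g (act (torp m) E)).
  by apply: (H M) => //; rewrite ?leq_addl // subrr ball0.
elim: d m r' => [|d IHd] m r' Mm nm hr; first by apply: hM => //; rewrite addn0 in Mm.
rewrite torp_refine actZ act_sum; apply: lspanZ; apply: lspan_sum => j _ _.
rewrite -actM -mulgA -upperD; apply: IHd; first by rewrite addSnnS.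
  exact: leq_trans nm (leqnSn m).
rewrite addrAC ballDr // ballMqX; apply: ball_le (ball_natr j); lia.
Qed.

Lemma weyl_torp_step n :
  borel_span (act (weyl * torp n)%g E - lam' *: act (weyl * torp n.+1)%g E).
Proof.
rewrite actM torp_refine actZ act_sum (bigD1 (Ordinal q_gt0)) //= mulr0 upper0 act1.
rewrite -actM scalerDr addrC addKr; apply: lspanZ; apply: lspan_sum => j _ j0.
rewrite -actM; apply: weyl_upper_borel_span; rewrite ballMqX.
have -> : n.+1%:Z - n%:Z = 1%N%:Z by lia.
apply: contra j0 => hj; apply/eqP/val_inj => /=.
by apply: (@ball_natrB_inj 1 _ _ (ltn_ord j)); rewrite ?subr0 ?q_gt0.
Qed.

Lemma weyl_torp n : borel_span (act weyl E - lam' ^+ n *: act (weyl * torp n)%g E).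
Proof.
elim: n => [|n IHn]; first by rewrite !expr0 tor1 mulg1 scale1r subrr; exact: lspan0.
have := lspanD IHn (lspanZ (lam' ^+ n) (weyl_torp_step n)).
by rewrite scalerBr scalerA -exprSr addrA subrK.
Qed.

Definition normal_form : set W := [set x | exists d, borel_span (x - d *: act weyl E)].

Lemma normal_form_submodule : submodule normal_form.
Proof.
split=> [|x y [d hx] [d' hy]|r x [d hx]].
- by exists 0; rewrite scale0r subr0; exact: lspan0.
- by exists (d + d'); rewrite scalerDl opprD addrACA; exact: lspanD.
- by exists (r * d); rewrite -scalerA -scalerBr; exact: lspanZ.
Qed.

Lemma borel_span_normal_form x : borel_span x -> normal_form x.
Proof. by exists 0; rewrite scale0r subr0. Qed.

Lemma weyl_normal_form : normal_form (act weyl E).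
Proof. by exists 1; rewrite scale1r subrr; exact: lspan0. Qed.

Let normal_formD x y : normal_form x -> normal_form y -> normal_form (x + y).
Proof. by case: normal_form_submodule => _ + _; apply. Qed.

Let normal_formZ r x : normal_form x -> normal_form (r *: x).
Proof. by case: normal_form_submodule => _ _; apply. Qed.

Definition preserves_normal_form g := forall x, normal_form x -> normal_form (act g x).

Lemma preserves_normal_formM g h :
  preserves_normal_form g -> preserves_normal_form h -> preserves_normal_form (g * h)%g.
Proof. by move=> gP hP x /hP/gP; rewrite -actM. Qed.

Lemma preserves_normal_form_borel g : bot_left g = 0 ->
  normal_form (act (g * weyl)%g E) -> preserves_normal_form g.
Proof.
move=> g0 gw x [d hx]; rewrite -(subrK (d *: act weyl E) x) actD actZ -actM.
apply: normal_formD; last exact: normal_formZ.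
by apply: borel_span_normal_form; exact: borel_span_act.
Qed.

Lemma upper_preserves_normal_form b : preserves_normal_form (upper b).
Proof.
apply: preserves_normal_form_borel; first exact: bot_left_upper.
have [m hm] := E_lower; have [n hn] := ball_ex b; set M := (m + n)%N.
have fixM : act (upper b) (act (weyl * torp M)%g E) = act (weyl * torp M)%g E.
  have -> : act (upper b) (act (weyl * torp M)%g E) =
      act (weyl * torp M * lower (Nm (p%:R ^+ M) * b))%g E.
    rewrite -actM -(mulgA weyl) -lower_tor ?pX_neq0 // /lower.
    by rewrite !mulgA weylK mul1g.
  by rewrite actM hm // Nm_pX ballMqX; apply: ball_le hn; rewrite /M; lia.
exists 1; rewrite scale1r actM.
have := lspanB (borel_span_act (bot_left_upper b) (weyl_torp M)) (weyl_torp M).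
by rewrite (morphDB (actD _)) actZ fixM opprB addrA subrK.
Qed.

Lemma weyl_tor1_borel_span : borel_span (act weyl E - lam' *: act (weyl * tor p%:R)%g E).
Proof. by have := weyl_torp_step 0; rewrite expr0 tor1 mulg1 expr1. Qed.

Lemma torp_preserves_normal_form : preserves_normal_form (tor p%:R).
Proof.
apply: preserves_normal_form_borel; first by rewrite bot_left_tor ?p_neq0.
exists lam'; have := borel_span_act (bot_left_tor p_neq0) weyl_tor1_borel_span.
rewrite (morphDB (actD _)) actZ -!actM [(tor _ * (_ * _))%g]mulgA tor_weyl ?p_neq0 //.
rewrite -alg_nat conj_alg -mulgA -torM ?alg_nat ?invr_eq0 ?p_neq0 //.
by rewrite mulVf ?p_neq0 // tor1 mulg1.
Qed.

Lemma torpV_preserves_normal_form : preserves_normal_form (tor p%:R^-1).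
Proof.
have pV0 : (p%:R^-1 : L) != 0 by rewrite invr_eq0 p_neq0.
apply: preserves_normal_form_borel; first by rewrite bot_left_tor.
rewrite tor_weyl // conjV invrK -alg_nat conj_alg alg_nat; exists lam.
have := lspanZ (- lam) weyl_tor1_borel_span.
by rewrite scalerBr scalerA mulNr lamV !scaleNr scale1r opprK addrC.
Qed.

Lemma tor_unit_preserves_normal_form z : N (Nm z) = 1 -> preserves_normal_form (tor z).
Proof.
move=> z1; have z0 := Nm_norm1_neq0 z1.
apply: preserves_normal_form_borel; first by rewrite bot_left_tor.
have [d hd] := E_tor (Nm_norm1_conjV z1); rewrite tor_weyl // actM hd actZ.
apply: normal_formZ; exact: weyl_normal_form.
Qed.

Lemma tor_preserves_normal_form y : y != 0 -> preserves_normal_form (tor y).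
Proof.
move=> y0; have [i [z [z1 ->]]] := unramified_decomp unr y0.
have z0 := Nm_norm1_neq0 z1; rewrite torM ?pXz_neq0 //.
apply: preserves_normal_formM (tor_unit_preserves_normal_form z1).
have powP x n : x != 0 ->
    preserves_normal_form (tor x) -> preserves_normal_form (tor (x ^+ n)).
  move=> x0 xP; elim: n => [|n IHn]; first by rewrite expr0 tor1 => u; rewrite act1.
  by rewrite exprS torM ?expf_neq0 //; exact: preserves_normal_formM.
case: i => n; first exact: powP p_neq0 torp_preserves_normal_form.
rewrite NegzE -exprnN -exprVn; apply: powP torpV_preserves_normal_form.
by rewrite invr_eq0 p_neq0.
Qed.

Lemma weyl_preserves_normal_form : preserves_normal_form weyl.
Proof.
move=> x [d hx]; rewrite -(subrK (d *: act weyl E) x) actD actZ.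
apply: normal_formD; last first.
  rewrite -actM weylK act1; apply: normal_formZ; apply: borel_span_normal_form.
  exact: borel_span_base.
apply: (lspan_min (N := act weyl @^-1` normal_form) _ _ hx).
  exact: (submodule_preimage (h := id) (actD _) (actZ _) normal_form_submodule).
move=> _ [g /borel_decomp[y [a [y0 ->]]] <-] /=.
rewrite -actM mulgA weyl_tor // -mulgA actM.
apply: tor_preserves_normal_form; first by rewrite invr_eq0 conj_eq0.
have [ha|ha] := boolP (ball 0 a).
  by rewrite actM E_upper //; exact: weyl_normal_form.
apply: borel_span_normal_form; have := weyl_upper_borel_span (n := 0) ha.
by rewrite expr0 tor1 act1.
Qed.

Lemma all_preserve_normal_form g : preserves_normal_form g.
Proof.
have [g0|g0] := eqVneq (bot_left g) 0.
  have [y [a [y0 ->]]] := borel_decomp g0.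
  apply: preserves_normal_formM (@upper_preserves_normal_form a).
  exact: tor_preserves_normal_form.
have [b ->] := bigcell_decomp g0.
apply: preserves_normal_formM (@upper_preserves_normal_form _).
apply: preserves_normal_formM weyl_preserves_normal_form.
apply: preserves_normal_formM (@upper_preserves_normal_form _).
by apply: tor_preserves_normal_form; rewrite invr_eq0 conj_eq0.
Qed.

Definition orbit_span : set W := lspan (range (fun g => act g E)).

Lemma orbit_span_act g x : orbit_span x -> orbit_span (act g x).
Proof.
apply: (lspan_image (h := id) (actD g) (actZ g)) => _ [h _ <-].
by rewrite -actM; apply: mem_lspan; exists (g * h)%g.
Qed.

Lemma mem_orbit_span g : orbit_span (act g E).
Proof. by apply: mem_lspan; exists g. Qed.

Lemma borel_orbit_span x : borel_span x -> orbit_span x.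
Proof.
move: x; apply: lspan_min; first exact: lspan_submodule.
by move=> _ [g _ <-]; exact: mem_orbit_span.
Qed.

Lemma orbit_span_normal_form x :
  orbit_span x -> exists d, borel_span (x - d *: act weyl E).
Proof.
move: x; apply: lspan_min; first exact: normal_form_submodule.
move=> _ [g _ <-]; apply: all_preserve_normal_form; apply: borel_span_normal_form.
exact: borel_span_base.
Qed.

Definition level_span (n : nat) : set W :=
  lspan (range (fun i : 'I_(q ^ (n + n)) => act (upper (- grid n i)) (act (torp n) E))).

Lemma level_span_torp n r : ball (- n%:Z) r ->
  level_span n (act (upper r) (act (torp n) E)).
Proof.
move=> hr; have [i hi] := grid_partition n (etrans (ballN _ r) hr).
rewrite -(subrKC (- grid n i) r) upperD opprK actM.
rewrite (_ : act (upper (r + _)) _ = act (torp n) E); first by apply: mem_lspan; exists i.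
rewrite -actM upper_tor ?pX_neq0 // actM E_upper //.
by rewrite Nm_pX exprnN ballMqz sub0r opprK -ballN opprD hi.
Qed.

Lemma level_span_tor n d y r : y != 0 -> (d <= n + n)%N ->
  N (Nm y) = q%:R ^ (- (n%:Z - d%:Z)) -> ball (- n%:Z) r ->
  level_span n (act (upper r) (act (tor y) E)).
Proof.
elim: d y r => [|d IHd] y r y0 dn ny hr.
  have z1 : N (Nm (y / p%:R ^+ n)) = 1.
    rewrite (NmM e) (NmV e) Nm_pX padic_normM padic_normV ny padic_normX padic_normq.
    by rewrite exprVn invrK subr0 exprnP -expfzDr ?ratq_neq0 // addNr expr0z.
  have -> : tor y = (torp n * tor (y / p%:R ^+ n))%g.
    by rewrite -torM ?pX_neq0 ?(Nm_norm1_neq0 z1) // mulrC divfK ?pX_neq0.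
  have [d hd] := E_tor z1; rewrite actM hd !actZ; apply: lspanZ.
  exact: level_span_torp.
rewrite tor_refine // actZ act_sum; apply: lspanZ; apply: lspan_sum => j _ _.
rewrite -actM -upperD; apply: IHd; rewrite ?mulf_neq0 ?p_neq0 //.
- exact: ltnW.
- rewrite (NmM e) Nm_p padic_normM ny padic_normq -[X in X^-1]expr1z invr_expz.
  by rewrite -expfzDr ?ratq_neq0 //; congr (_ ^ _); lia.
- rewrite ballD //; have hb : ball (n%:Z - d.+1%:Z) (Nm y) by rewrite /ball ny.
  by apply: ball_le (ballM hb (ball_natr j)); lia.
Qed.

Lemma level_span_borel g : bot_left g = 0 ->
  exists m, forall n, (m <= n)%N -> level_span n (act g E).
Proof.
move=> /borel_decomp[y [a [y0 ->]]].
have [i [z [z1 yE]]] := unramified_decomp unr y0.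
have [m hm] := ball_ex (Nm y * a).
exists (`|i| + m)%N => n hn; rewrite tor_upper // actM.
apply: (@level_span_tor n (absz (n%:Z - i))) => //; first by lia.
  rewrite yE (NmM e) Nm_pXz padic_normM padic_normqz z1 mulr1.
  by congr (_ ^ _); lia.
by apply: ball_le hm; lia.
Qed.

Lemma borel_span_level x : borel_span x -> exists n, level_span n x.
Proof.
move=> hx; suff [n hn] : exists m, forall n, (m <= n)%N -> level_span n x.
  by exists n; exact: hn.
move: x hx; apply: lspan_min; last by move=> _ [g g0 <-]; exact: level_span_borel.
split=> [|x y [m hm] [m' hm']|r x [m hm]].
- by exists 0%N => n _; exact: lspan0.
- by exists (maxn m m') => n; rewrite geq_max => /andP[/hm ? /hm' ?]; exact: lspanD.
- by exists m => n /hm ?; exact: lspanZ.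
Qed.

End OrdinarySpan.

(** * Reconstruction of a character from a lift *)

Section OrdinaryCharacter.
Variables (pi0 : srep G k) (chi : schar G k) (M0 : cellModel pi0 chi).
Variables (A : artAlg res) (V : srep G A) (phi : V -> pi0).
Hypothesis L0 : is_lift phi.
Local Notation rA := (art_res A).
Variables (v : V) (lam lam' : A).
Hypotheses (ov : ordinary M0 phi v lam) (lamV : lam * lam' = 1).

(* Units preserve the line of v; p does not, and takes the Hecke eigenvalue as value. *)
Definition is_tor_value (y : L) (d : A) : Prop := exists (i : int) z d',
  [/\ N (Nm z) = 1, y = p%:R ^ i * z, srep_act (tor z) v = d' *: v &
      d = zpow lam lam' i * d'].

Lemma tor_value_ex y : y != 0 -> exists d, is_tor_value y d.
Proof.
move=> /(unramified_decomp unr)[i [z [z1 yE]]].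
have [d' zv] := ordinary_tor_unit L0 ov z1.
by exists (zpow lam lam' i * d'), i, z, d'.
Qed.

Lemma tor_value_unique y d d' : is_tor_value y d -> is_tor_value y d' -> d = d'.
Proof.
move=> [i [z [s [z1 -> zv ->]]]] [j [z' [s' [z'1 E z'v ->]]]].
have ij : i = j.
  have := congr1 (fun x => N (Nm x)) E.
  rewrite !(NmM e) !Nm_pXz !padic_normM z1 z'1 !mulr1 !padic_normqz.
  by move=> /(ieexprIz (lt_trans ltr01 ratq_gt1) (negbT (gt_eqF ratq_gt1)))/oppr_inj.
rewrite ij in E *; have zz : z = z' := mulfI (pXz_neq0 j) E.
by congr (_ * _); apply: (ordinary_inj L0 ov); rewrite -zv zz.
Qed.

Definition tor_value (y : L) : A := xget 0 [set d | is_tor_value y d].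
Local Notation tau := tor_value.

Lemma tor_valueP y : y != 0 -> is_tor_value y (tau y).
Proof.
by move=> /tor_value_ex y0; apply: (@xgetPex _ 0 [set d | is_tor_value y d]).
Qed.

Lemma tor_valueE y d : is_tor_value y d -> tau y = d.
Proof.
move=> yd; apply: tor_value_unique (yd).
by apply: (@xgetPex _ 0 [set d | is_tor_value y d]); exists d.
Qed.

Lemma tor_value_eigen z d : N (Nm z) = 1 -> srep_act (tor z) v = d *: v -> tau z = d.
Proof.
move=> z1 zv; apply: tor_valueE; exists 0, z, d.
by rewrite expr0z /= !mul1r.
Qed.

Lemma tor_value_unit z : N (Nm z) = 1 -> srep_act (tor z) v = tau z *: v.
Proof.
by move=> z1; have [d zv] := ordinary_tor_unit L0 ov z1; rewrite (tor_value_eigen z1 zv).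
Qed.

Lemma tor_value1 : tau 1 = 1.
Proof.
by apply: tor_value_eigen; rewrite ?Nm1 ?padic_norm1 // tor1 srep_act1 scale1r.
Qed.

Lemma tor_valueM x y : x != 0 -> y != 0 -> tau (x * y) = tau x * tau y.
Proof.
move=> /tor_valueP[i [z [d [z1 xE zv ->]]]] /tor_valueP[j [z' [d' [z'1 yE z'v ->]]]].
apply: tor_valueE; exists (i + j), (z * z'), (d * d'); split.
- by rewrite (NmM e) padic_normM z1 z'1 mulr1.
- by rewrite xE yE mulrACA expfzDr ?p_neq0.
- by rewrite torM ?Nm_norm1_neq0 // srep_actM z'v srep_actZ zv scalerA mulrC.
- by rewrite zpowD // mulrACA.
Qed.

Lemma tor_value_p : tau p%:R = lam.
Proof.
apply: tor_valueE; exists 1, 1, 1; split; rewrite ?Nm1 ?padic_norm1 //.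
- by rewrite mulr1 expr1z.
- by rewrite tor1 srep_act1 scale1r.
- by rewrite mulr1 /= expr1.
Qed.

Lemma tor_value_invertible y : y != 0 -> exists d, tau y * d = 1.
Proof.
move=> y0; exists (tau y^-1); rewrite -tor_valueM ?invr_eq0 // mulfV //.
exact: tor_value1.
Qed.

Lemma tor_value_smooth : exists m, forall x, x - 1 \in pint m -> tau x = 1.
Proof.
have [K oK Kv] := srep_smooth v; have [m mK] := open_subgroup_tor oK.
exists m.+1 => x xm; apply: tor_value_eigen; first exact: pint_sub1_Nm xm.
by rewrite scale1r; apply/Kv/mK.
Qed.

Lemma tor_value_res y : y != 0 -> rA (tau y) = chi (tor y).
Proof.
move=> /tor_valueP[i [z [d [z1 -> zv ->]]]]; have z0 := Nm_norm1_neq0 z1.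
rewrite torM ?pXz_neq0 // scharM rmorphM; congr (_ * _); last first.
  have := congr1 phi zv; rewrite (lift_equiv L0) (lift_scale L0) (ord_base ov).
  rewrite (base_tor M0 z1) => /(congr1 (fun x => M0 x 0)).
  by rewrite !cellmZ base_eval ball0 !mulr1.
have chiX n : chi (tor (p%:R ^+ n)) = rA lam ^+ n.
  elim: n => [|n IHn]; first by rewrite !expr0 tor1 schar1.
  by rewrite !exprS torM ?p_neq0 ?pX_neq0 // scharM IHn (ord_eigen ov).
case: i => n /=; first by rewrite rmorphXn -chiX.
apply: (mulfI (schar_neq0 chi (tor (p%:R ^+ n.+1)))).
rewrite -scharM -torM ?pX_neq0 ?pXz_neq0 // NegzE -exprnN mulfV ?pX_neq0 // tor1 schar1.
by rewrite chiX -!rmorphXn -rmorphM -exprMn lamV expr1n rmorph1.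
Qed.

End OrdinaryCharacter.

Section Graph.
Variables (pi0 : srep G k) (chi : schar G k) (M0 : cellModel pi0 chi).
Variables (A : artAlg res) (V : srep G A) (phi : V -> pi0).
Hypothesis L0 : is_lift phi.
Variables (v : V) (lam lam' : A).
Hypotheses (ov : ordinary M0 phi v lam) (lamV : lam * lam' = 1).
Local Notation tau := (tor_value v lam lam').
Local Notation tau1 := (tor_value1 L0 lam' ov).
Local Notation tauM := (tor_valueM L0 ov lamV).
Local Notation W := ((G -> A^o) * V)%type.

Definition graph_act (g : G) (x : W) : W := (fun h => x.1 (h * g)%g, srep_act g x.2).
Definition graph_base : W := (cell_fun tau, v).
Local Notation act := graph_act.

(* It will turn out to be the graph of a G-map onto V from an induced representation. *)
Definition graph : set W := orbit_span act graph_base.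

Lemma graph_act_linear g : linear (act g).
Proof. by move=> a x y; congr pair; rewrite /= srep_linear. Qed.

Lemma graph_act1 x : act 1%g x = x.
Proof.
case: x => f x; congr pair; last exact: srep_act1.
by apply/funext => h; rewrite mulg1.
Qed.

Lemma graph_actM g h x : act (g * h)%g x = act g (act h x).
Proof.
congr pair; last exact: srep_actM.
by apply/funext => h'; rewrite mulgA.
Qed.

Lemma graph_fst_sum (I : Type) (r : seq I) (F : I -> W) g :
  (\sum_(i <- r) F i).1 g = \sum_(i <- r) (F i).1 g.
Proof. exact: (big_morph (fun x : W => x.1 g)). Qed.

Lemma graph_snd_sum (I : Type) (r : seq I) (F : I -> W) :
  (\sum_(i <- r) F i).2 = \sum_(i <- r) (F i).2.
Proof. exact: (big_morph (fun x : W => x.2)). Qed.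

Lemma graph_ext (x y : W) : x.1 =1 y.1 -> x.2 = y.2 -> x = y.
Proof. by case: x y => [f x] [f' y] /= /funext-> ->. Qed.

Lemma graph_base_fixed : upper_fixed act graph_base.
Proof.
move=> a ha; apply: graph_ext => [g|]; first exact: cell_fun_upper.
exact: ord_fixed ov _ ha.
Qed.

Lemma graph_base_hecke : hecke_op act graph_base = lam *: graph_base.
Proof.
apply: graph_ext => [g|]; last by rewrite graph_snd_sum; exact: ordinary_hecke ov.
rewrite graph_fst_sum -[RHS]/(lam * cell_fun tau g) -[X in X * _](tor_value_p L0 lam' ov).
exact: cell_fun_hecke tauM g.
Qed.

Lemma graph_base_tor y : N (Nm y) = 1 ->
  exists d, act (tor y) graph_base = d *: graph_base.
Proof.
move=> y1; exists (tau y); apply: graph_ext => [g|]; first exact: (cell_fun_tor tauM).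
exact: (tor_value_unit L0 lam' ov y1).
Qed.

Lemma graph_base_smooth : exists2 K : set G, open_subgroup K &
  forall g, K g -> act g graph_base = graph_base.
Proof.
have [K oK cK] := cell_fun_smooth tauM (tor_value_smooth L0 lam' ov).
have [K' oK' vK] := srep_smooth v; exists (K `&` K'); first exact: open_subgroupI.
by move=> g [Kg K'g]; apply: graph_ext => [h|]; [exact: cK|exact: vK].
Qed.

Lemma graph_base_lower : exists m : nat, forall a, ball m%:Z a ->
  act (lower a) graph_base = graph_base.
Proof.
have [K oK EK] := graph_base_smooth; have [m mK] := open_subgroup_lower oK.
by exists m => a /mK/EK.
Qed.

Lemma graph_actP g x : graph x -> graph (act g x).
Proof. exact: (orbit_span_act graph_act_linear graph_actM). Qed.

Lemma graph_normal_form x : graph x ->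
  exists d, borel_span act graph_base (x - d *: act weyl graph_base).
Proof.
exact: (orbit_span_normal_form graph_act_linear graph_act1 graph_actM lamV
  graph_base_fixed graph_base_hecke graph_base_tor graph_base_lower).
Qed.

Lemma borel_graph_level x : borel_span act graph_base x ->
  exists n (a : 'I_(q ^ (n + n)) -> A),
    x = \sum_i a i *: act (upper (- grid n i)) (act (tor (p%:R ^+ n)) graph_base).
Proof.
move=> /(borel_span_level graph_act_linear graph_actM lamV graph_base_fixed
  graph_base_hecke graph_base_tor)[n /lspan_finP[a ->]].
by exists n, a.
Qed.

Lemma level_fst n (a : 'I_(q ^ (n + n)) -> A) b :
  (\sum_i a i *: act (upper (- grid n i)) (act (tor (p%:R ^+ n)) graph_base)).1
    (weyl * upper b)%g =
  \sum_i a i * tau (p%:R ^+ n) * (ball n%:Z (b - grid n i))%:R.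
Proof.
rewrite graph_fst_sum; apply: eq_bigr => i _.
by rewrite -mulrA -(cell_fun_weyl_ball tauM tau1).
Qed.

Lemma borel_graph_fst1 x : borel_span act graph_base x -> x.1 1%g = 0.
Proof.
move: x; apply: lspan_min => [|_ [g g0 <-] /=]; last by rewrite mul1g cell_fun_borel.
split=> [//|x y /= hx hy|r x /= hx]; first by rewrite -[LHS]/(x.1 _ + y.1 _) hx hy addr0.
by rewrite -[LHS]/(r * x.1 _) hx mulr0.
Qed.

Lemma borel_graph_snd_eq0 x : borel_span act graph_base x -> x.2 = 0 -> x = 0.
Proof.
move=> /borel_graph_level[n [a ->]]; rewrite graph_snd_sum => x0; apply: big1 => i _.
rewrite (ordinary_translate_indep L0 ov (a := a) (enum_uniq _) _ (mem_enum _ i)).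
  exact: scale0r.
by rewrite big_enum.
Qed.

Lemma borel_graph_fst_eq0 x : borel_span act graph_base x ->
  (forall b, x.1 (weyl * upper b)%g = 0) -> x = 0.
Proof.
move=> /borel_graph_level[n [a ->]] x0; apply: big1 => i _.
have [j ij] := grid_partition n (ball_grid n i).
have ii : j = i by apply/eqP; rewrite eq_sym -ij subrr ball0.
have := x0 (grid n i); rewrite level_fst (big_ord_pred1 _ ij) ii.
have [d hd] := tor_value_invertible L0 ov lamV (pX_neq0 n).
move=> /(congr1 ( *%R^~ d)); rewrite /= -mulrA hd mulr1 mul0r => ->.
exact: scale0r.
Qed.

Lemma graph_borel_span x : graph x -> x.1 1%g = 0 -> borel_span act graph_base x.
Proof.
move=> /graph_normal_form[d hx] x1; have := borel_graph_fst1 hx.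
rewrite -[LHS]/(x.1 1%g - d * cell_fun tau (1 * weyl)%g) x1 mul1g (cell_fun_weyl tau1).
rewrite mulr1 sub0r => /eqP; rewrite oppr_eq0 => /eqP d0.
by move: hx; rewrite d0 scale0r subr0.
Qed.

Lemma graph_functional x : graph (0, x) -> x = 0.
Proof.
move=> hx; have /borel_graph_fst_eq0 := graph_borel_span hx erefl.
by move=> /(_ (fun=> erefl))/(congr1 snd).
Qed.

Lemma graph_kernel_eq0 f : graph (f, 0) -> f 1%g = 0 -> f =1 fun=> 0.
Proof.
move=> hf f1 g; have /borel_graph_snd_eq0 := graph_borel_span hf f1.
by move=> /(_ erefl)/(congr1 (fun x => x.1 g)).
Qed.

Lemma borel_graph_snd_surj u : exists2 x, borel_span act graph_base x & x.2 = u.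
Proof.
move: u (ordinary_translate_span L0 ov u).
apply: lspan_min => [|_ [[n r] _ <-]]; last first.
  exists (act (upper r * tor (p%:R ^+ n))%g graph_base); last by rewrite -srep_actM.
  apply: mem_borel_span.
  by rewrite bot_left_borelM ?bot_left_upper ?bot_left_tor ?pX_neq0.
split=> [|u u' [x hx <-] [x' hx' <-]|r u [x hx <-]].
- by exists 0 => //; exact: lspan0.
- by exists (x + x') => //; exact: lspanD.
- by exists (r *: x) => //; exact: lspanZ.
Qed.

(* w E and the Borel orbit of E have the same projection to V. *)
Lemma graph_kernel_ex : exists f0 : G -> A, graph (f0 : G -> A^o, 0) /\ f0 1%g = 1.
Proof.
have [y hy y2] := borel_graph_snd_surj (srep_act weyl v).
exists (act weyl graph_base - y).1; split.
  have -> : ((act weyl graph_base - y).1, 0) = act weyl graph_base - y.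
    by apply: graph_ext => //=; rewrite y2 subrr.
  by apply: lspanB; [exact: mem_orbit_span|exact: borel_orbit_span].
rewrite -[LHS]/(cell_fun tau (1 * weyl)%g - y.1 1%g) (borel_graph_fst1 hy) mul1g subr0.
exact: cell_fun_weyl tau1.
Qed.

Lemma graph_borel_mul x y b g : graph x -> y != 0 ->
  x.1 (tor y * upper b * g)%g = tau (c y)^-1 * x.1 g.
Proof.
move=> hx y0; move: x hx; apply: lspan_min => [|_ [h _ <-] /=]; last first.
  by rewrite -mulgA (cell_fun_borel_mul tauM).
split=> [|x x' /= hx hx'|r x /= hx]; first by rewrite /= mulr0.
  by rewrite -[LHS]/(x.1 _ + x'.1 _) hx hx' -mulrDr.
by rewrite -[LHS]/(r * x.1 _) hx mulrCA.
Qed.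

Lemma graph_smooth x : graph x -> exists2 K : set G, open_subgroup K &
  forall g h, K h -> x.1 (g * h)%g = x.1 g.
Proof.
have [K0 oK0 cK] := cell_fun_smooth tauM (tor_value_smooth L0 lam' ov).
move: x; apply: lspan_min => [|_ [h _ <-] /=]; last first.
  exists [set g | K0 (h^-1 * g * h)%g]; first exact: open_subgroup_conj.
  by move=> g g' /(cK (g * h)%g); rewrite !mulgA mulgK.
split=> [|x y [K oK xK] [K' oK' yK]|r x [K oK xK]].
- by exists setT => //; exact: open_subgroupT.
- exists (K `&` K'); first exact: open_subgroupI.
  by move=> g h [/xK hx /yK hy]; rewrite -[LHS]/(x.1 _ + y.1 _) hx hy.
- by exists K => // g h /xK hx; rewrite -[LHS]/(r * x.1 _) hx.
Qed.

Section Kernel.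
Variable f0 : G -> A.
Hypotheses (f0_graph : graph (f0 : G -> A^o, 0)) (f01 : f0 1%g = 1).

(* The first components of the graph over 0 form the line A f0, which is G-stable. *)
Lemma graph_kernelM g h : f0 (g * h)%g = f0 g * f0 h.
Proof.
have hG : graph (act h (f0 : G -> A^o, 0) - f0 h *: ((f0 : G -> A^o, 0) : W)).
  by apply: lspanB; [exact: graph_actP|exact: lspanZ].
have E : act h (f0 : G -> A^o, 0) - f0 h *: ((f0 : G -> A^o, 0) : W) =
    (fun g => f0 (g * h)%g - f0 h * f0 g : A^o, 0).
  by apply: graph_ext => //=; rewrite (morphD0 (srep_actD _)) scaler0 subr0.
rewrite E in hG; apply/eqP; rewrite mulrC -subr_eq0; apply/eqP.
by apply: (graph_kernel_eq0 hG); rewrite mul1g f01 mulr1 subrr.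
Qed.

Lemma graph_kernel_smooth : exists2 K : set G, open_subgroup K &
  forall g, K g -> f0 g = 1.
Proof.
have [K oK hK] := graph_smooth f0_graph; exists K => // g /(hK 1%g).
by rewrite mul1g /= f01.
Qed.

Definition kernel_char : schar G A := SChar f01 graph_kernelM graph_kernel_smooth.

Lemma kernel_char_tor y : y != 0 -> kernel_char (tor y) = tau (c y)^-1.
Proof.
move=> y0; have := graph_borel_mul 0 1%g f0_graph y0.
by rewrite /= upper0 !mulg1 f01 mulr1.
Qed.

Lemma graph_ind x : graph x -> x.1 \in ind_pred kernel_char.
Proof.
move=> hx; apply/ind_predP; split; last exact: graph_smooth.
move=> g u h /torus_tor[y y0 ->] /unipotent_upper[b ->].
by rewrite graph_borel_mul // kernel_char_tor.
Qed.

Lemma graph_total (f : ind kernel_char) : exists x, graph (f : G -> A^o, x).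
Proof.
have [n /stepfun_expand fE] := ind_eval_stepfun f.
have [d hd] := tor_value_invertible L0 ov lamV (pX_neq0 n).
pose y : W := f 1%g *: ((f0 : G -> A^o, 0) : W) + \sum_(i < q ^ (n + n))
  (ind_eval f (grid n i) * d) *:
    act (upper (- grid n i)) (act (tor (p%:R ^+ n)) graph_base).
have hy : graph y.
  apply: lspanD; first exact: lspanZ.
  apply: lspan_sum => i _ _; apply: lspanZ; rewrite -graph_actM.
  exact: mem_orbit_span.
have f_fst : f = Ind (graph_ind hy).
  apply: ind_ext => [|a] /=.
    rewrite -[RHS]/(f 1%g * f0 1%g + (\sum_i _ *: _).1 1%g) f01 mulr1.
    rewrite (_ : (\sum_i _ *: _).1 1%g = 0) ?addr0 // graph_fst_sum big1 // => i _.
    set b := _ * d; rewrite -[LHS]/(b * cell_fun tau (1 * upper _ * tor _)%g) mul1g.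
    rewrite cell_fun_borel ?mulr0 // bot_left_borelM ?bot_left_upper //.
    by rewrite bot_left_tor ?pX_neq0.
  rewrite -[RHS]/(f 1%g * f0 (weyl * upper a)%g + (\sum_i _ *: _).1 (weyl * upper a)%g).
  rewrite level_fst graph_kernelM (_ : f0 (upper a) = 1); last first.
    exact: (schar_upper kernel_char).
  under eq_bigr do rewrite -(mulrA _ d) (mulrC d) hd mulr1.
  have := congr1 (fun h => h a) fE; rewrite fct_sumE /ind_eval => <-.
  by rewrite mulr1 addrC subrK.
exists y.2; suff -> : (f : G -> A^o) = y.1 by rewrite -surjective_pairing.
by rewrite [in LHS]f_fst.
Qed.

Lemma graph_unique (f f' : ind kernel_char) x x' a :
  graph (f : G -> A^o, x) -> graph (f' : G -> A^o, x') ->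
  (forall g, f g - f' g = a * kernel_char g) -> x = x'.
Proof.
move=> hx hx' ff; apply/eqP; rewrite -subr_eq0; apply/eqP/graph_functional.
have := lspanB (lspanB hx hx') (lspanZ a f0_graph).
congr graph; apply: graph_ext => [g|] /=; last by rewrite scaler0 subr0.
by rewrite -[LHS]/(f g - f' g - a * f0 g) ff subrr.
Qed.

End Kernel.

End Graph.

Section SteinbergGraph.
Variables (chi : schar G k) (A : artAlg res).
Local Notation pi0 := (twist_rep chi (steinberg hp c k)).
Local Notation M0 := (twist_model chi (St_model (triv_char G k))).
Local Notation rA := (art_res A).
Variables (V : srep G A) (phi : V -> pi0).
Hypothesis L0 : is_lift phi.
Variables (v : V) (lam lam' : A).
Hypotheses (ov : ordinary M0 phi v lam) (lamV : lam * lam' = 1).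
Local Notation W := ((G -> A^o) * V)%type.
Local Notation graph := (graph v lam lam').
Local Notation tau := (tor_value v lam lam').

Lemma cell_fun_res g : chi (g^-1)%g * rA (cell_fun tau g) =
  chi weyl * cell_fun (fun x => triv_char G k (tor x)) g.
Proof.
rewrite /cell_fun rmorphM rmorph_nat mulr1.
have [g0|g0] := eqVneq (bot_left g) 0; first by rewrite mul0r !mulr0.
have E : chi (g^-1)%g * chi (tor (bot_left g)) = chi weyl.
  rewrite -[RHS]mulr1 -(scharV chi g) [in RHS](schar_bigcell chi g0).
  transitivity (chi weyl * chi weyl * (chi (g^-1)%g * chi (tor (bot_left g)))).
    by rewrite schar_weylK mul1r.
  by ring.
by rewrite (tor_value_res L0 ov lamV g0) mulrCA E mulrC.
Qed.

Lemma graph_res x : graph x -> exists2 f : ind (triv_char G k),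
  forall h, f h = chi (h^-1)%g * rA (x.1 h) & St_class hp f = phi x.2.
Proof.
move: x; apply: lspan_min => [|_ [g _ <-] /=]; last first.
  exists (chi g *: ind_act hp g (chi weyl *: St_cell (triv_char G k))) => [h|].
    rewrite -[LHS]/(chi g * (chi weyl * cell_fun _ (h * g)%g)) -cell_fun_res.
    rewrite invgM scharM !mulrA; congr (_ * _).
    by rewrite scharV mul1r.
  rewrite (lift_equiv L0) (ord_base ov).
  rewrite -[RHS]/(chi g *: srep_act g (_ : steinberg hp c k)).
  by rewrite St_classZ -St_class_act St_classZ.
split=> [|x y [f fE fx] [f' f'E f'y]|r x [f fE fx]].
- exists 0; last by rewrite (morphD0 (lift_add L0)) (St_class0 (triv_char G k)).
  by move=> h; rewrite rmorph0 mulr0.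
- exists (f + f') => [h|]; last by rewrite St_classD (lift_add L0) fx f'y.
  by rewrite -[LHS]/(f h + f' h) fE f'E -mulrDr -rmorphD.
- exists (rA r *: f) => [h|]; last by rewrite St_classZ (lift_scale L0) fx.
  by rewrite -[LHS]/(rA r * f h) fE mulrCA -rmorphM.
Qed.

Section Kernel.
Variable f0 : G -> A.
Hypotheses (f0_graph : graph (f0 : G -> A^o, 0)) (f01 : f0 1%g = 1).
Local Notation s0 := (kernel_char L0 ov lamV f0_graph f01).

Lemma kernel_char_res g : rA (s0 g) = chi g.
Proof.
have [f fE] := graph_res f0_graph; rewrite /= (morphD0 (lift_add L0)) => f_0.
have [a ha] : exists a, forall h, f h - 0 = a * 1.
  apply: (quotient_classP (char_line_sub hp _) f 0).1.
  exact: etrans f_0 (esym (St_class0 _)).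
have : f g = f 1%g by rewrite -[f g]subr0 -[f 1%g]subr0 !ha.
rewrite !fE /= f01 rmorph1 invg1 schar1 !mulr1 => E.
by rewrite -[RHS]mulr1 -E mulrA scharV mul1r.
Qed.

Definition kernel_lift : char_lift chi A := CharLift kernel_char_res.

Lemma St_kernel_iso : lift_iso (Lift (St_map_is_lift kernel_lift)) (Lift L0).
Proof.
have [psi psiP] := choice (fun f : ind s0 => graph_total f).
pose Psi (x : St_rep hp kernel_lift) : V := psi (mrepr x).
have PsiE (f : ind kernel_lift) x : graph (f : G -> A^o, x) -> Psi (St_class hp f) = x.
  move=> hx; have [a ha] := quotient_repr (char_line_sub hp kernel_lift) f.
  by apply: (graph_unique (psiP _) hx (a := a)) => g; rewrite -ha.
apply: (lift_morphism_iso res_surj (l := Lift _) (l' := Lift L0) (psi := Psi)).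
- move=> a; elim/St_classW=> f; elim/St_classW=> f'.
  rewrite -St_classZ -St_classD (PsiE f _ (psiP f)) (PsiE f' _ (psiP f')).
  by apply: PsiE; exact: lspanD (lspanZ a (psiP f)) (psiP f').
- move=> g; elim/St_classW=> f; rewrite St_class_act (PsiE f _ (psiP f)); apply: PsiE.
  exact: (graph_actP g (psiP f)).
- elim/St_classW=> f; rewrite (PsiE f _ (psiP f)) /= St_map_class.
  have [f' f'E <-] := graph_res (psiP f); congr St_class.
  by apply: val_inj; apply/funext => h; rewrite /= f'E.
Qed.

End Kernel.

End SteinbergGraph.

Lemma lift_steinberg_ex (chi : schar G k) (A : artAlg res)
    (l : Defs.lift (twist_rep chi (steinberg hp c k)) A) :
  exists s : char_lift chi A, lift_iso (Lift (St_map_is_lift s)) l.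
Proof.
case: l => V phi L0; pose M0 := twist_model chi (St_model (triv_char G k)).
have [v [lam ov]] := ordinary_ex M0 L0; have [lam' lamV] := ordinary_unit ov.
have [f0 [f0_graph f01]] := graph_kernel_ex L0 lam' ov.
exists (kernel_lift L0 ov lamV f0_graph f01).
exact: St_kernel_iso.
Qed.

Lemma schar_ext_tor (R : comNzRingType) (s s' : schar G R) :
  s (tor p%:R) = s' (tor p%:R) ->
  (forall z, N (Nm z) = 1 -> s (tor z) = s' (tor z)) -> s = s'.
Proof.
move=> sp su; apply: schar_ext.
have sX n : s (tor (p%:R ^+ n)) = s' (tor (p%:R ^+ n)).
  elim: n => [|n IHn]; first by rewrite expr0 tor1 !schar1.
  by rewrite exprS torM ?p_neq0 ?pX_neq0 // !scharM sp IHn.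
have sT y : y != 0 -> s (tor y) = s' (tor y).
  move=> /(unramified_decomp unr)[i [z [z1 ->]]].
  rewrite torM ?pXz_neq0 ?Nm_norm1_neq0 // !scharM (su z) //; congr (_ * _).
  case: i => [n|n]; first exact: sX.
  apply: (schar_eq_div (h := tor (p%:R ^+ n.+1))) => //.
  by rewrite -torM ?pX_neq0 ?pXz_neq0 // NegzE -exprnN mulVf ?pX_neq0 // tor1 !schar1.
have sw : s weyl = s' weyl.
  by rewrite !schar_weylE sT // oppr_eq0 invr_eq0 traceless_neq0.
move=> g; have [g0|g0] := eqVneq (bot_left g) 0; last first.
  by rewrite (schar_bigcell s g0) (schar_bigcell s' g0) sT // sw.
have [y [a [y0 ->]]] := borel_decomp g0.
by rewrite !scharM !schar_upper sT.
Qed.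

Section SteinbergInjectivity.
Variables (chi : schar G k) (A : artAlg res).
Local Notation M0 := (twist_model chi (St_model (triv_char G k))).
Local Notation rA := (art_res A).

Lemma St_base_ordinary (s : char_lift chi A) :
  ordinary M0 (St_map hp s) (cm_base (St_model s)) (s (tor p%:R)).
Proof.
split; last exact: char_lift_res.
- apply: (cellm_ext (M := M0)) => a; rewrite St_map_eval !base_eval.
  exact: rmorph_nat.
- exact: base_fixed.
- by rewrite base_hecke subrr; exact: lspan0.
Qed.

Lemma St_lift_inj (s s' : char_lift chi A)
    (H : is_lift (St_map hp s)) (H' : is_lift (St_map hp s')) :
  lift_iso (Lift H) (Lift H') -> s = s'.
Proof.
case=> psi [psi_lin _ psi_act psi_map].
have ov := ordinary_morphism psi_lin psi_act psi_map (St_base_ordinary s).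
have ov' := St_base_ordinary s'.
suff ss : s = s' :> schar G A by apply: char_lift_ext => g; rewrite ss.
apply: schar_ext_tor => [|z z1].
  exact: (ordinary_eigenvalue_unique H' (@heckeZ _ _) ov ov'
    (ordinary_hecke ov) (ordinary_hecke ov')).
apply: (ordinary_eigenvalue_unique H' (srep_actZ (tor z)) ov ov').
  by rewrite -psi_act (base_tor (St_model s) z1) (scalable_linear psi_lin).
exact: base_tor (St_model s') z z1.
Qed.

End SteinbergInjectivity.

Section SteinbergDeformations.
Variable chi : schar G k.

Definition St_def (A : artAlg res) (s : char_lift chi A) :
  Def res_surj (twist_rep chi (steinberg hp c k)) A :=
  lift_class (Lift (St_map_is_lift s)).

Lemma St_def_bij (A : artAlg res) : bijective (@St_def A).
Proof.
apply: inj_surj_bij => [s s' /lift_classP|X]; first exact: St_lift_inj.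
have [s hs] := lift_steinberg_ex (class_rep X); exists s.
by rewrite -[RHS]class_repK; apply/lift_classP.
Qed.

Lemma def_map_St_def (A A' : artAlg res) (h : artHom A A') (s : char_lift chi A) :
  af_map h (St_def s) = St_def (push_char res_surj h s).
Proof. by rewrite /= def_map_class; apply/lift_classP; exact: bc_St_iso. Qed.

End SteinbergDeformations.

End UnitarySteinberg.

Theorem mainTheorem4
  (p : nat) (hp : prime p) (Qp : padicField p)
  (Qp2 : fieldExtType Qp) (Qp2_quadratic : \dim {: Qp2} = 2%N)
  (Qp2_unramified : unramified Qp2)
  (c : {lrmorphism Qp2 -> Qp2}) (c_nontrivial : exists x, c x <> x)
  (E : fieldExtType Qp)
  (k : fieldType) (res : {rmorphism intRing E -> k})
  (res_surj : forall y : k, exists x : intRing E, res x = y)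
  (chi : schar (U11 c) k) :
  exists eta : forall A : artAlg res,
      Def res_surj (char_rep chi) A ->
      Def res_surj (twist_rep chi (steinberg hp c k)) A,
    (forall (A : artAlg res) (sigma : char_lift chi A),
       exists St_is_lift : is_lift (St_map hp sigma),
         eta A (lift_class (lift_of_char res_surj sigma)) =
         lift_class (Lift St_is_lift)) /\
    natural_iso eta.
Proof.
have two0 : (2%:R : Qp2) != 0 by rewrite padic_natr_neq0.
have [e] := tracelessGen_ex two0 Qp2_quadratic c_nontrivial.
pose eta A (X : Def res_surj (char_rep chi) A) := St_def hp e res_surj (char_of_def X).
exists eta; split=> [A sigma|].
  exists (St_map_is_lift hp e res_surj sigma).
  by rewrite -[lift_class _]/(char_def res_surj sigma) /eta char_defK.
split=> [A A' h X|A].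
  rewrite -(char_of_defK X) def_map_char_def /eta !char_defK.
  by rewrite def_map_St_def.
apply: bij_comp (St_def_bij hp e res_surj Qp2_unramified chi A) _.
by exists (@char_def _ _ _ _ res_surj chi A); [exact: char_of_defK|exact: char_defK].
Qed.
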